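(* Let $w=(w_j)$ be a decreasing sequence of positive numbers such that $w_1=1$ and $w\in c_0\setminus\ell_1$. With any compatible ordering, the monomials associated with the canonical basis of the Lorentz predual $d_*(w,1)$ form a Schauder basis of $(\mathcal H(d_*(w,1)),\tau_0)$.
   Context: Put $W_m=\sum_{j=1}^mw_j$. For a null scalar sequence $x$, $(x_j^* )$ denotes the decreasing rearrangement of $(|x_j|)$. The Lorentz predual is $$d_*(w,1)=\left\{x\in c_0:\lim_{m\to\infty}\frac{\sum_{j=1}^mx_j^*}{W_m}=0\right\},\qquad \|x\|_*=\sup_{m\ge1}\frac{\sum_{j=1}^mx_j^*}{W_m},$$ with complex scalars. Its canonical basis is the sequence of canonical unit vectors $(e_j)$. $\mathcal H(X)$ is the space of entire holomorphic functions $X\to\mathbb C$, and $\tau_0$ is the compact-open topology, generated by the seminorms $\|f\|_K=\sup_{x\in K}|f(x)|$, $K\subset X$ compact. A Schauder basis of a locally convex space is understood in the usual sense (unique convergent expansions with continuous coefficient functionals). For a Schauder basis $(e_j)$ with coefficient functionals $(e_j^* )$, the associated monomials are $e^{*\alpha}(x)=\prod_je_j^*(x)^{\alpha_j}$, where $\alpha=(\alpha_j)_{j\ge1}$ ranges over finitely supported multi-indices with entries in $\mathbb N_0$; $|\alpha|=\sum_j\alpha_j$ is the degree and $\operatorname{len}(\alpha)=\max\operatorname{supp}(\alpha)$, $\operatorname{len}(0)=0$. Square order: for multi-indices of the same degree, $\alpha\prec\beta$ if either $\operatorname{len}(\alpha)<\operatorname{len}(\beta)$, or $\operatorname{len}(\alpha)=\operatorname{len}(\beta)$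 and $\alpha_j<\beta_j$ for $j=\max\{i:\alpha_i\ne\beta_i\}$. An ordering (enumeration as a sequence) of all monomials is compatible if, for every $n\in\mathbb N_0$, its restriction to the degree-$n$ monomials agrees with the square order. *)

(* Defs.v *)
From HB Require Import structures.
From mathcomp Require Import all_boot all_order all_algebra finmap.
From mathcomp Require Import all_classical all_reals all_analysis.
From mathcomp Require Import complex.
Set Implicit Arguments.
Unset Strict Implicit.
Unset Printing Implicit Defensive.
Import Order.TTheory GRing.Theory Num.Theory numFieldNormedType.Exports.
Import Normc.
Local Open Scope classical_set_scope.
Local Open Scope ring_scope.
Local Open Scope complex_scope.
Local Open Scope convex_scope.

Section rearrangement.
Context {R : realType}.
Implicit Types (a b : nat -> R) (n m : nat) (s : seq nat).

(** Zero-based: for a nonnegative null sequence [a], this is its (n+1)-st largest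
    term counted with multiplicity, written through the distribution function
    of [a]. *)
Definition decreasing_rearrangement a n : R :=
  inf [set t | 0 <= t /\ ([set j | (t < a j)%R] #<= `I_n)%card].

Definition rsum a m : R := \sum_(k < m) decreasing_rearrangement a k.

Lemma rearr_set_size a n t s : uniq s -> {in s, forall j, t < a j} ->
  ([set j | (t < a j)%R] #<= `I_n)%card -> (size s <= n)%N.
Proof.
move=> us sA An.
have fA : finite_set [set j | (t < a j)%R] by apply/finite_set_leP; exists n.
apply: leq_trans (geq_card_fset_set An).
apply: uniq_leq_size => // j js; rewrite in_fset_set// inE /=.
exact: sA.
Qed.

Lemma rearr_set_of_seq a t s : (forall j, t < a j -> j \in s) ->
  ([set j | (t < a j)%R] #<= `I_(size s))%card.
Proof.
move=> H; apply: (card_le_trans (subset_card_le _) (card_image_le (nth 0%N s) _)).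
by move=> j /= /H js; exists (index j s); rewrite /= ?index_mem ?nth_index.
Qed.

Lemma rearr_lb a n : has_lbound [set t | 0 <= t /\ ([set j | (t < a j)%R] #<= `I_n)%card].
Proof. by exists 0 => t []. Qed.

Lemma rearr_nonempty a n M : (forall j, a j <= M) ->
  [set t | 0 <= t /\ ([set j | (t < a j)%R] #<= `I_n)%card] !=set0.
Proof.
move=> aM; exists (Num.max 0 M); split; first by rewrite le_max lexx.
suff -> : [set j | (Num.max 0 M < a j)%R] = set0 by exact: card_ge0.
by apply/seteqP; split=> // j /=; rewrite ltNge le_max aM orbT.
Qed.

Lemma rsum_ge a M s : (forall j, a j <= M) -> uniq s ->
  \sum_(j <- s) a j <= rsum a (size s).
Proof.
move=> aM; move En : (size s) => n; elim: n s En => [|n IH] s sn us.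
  by rewrite (size0nil sn) big_nil /rsum big_ord0.
have [j0 j0s j0P] : exists2 j0, j0 \in s & {in s, forall j, a j0 <= a j}.
  case: s sn us => // k s _ _.
  have /orP kk : k \in k :: s by rewrite mem_head.
  pose i := [arg min_(i < Ordinal (ltn0Sn (size s))) a (nth 0%N (k :: s) i)]%O.
  exists (nth 0%N (k :: s) i); first exact: mem_nth.
  rewrite /i; case: arg_minP => //= i0 _ i0P j js.
  have jk : (index j (k :: s) < (size s).+1)%N by rewrite -[(size s).+1]/(size (k :: s)) index_mem.
  by have := i0P (Ordinal jk) isT; rewrite [X in _ <= a X -> _]nth_index.
rewrite (perm_big _ (perm_to_rem j0s)) big_cons /rsum big_ord_recr /= addrC.
apply: lerD.
  by apply: IH; [rewrite size_rem// sn|exact: rem_uniq].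
apply: lb_le_inf (rearr_nonempty _ aM) _ => t [t0 tn].
rewrite leNgt; apply/negP => taj0.
suff : (n.+1 <= n)%N by rewrite ltnn.
rewrite -sn; apply: rearr_set_size tn => // j /j0P; exact: lt_le_trans.
Qed.

Lemma rsum_le a m e : (forall j, 0 <= a j) -> 0 < e ->
  exists s, [/\ uniq s, size s = m & rsum a m <= \sum_(j <- s) (a j + e)].
Proof.
move=> a0 e0; elim: m => [|m [s [us sm IH]]].
  by exists [::]; split; rewrite // big_nil /rsum big_ord0.
suff [j js jP] : exists2 j, j \notin s & decreasing_rearrangement a m <= a j + e.
  exists (j :: s); split; rewrite /= ?js ?sm//.
  by rewrite big_cons addrC /rsum big_ord_recr lerD.
apply: contrapT => H.
have {}H j : j \notin s -> a j < decreasing_rearrangement a m - e.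
  move=> js; rewrite ltrBrDr ltNge; apply/negP => jP; apply: H; by exists j.
have [j js] : exists j, j \notin s.
  exists (\max_(i <- s) i).+1; apply/negP => js.
  by have := @leq_bigmax_seq _ s xpredT id _ js isT; rewrite ltnn.
have := H _ js; set t := _ - e => jt.
suff : decreasing_rearrangement a m <= t by rewrite /t leNgt ltrBlDr ltrDl e0.
apply: ge_inf; first exact: rearr_lb.
split; first exact: le_trans (a0 j) (ltW jt).
rewrite -sm; apply: rearr_set_of_seq => k; apply: contraTT => ks.
by rewrite -leNgt ltW// H.
Qed.

Lemma rsum_leW a m (x : R) : (forall j, 0 <= a j) ->
  (forall s, uniq s -> size s = m -> \sum_(j <- s) a j <= x) -> rsum a m <= x.
Proof.
move=> a0 H; apply/ler_addgt0Pl => e e0.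
have e'0 : 0 < e / m.+1%:R by rewrite divr_gt0.
have [s [us sm]] := rsum_le m a0 e'0.
move=> /le_trans; apply; rewrite big_split /= addrC lerD ?H//.
rewrite big_const_seq iter_addr addr0 count_predT sm -[_ *+ m]mulr_natr -mulrA.
by rewrite ler_piMr ?(ltW e0)// mulrC ler_pdivrMr// mul1r ler_nat.
Qed.

Lemma rsumD a b c Ma Mb m : (forall j, a j <= Ma) -> (forall j, b j <= Mb) ->
  (forall j, 0 <= c j <= a j + b j) -> rsum c m <= rsum a m + rsum b m.
Proof.
move=> aM bM cab; apply: rsum_leW => [j|s us <-]; first by case/andP: (cab j).
apply: (@le_trans _ _ (\sum_(j <- s) (a j + b j))).
  by apply: ler_sum => j _; case/andP: (cab j).
by rewrite big_split lerD// (rsum_ge aM, rsum_ge bM).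
Qed.

Lemma rsum_mono a c Ma m : (forall j, a j <= Ma) ->
  (forall j, 0 <= c j <= a j) -> rsum c m <= rsum a m.
Proof.
move=> aM ca; apply: rsum_leW => [j|s us <-]; first by case/andP: (ca j).
apply: le_trans (rsum_ge aM us).
by apply: ler_sum => j _; case/andP: (ca j).
Qed.

Lemma rsumZ a M r m : (forall j, 0 <= a j <= M) -> 0 <= r ->
  rsum (fun j => r * a j) m = r * rsum a m.
Proof.
have le b N q : (forall j, 0 <= b j <= N) -> 0 <= q ->
    rsum (fun j => q * b j) m <= q * rsum b m.
  move=> bN q0; apply: rsum_leW => [j|s us <-].
    by rewrite mulr_ge0//; case/andP: (bN j).
  rewrite -mulr_sumr ler_wpM2l//; apply: (@rsum_ge _ N) => // j.
  by case/andP: (bN j).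
move=> aM r0; apply/eqP; rewrite eq_le (le _ M)//=.
have [->|rn0] := eqVneq r 0.
  rewrite mul0r /rsum sumr_ge0// => k _.
  by apply: lb_le_inf => [|t []//]; apply: (@rearr_nonempty _ _ 0) => j; rewrite mul0r.
have rgt0 : 0 < r by rewrite lt_def rn0.
rewrite -ler_pdivlMl//.
apply: le_trans (le (fun j => r * a j) (r * M) r^-1 _ _); last 2 first.
- by move=> j; have /andP[? ?] := aM j; rewrite mulr_ge0//= ler_wpM2l.
- by rewrite invr_ge0.
rewrite le_eqVlt; apply/orP; left; apply/eqP; congr rsum; apply/funext => j.
by rewrite mulrA mulVf// mul1r.
Qed.

Lemma rearr_ge0 a n : 0 <= decreasing_rearrangement a n.
Proof.
have [E0|/set0P E0] := eqVneq [set t | 0 <= t /\ ([set j | (t < a j)%R] #<= `I_n)%card] set0.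
  by rewrite /decreasing_rearrangement E0 inf0.
by apply: lb_le_inf => // t [].
Qed.

Lemma rsum_ge0 a m : 0 <= rsum a m.
Proof. by apply: sumr_ge0 => k _; exact: rearr_ge0. Qed.

Lemma le_rsum1 a M m j : (forall j, 0 <= a j <= M) -> (0 < m)%N -> a j <= rsum a m.
Proof.
move=> aM m0; have := @rsum_ge a M [:: j] _ isT.
rewrite big_seq1 /=; move=> /(_ _)/le_trans; apply.
  by move=> k; case/andP: (aM k).
case: m m0 => // m _; rewrite /rsum !big_ord_recl big_ord0 addr0 lerDl sumr_ge0// => k _.
exact: rearr_ge0.
Qed.

End rearrangement.

Section lorentz_sequences.
Context {R : realType}.
Implicit Types (x y : nat -> R[i]^o) (n m j : nat).

(** Zero-based: [w j] is the weight usually called w_(j+1). Decreasing is meant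
    in the non-strict sense. *)
Record lorentz_weight := LorentzWeight {
  lweight :> nat -> R;
  lweight_gt0 : forall j, 0 < lweight j;
  lweight_nonincreasing : nonincreasing_seq lweight;
  lweight0 : lweight 0%N = 1;
  lweight_cvg0 : lweight @ \oo --> 0;
  lweight_not_summable : ~ cvgn [normed series lweight] }.

(** Entry [m] is the quotient of the sums of the first m+1 terms. [normc] is the
    real-valued modulus on [R[i]]; the regular module [R[i]^o] is the copy of
    [R[i]] carrying the topology and the normed module structure. *)
Definition lorentz_ratio (w : lorentz_weight) x m : R :=
  (\sum_(j < m.+1) decreasing_rearrangement (fun i => normc (x i)) j) /
  (\sum_(j < m.+1) w j).

Definition lorentz_set (w : lorentz_weight) : set (nat -> R[i]^o) :=
  [set x | x @ \oo --> (0 : R[i]^o) /\ lorentz_ratio w x @ \oo --> (0 : R)].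

Definition lorentz_norm (w : lorentz_weight) x : R :=
  sup (range (lorentz_ratio w x)).

Definition lorentz_pred (w : lorentz_weight) : {pred nat -> R[i]^o} :=
  mem (lorentz_set w).

Variable w : lorentz_weight.

Lemma normc_ge0 (z : R[i]) : 0 <= normc z.
Proof. by case: z => a b; rewrite /= sqrtr_ge0. Qed.

Lemma normcEn (z : R[i]^o) : `|z| = (normc z)%:C.
Proof. by []. Qed.

Lemma normc_lt (z : R[i]^o) (e : R) : (`|z| < e%:C) = (normc z < e).
Proof. by rewrite normcEn ltcR. Qed.

Lemma cvg0_normcP x : x @ \oo --> (0 : R[i]^o) <->
  forall e : R, 0 < e -> \forall n \near \oo, normc (x n) < e.
Proof.
split=> [/cvgr0Pnorm_lt H e e0|H].
  have : (0 : R[i]) < e%:C by rewrite ltcR.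
  move=> /H; apply: filterS => n; by rewrite normc_lt.
apply/cvgr0Pnorm_lt => -[e1 e2] /= e0.
have e2E : e2 = 0 by move: e0; rewrite ltcE /= => /andP[/eqP].
move: e0; rewrite e2E -[Complex e1 0]/(e1%:C) => e0.
have {}e0 : 0 < e1 by move: e0; rewrite ltcR.
by apply: filterS (H _ e0) => n; rewrite normc_lt.
Qed.

Lemma cvg0_bounded x : x @ \oo --> (0 : R[i]^o) ->
  exists M, forall j, normc (x j) <= M.
Proof.
move=> /cvg0_normcP /(_ 1 ltr01) [N _ NP].
exists (1 + \sum_(i < N) normc (x i)) => j.
have S0 : 0 <= \sum_(i < N) normc (x i) by apply: sumr_ge0 => *; exact: normc_ge0.
have [Nj|jN] := leqP N j.
  by rewrite ler_wpDr// ltW// NP.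
rewrite (bigD1 (Ordinal jN))//= addrCA lerDl addr_ge0// sumr_ge0// => *.
exact: normc_ge0.
Qed.

Lemma lsum_gt0 m : 0 < \sum_(j < m.+1) w j.
Proof.
rewrite big_ord_recl ltr_wpDr ?lweight_gt0// sumr_ge0// => *.
exact/ltW/lweight_gt0.
Qed.

Lemma lratio_ge0 x m : 0 <= lorentz_ratio w x m.
Proof.
by rewrite /lorentz_ratio divr_ge0 ?(ltW (lsum_gt0 _))// sumr_ge0// => *; exact: rearr_ge0.
Qed.

Lemma lratioD x y m : x @ \oo --> (0 : R[i]^o) -> y @ \oo --> (0 : R[i]^o) ->
  lorentz_ratio w (x + y) m <= lorentz_ratio w x m + lorentz_ratio w y m.
Proof.
move=> /cvg0_bounded[M xM] /cvg0_bounded[N yN].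
rewrite /lorentz_ratio -mulrDl ler_wpM2r ?invr_ge0 ?(ltW (lsum_gt0 _))//.
apply: (rsumD _ xM yN) => j; rewrite normc_ge0/=.
by rewrite -lecR rmorphD /= -!normcEn; exact: ler_normD.
Qed.

Lemma lratioZ (k : R[i]) x m : x @ \oo --> (0 : R[i]^o) ->
  lorentz_ratio w (k *: x) m = normc k * lorentz_ratio w x m.
Proof.
move=> /cvg0_bounded[M xM].
rewrite /lorentz_ratio mulrA; congr (_ / _).
rewrite -(@rsumZ _ _ M)//; last exact: normc_ge0.
  by congr rsum; apply/funext => i; rewrite -normcM.
by move=> j; rewrite normc_ge0 xM.
Qed.

Lemma cvgr0_le (u v : nat -> R) : (forall n, 0 <= u n <= v n) ->
  v @ \oo --> (0 : R) -> u @ \oo --> (0 : R).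
Proof.
move=> uv v0; apply: (squeeze_cvgr _ (cvg_cst 0) v0).
by near=> n; exact: uv.
Unshelve. all: by end_near. Qed.

Lemma lorentz_submod_closed : submod_closed (lorentz_pred w).
Proof.
split.
  rewrite inE; split; first exact: cvg_cst.
  rewrite (_ : lorentz_ratio w 0 = fun=> 0); first exact: cvg_cst.
  apply/funext => m; rewrite -(scale0r (0 : nat -> R[i]^o)) lratioZ; last exact: cvg_cst.
  by rewrite normc0 mul0r.
move=> k x y; rewrite !inE => -[x0 lx] [y0 ly].
have kx0 : (k *: x : nat -> R[i]^o) @ \oo --> (0 : R[i]^o).
  by rewrite -(scaler0 _ k); apply: cvgZr.
split.
  by rewrite -(addr0 (0 : R[i]^o)); apply: cvgD.
apply: (@cvgr0_le _ (fun m => normc k * lorentz_ratio w x m + lorentz_ratio w y m)).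
  by move=> m; rewrite lratio_ge0 -lratioZ// lratioD.
rewrite -(addr0 (0 : R)) -[X in X + 0](mulr0 (normc k)).
by apply: cvgD => //; apply: cvgMr.
Qed.

Lemma lratio_has_sup x : lorentz_set w x -> has_sup (range (lorentz_ratio w x)).
Proof.
move=> [_ lx]; split; first by exists (lorentz_ratio w x 0%N), 0%N.
have [M [_ MP]] : bounded_fun (lorentz_ratio w x).
  by apply: cvg_seq_bounded; apply: cvgP lx.
exists (M + 1) => _ [m _ <-].
by apply: le_trans (ler_norm _) _; apply: MP; rewrite ?ltrDl.
Qed.

Lemma lratio_le x m : lorentz_set w x -> lorentz_ratio w x m <= lorentz_norm w x.
Proof. by move=> /lratio_has_sup [_ ub]; apply: ub_le_sup => //; exists m. Qed.

Lemma lnorm_le x (c : R) : (forall m, lorentz_ratio w x m <= c) -> lorentz_norm w x <= c.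
Proof.
move=> H; apply: sup_le_ub; first by exists (lorentz_ratio w x 0%N), 0%N.
by move=> _ [m _ <-].
Qed.

Lemma lnorm_ge0 x : lorentz_set w x -> 0 <= lorentz_norm w x.
Proof. by move=> /(lratio_le 0); apply: le_trans; exact: lratio_ge0. Qed.

Lemma lnormD x y : lorentz_set w x -> lorentz_set w y ->
  lorentz_norm w (x + y) <= lorentz_norm w x + lorentz_norm w y.
Proof.
move=> xw yw; apply: lnorm_le => m.
by apply: le_trans (lratioD _ xw.1 yw.1) _; rewrite lerD ?lratio_le.
Qed.

Lemma lnormZ (k : R[i]) x : lorentz_set w x ->
  lorentz_norm w (k *: x) = normc k * lorentz_norm w x.
Proof.
have le (q : R[i]) u : lorentz_set w u -> lorentz_norm w (q *: u) <= normc q * lorentz_norm w u.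
  move=> uw; apply: lnorm_le => m; rewrite lratioZ; last exact: uw.1.
  by rewrite ler_wpM2l ?normc_ge0 ?lratio_le.
move=> xw; apply/eqP; rewrite eq_le le//=.
have kxw : lorentz_set w (k *: x).
  have := lorentz_submod_closed; case=> S0 S.
  have := S k x 0; rewrite addr0 => /(_ (mem_set xw) S0); by rewrite inE.
have [->|k0] := eqVneq k 0; first by rewrite normc0 mul0r lnorm_ge0// scale0r; have := lorentz_submod_closed.1; rewrite inE.
have nk0 : 0 < normc k.
  rewrite lt_def normc_ge0 andbT; apply: contra_neq k0; exact: eq0_normc.
rewrite -ler_pdivlMl// -normcV; apply: le_trans (le _ _ kxw).
by rewrite scalerA mulVf// scale1r.
Qed.

Lemma normc_le_lnorm x j : lorentz_set w x -> normc (x j) <= lorentz_norm w x.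
Proof.
move=> xw; have [M xM] := cvg0_bounded xw.1.
apply: le_trans (lratio_le 0 xw).
rewrite /lorentz_ratio [X in _ / X]big_ord_recl big_ord0 addr0 lweight0 divr1.
apply: (@le_rsum1 _ (fun i => normc (x i)) M 1%N) => // i.
by rewrite normc_ge0 xM.
Qed.

End lorentz_sequences.
Arguments lorentz_weight : clear implicits.

Section lorentz_predual.
Context {R : realType} (w : lorentz_weight R).

Record lorentz_predual := LorentzPredual {
  lp_seq :> nat -> R[i]^o;
  lp_seqP : lp_seq \in lorentz_pred w }.

HB.instance Definition _ := [isSub for lp_seq].
HB.instance Definition _ := [Choice of lorentz_predual by <:].
HB.instance Definition _ := GRing.isSubmodClosed.Build _ _ (lorentz_pred w)
  (lorentz_submod_closed w).
HB.instance Definition _ := [SubChoice_isSubLmodule of lorentz_predual by <:].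

End lorentz_predual.

Section lorentz_normed.
Context {R : realType} (w : lorentz_weight R).
Implicit Types x y : lorentz_predual w.

Lemma lp_set x : lorentz_set w x.
Proof. by have := lp_seqP x; rewrite inE. Qed.

(** Norms on modules over [R[i]] take values in [R[i]], hence the embedding. *)
Definition lp_norm x : R[i] := (lorentz_norm w x)%:C.

Lemma lp_normD x y : lp_norm (x + y) <= lp_norm x + lp_norm y.
Proof. by rewrite /lp_norm -rmorphD lecR; apply: lnormD; exact: lp_set. Qed.

Lemma lp_normZ (k : R[i]) x : lp_norm (k *: x) = `|k| * lp_norm x.
Proof.
rewrite /lp_norm -[ `|k| ]/((normc k)%:C) -rmorphM; congr (_ %:C).
by apply: lnormZ; exact: lp_set.
Qed.

Lemma lp_norm_eq0 x : lp_norm x = 0 -> x = 0.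
Proof.
move=> [/eqP]; rewrite /lp_norm => x0; apply/val_inj/funext => j /=.
apply: eq0_normc; apply/eqP; rewrite eq_le normc_ge0 andbT.
by apply: le_trans (normc_le_lnorm _ (lp_set x)) _; rewrite (eqP x0).
Qed.

HB.instance Definition _ := Lmodule_isNormed.Build R[i] (lorentz_predual w)
  lp_normD lp_normZ lp_norm_eq0.

End lorentz_normed.

Section entire.
Context {R : realType} (X : normedModType R[i]).

(** Holomorphic on all of X: complex Frechet differentiable at every point. *)
Definition holomorphic_pred : {pred X -> R[i]^o} :=
  fun f => `[< forall x, differentiable f x >].

Lemma holomorphic_submod_closed : submod_closed holomorphic_pred.
Proof.
split; first by apply/asboolP => x; exact: differentiable_cst.
move=> k f g /asboolP fd /asboolP gd; apply/asboolP => x.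
have kf : differentiable (k *: f) x := differentiableZ k (fd x).
exact: (differentiableD kf (gd x)).
Qed.

HB.instance Definition _ := GRing.isSubmodClosed.Build _ _ holomorphic_pred
  holomorphic_submod_closed.

Record entire := Entire {
  entire_fun :> X -> R[i]^o;
  entireP : entire_fun \in holomorphic_pred }.

HB.instance Definition _ := [isSub for entire_fun].
HB.instance Definition _ := [Choice of entire by <:].
HB.instance Definition _ := [SubChoice_isSubLmodule of entire by <:].

(** The topology of uniform convergence on compact sets, i.e. the one generated by
    the seminorms sup_K |f| ([nbhs_tau0P]); on continuous functions it is the
    compact-open topology ([entire_cvg_compact_openP]). *)
HB.instance Definition _ := Uniform.copy entire
  (initial_topology (entire_fun : entire -> {family compact, X -> R[i]^o})).

Lemma entire_continuous (f : entire) : continuous f.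
Proof.
by move=> x; apply: differentiable_continuous; exact: (asboolP _ (entireP f)).
Qed.

Definition tau0_ball (f : entire) (K : set X) (e : R) : set entire :=
  [set g | forall x, K x -> normc (f x - g x) < e].

Lemma nbhs_tau0P (f : entire) (A : set entire) : nbhs f A <->
  exists K e, [/\ compact K, 0 < e & tau0_ball f K e `<=` A].
Proof.
split; last first.
  move=> [K [e [cK e0 KA]]].
  pose E : set (R[i]^o * R[i]^o) := [set xy | normc (xy.1 - xy.2) < e].
  have entE : entourage E.
    rewrite -entourage_ballE; exists e%:C => /=; first by rewrite ltcR.
    by move=> [x y]; rewrite /ball /= normc_lt.
  have fE := @fam_nbhs X (R[i]^o) compact K E (f : X -> R[i]^o) entE cK.
  have := @initial_continuous entire {family compact, X -> R[i]^o} entire_fun f _ fE.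
  by rewrite nbhs_simpl /=; apply: filterS.
move=> [_ [[B oB <-]] /= Bf BA].
have {oB}Bf' : nbhs (f : {family compact, X -> R[i]^o}) B by exact: open_nbhs_nbhs.
pose F : set_system (X -> R[i]^o) := filter_from
  [set Ke : set X * R | compact Ke.1 /\ 0 < Ke.2]
  (fun Ke => [set g | forall x, Ke.1 x -> normc (f x - g x) < Ke.2]).
have FF : Filter F.
  apply: filter_from_filter; first by exists (set0, 1); split => //=; exact: compact0.
  move=> [K e] [L d] [/= cK e0] [/= cL d0]; exists (K `|` L, Num.min e d).
    by split; [exact: compactU|rewrite /= lt_min e0].
  move=> g /= H; split => x Kx.
    by have := H x (or_introl Kx); rewrite lt_min => /andP[].
  by have := H x (or_intror Kx); rewrite lt_min => /andP[].
have : {family compact, F --> (f : X -> R[i]^o)}.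
  apply/fam_cvgP => C cC P /uniform_nbhs [E [entE EP]].
  move: entE; rewrite -entourage_ballE => -[[e1 e2] /= e0 eE].
  have e2E : e2 = 0 by move: e0; rewrite ltcE /= => /andP[/eqP].
  move: e0 eE; rewrite e2E -[Complex e1 0]/(e1%:C) ltcR => e0 eE.
  exists (C, e1) => //= g gC; apply: EP => x Cx; apply: eE.
  by rewrite /ball /= normc_lt; exact: gC.
move=> /(_ B Bf') [[K e] [/= cK e0] KB]; exists K, e; split=> // g gK.
by apply: BA => /=; exact: KB.
Qed.

Lemma normcD (x y : R[i]) : normc (x + y) <= normc x + normc y.
Proof. exact: le_normcD. Qed.

Lemma normc_continuous : continuous (@normc R : R[i]^o -> R).
Proof.
move=> x; apply/(@cvgrPdist_lt _ _ _ (nbhs x) (nbhs_filter x)) => e e0.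
have ec0 : (0 : R[i]) < e%:C by rewrite ltcR.
have : nbhs (x : R[i]^o) (ball (x : R[i]^o) e%:C) by exact: nbhsx_ballx.
apply: (@filterS _ _ (nbhs_filter (x : R[i]^o))) => y; rewrite /ball /= normc_lt; apply: le_lt_trans.
rewrite ler_norml lerBlDr lerNl opprB lerBlDr.
rewrite -[normc (x - y)]normcN {1}opprB; apply/andP; split.
  by apply: le_trans (normcD _ _); rewrite subrK.
by rewrite normcN; apply: le_trans (normcD _ _); rewrite subrK.
Qed.

Lemma entire_cvg_compact_openP (F : set_system entire) (f : entire) :
  Filter F ->
  F --> f <-> {compact-open, entire_fun @ F --> (f : X -> R[i]^o)}.
Proof.
move=> FF.
have := @compact_open_fam_compactP X (R[i]^o) f (entire_fun @ F)
  (@entire_continuous f) _.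
move=> /(_ _) ->; split=> [Ff|Ff A [_ [[B oB <-]] /= Bf BA]].
  apply: (cvg_trans (cvg_app entire_fun Ff)).
  exact: (@initial_continuous entire {family compact, X -> R[i]^o} entire_fun f).
by apply: (filterS BA); apply: Ff; exact: open_nbhs_nbhs.
Qed.

Lemma entire_bounded (f : entire) (K : set X) : compact K ->
  exists M, 0 <= M /\ forall x, K x -> normc (f x) <= M.
Proof.
move=> cK; have [->|/set0P K0] := eqVneq K set0; first by exists 0.
have cf : {within K, continuous (fun x => normc (f x))}.
  apply: continuous_subspaceT => x; apply: (@continuous_comp X (R[i]^o) R f (@normc R)).
    exact: entire_continuous.
  exact: normc_continuous.
have [c _ cP] := compact_EVT_max K0 cK cf.
by exists (normc (f c)); split=> [|x Kx]; [exact: normc_ge0|apply/cP/mem_set].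
Qed.

Lemma entire_add_continuous : continuous (fun fg : entire * entire => fg.1 + fg.2).
Proof.
move=> [f g] A /nbhs_tau0P [K [e [cK e0 KA]]].
have e20 : 0 < e / 2 by rewrite divr_gt0.
exists (tau0_ball f K (e / 2), tau0_ball g K (e / 2)).
  by split; apply/nbhs_tau0P; exists K, (e / 2); split.
move=> [f' g'] [/= Hf Hg]; apply: KA => x Kx /=.
rewrite opprD addrACA (splitr e); apply: le_lt_trans (normcD _ _) _.
by rewrite ltrD ?Hf ?Hg.
Qed.

Lemma entire_scale_continuous : continuous (fun z : R[i]^o * entire => z.1 *: z.2).
Proof.
move=> [k f] A /nbhs_tau0P [K [e [cK e0 KA]]].
have e20 : 0 < e / 2 by rewrite divr_gt0.
have [M [M0 MP]] := entire_bounded f cK.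
have k1 : 0 < normc k + 1 by rewrite ltr_wpDl ?normc_ge0.
have M1 : 0 < M + 1 by rewrite ltr_wpDl.
pose d := Num.min 1 (e / 2 / (normc k + 1)).
have d0 : 0 < d by rewrite lt_min ltr01 divr_gt0.
pose c := e / 2 / (M + 1).
have c0 : 0 < c by rewrite divr_gt0.
exists ([set l | normc (k - l) < c], tau0_ball f K d).
  split; last by apply/nbhs_tau0P; exists K, d; split.
  apply/nbhs_ballP; exists c%:C => /=; first by rewrite ltcR.
  by move=> l; rewrite /ball /= normc_lt.
move=> [l g] [/= Hl Hg]; apply: KA => x Kx /=.
have -> : k *: f x - l *: g x = k * (f x - g x) + (k - l) * g x.
  by rewrite /GRing.scale /= mulrBr mulrBl addrA subrK.
rewrite (splitr e); apply: le_lt_trans (normcD _ _) _; rewrite !normcM.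
have fgx := Hg x Kx.
apply: ltrD.
  apply: (@le_lt_trans _ _ (normc k * (e / 2 / (normc k + 1)))).
    by rewrite ler_wpM2l ?normc_ge0// ltW// (lt_le_trans fgx)// ge_min lexx orbT.
  by rewrite mulrA ltr_pdivrMr// mulrC ltr_pM2l// ltrDl.
have gM : normc (g x) <= M + 1.
  have -> : g x = f x - (f x - g x) by rewrite opprB addrC subrK.
  apply: le_trans (normcD _ _) _; rewrite normcN lerD ?MP// ltW//.
  by rewrite (lt_le_trans fgx)// ge_min lexx.
apply: (@le_lt_trans _ _ (normc (k - l) * (M + 1))).
  by rewrite ler_wpM2l ?normc_ge0.
by rewrite -ltr_pdivlMr.
Qed.

Lemma entire_locally_convex : exists2 B : set_system entire,
  (forall b, b \in B -> convex_set b) & basis B.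
Proof.
pose V (f : entire) K (e : R) : set entire := [set g | exists d, d < e /\
  forall x, K x -> normc (f x - g x) <= d].
exists [set b | exists f K e, [/\ compact K, 0 < e & b = V f K e]].
  move=> b; rewrite inE => -[f [K [e [cK e0 ->]]]] g h l.
  rewrite !inE => -[d [de gd]] [d' [de' hd']].
  exists (Num.max d d'); split; first by rewrite gt_max de.
  move=> x Kx.
  have -> : (g : convex_lmodType _) <| l |> (h : convex_lmodType _) =
      l%:num *: g + (1 - l%:num) *: h by [].
  rewrite -lecR -normcEn /=.
  have -> : f x - (l%:num *: g x + (1 - l%:num) *: h x) =
      l%:num * (f x - g x) + (1 - l%:num) * (f x - h x).
    rewrite !mulrBr addrACA -mulrDl [l%:num + _]addrC subrK mul1r.
    by rewrite opprD.
  apply: le_trans (ler_normD _ _) _; rewrite !normrM.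
  have l0 : 0 <= l%:num by [].
  have l1 : 0 <= (1 - l%:num) by rewrite subr_ge0.
  rewrite (ger0_norm l0) (ger0_norm l1).
  have -> : (Num.max d d')%:C =
      l%:num * (Num.max d d')%:C + (1 - l%:num) * (Num.max d d')%:C.
    by rewrite -mulrDl addrC subrK mul1r.
  rewrite lerD// ler_wpM2l//.
    by rewrite [leLHS]normcEn lecR le_max gd.
  by rewrite [leLHS]normcEn lecR le_max hd' ?orbT.
split.
  move=> _ [f [K [e [cK e0 ->]]]]; rewrite openE => g [d [de gd]].
  apply/nbhs_tau0P; exists K, ((e - d) / 2).
  have ed0 : 0 < (e - d) / 2 by rewrite divr_gt0// subr_gt0.
  split=> // h gh; exists (d + (e - d) / 2); split.
    by rewrite -ltrBrDl ltr_pdivrMr// mulr_natr mulr2n ltrDr subr_gt0.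
  move=> x Kx; rewrite -(subrK (g x) (f x)) -addrA.
  apply: le_trans (normcD _ _) _; rewrite lerD ?gd//.
  exact/ltW/gh.
move=> f A /nbhs_tau0P [K [e [cK e0 KA]]].
exists (V f K e).
  split; first by exists f, K, e.
  by exists 0; split=> // x _; rewrite subrr normc0.
move=> g [d [de gd]]; apply: KA => x Kx.
exact: le_lt_trans (gd x Kx) de.
Qed.

HB.instance Definition _ := PreTopologicalNmodule_isTopologicalNmodule.Build entire
  entire_add_continuous.
HB.instance Definition _ := TopologicalNmodule_isTopologicalLmodule.Build R[i] entire
  entire_scale_continuous.
HB.instance Definition _ := Uniform_isTvs.Build R[i] entire
  entire_locally_convex.
End entire.

Section schauder_basis.
Context {K : numFieldType} {E : tvsType K}.

Definition coefficient_functionals (b : nat -> E) (c : nat -> E -> K^o) : Prop :=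
  [/\ forall n, continuous (c n),
      forall x, series (fun n => c n x *: b n) @ \oo --> x &
      forall x (a : nat -> K),
        series (fun n => a n *: b n) @ \oo --> x -> forall n, a n = c n x].

Definition schauder_basis (b : nat -> E) : Prop :=
  exists c, coefficient_functionals b c.

End schauder_basis.

(** Finitely supported multi-indices, with [nat] (starting at 0) as index set. *)
Notation multiindex := {fsfun nat -> nat with 0%N}.

Section multiindices.
Implicit Types alpha beta : multiindex.

Definition mdegree alpha : nat := (\sum_(j <- finsupp alpha) alpha j)%N.

(** Index [j] is the (j+1)-st variable, so this is max supp in 1-based numbering,
    and 0 for the zero multi-index. *)
Definition mlen alpha : nat := (\max_(j <- finsupp alpha) j.+1)%N.

(** In the second clause [j] is the largest index where the two differ. *)
Definition square_lt alpha beta : Prop :=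
  (mlen alpha < mlen beta)%N \/
  mlen alpha = mlen beta /\
  exists j, (alpha j < beta j)%N /\ forall i, (j < i)%N -> alpha i = beta i.

(** Here [e] is the enumeration; the condition is only about pairs of equal
    degree. *)
Definition compatible (e : nat -> multiindex) : Prop :=
  forall i j, mdegree (e i) = mdegree (e j) ->
    (i < j)%N <-> square_lt (e i) (e j).

End multiindices.

Section lorentz_basis.
Context {R : realType} (w : lorentz_weight R).
Implicit Types x y : lorentz_predual w.

Lemma lsum_inv_cvg0 : (fun m => (\sum_(j < m.+1) w j)^-1) @ \oo --> (0 : R).
Proof.
have nd : nondecreasing_seq (series w).
  by apply: nondecreasing_series => n _ _; exact/ltW/lweight_gt0.
have wE : [normed series w] = series w.
  by apply/funext => n; apply: eq_bigr => i _; rewrite /= gtr0_norm// lweight_gt0.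
have := @lweight_not_summable _ w; rewrite wE => ncvg.
have wy : series w @ \oo --> +oo%R by exact: nondecreasing_dvgn_lt.
have -> : (fun m => (\sum_(j < m.+1) w j)^-1) =
    [sequence (series w n.+1)^-1]_n.
  by apply/funext => m; rewrite /series /= big_mkord.
rewrite (cvg_shiftS (fun n => (series w n)^-1)).
apply/gtr0_cvgV0 => //; exists 1%N => // -[|n] //= _.
by rewrite /series /= big_mkord; exact: lsum_gt0.
Qed.

Definition unit_seq j : nat -> R[i]^o := fun i => (i == j)%:R.

Lemma normc_bool (b : bool) : normc (b%:R : R[i]) = b%:R.
Proof. by case: b; rewrite ?normc0 ?normc1. Qed.

Lemma unit_seqP j : unit_seq j \in lorentz_pred w.
Proof.
rewrite inE; split.
  apply/cvg0_normcP => e e0; exists j.+1 => // i /= ji.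
  by rewrite normc_bool gtn_eqF.
apply: cvgr0_le lsum_inv_cvg0 => m.
rewrite lratio_ge0/= -[leRHS]mul1r /lorentz_ratio ler_wpM2r//.
  by rewrite invr_ge0; exact/ltW/lsum_gt0.
apply: rsum_leW => [i|s us _]; first exact: normc_ge0.
under eq_bigr do rewrite normc_bool.
rewrite -natr_sum lern1.
have -> : (\sum_(i <- s) (i == j) = count_mem j s)%N.
  by elim: s {us} => [|i s IH]; rewrite ?big_nil// big_cons IH.
by rewrite count_uniq_mem// leq_b1.
Qed.

Definition lorentz_unit j : lorentz_predual w := LorentzPredual (unit_seqP j).

Lemma lp_norm_ge x j : normc (x j) <= lorentz_norm w x.
Proof. exact/normc_le_lnorm/lp_set. Qed.

Definition lp_coord j : lorentz_predual w -> R[i]^o := fun x => x j.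

Lemma lp_coord_is_linear j : linear (lp_coord j).
Proof. by []. Qed.

HB.instance Definition _ j := GRing.isLinear.Build R[i] (lorentz_predual w) (R[i]^o)
  _ (lp_coord j) (lp_coord_is_linear j).

Lemma lp_coord_continuous j : continuous (lp_coord j).
Proof.
move=> x; apply/(@cvgrPdist_lt _ _ _ (nbhs x) (nbhs_filter x)) => e e0.
have : nbhs x (ball x e) by exact: nbhsx_ballx.
apply: filterS => y; rewrite -ball_normE /ball_ /=; apply: le_lt_trans.
by rewrite -[leLHS]/((normc ((x - y) j))%:C) -[leRHS]/((lorentz_norm w (x - y))%:C) lecR lp_norm_ge.
Qed.

Lemma lp_coord_differentiable j x : differentiable (lp_coord j) x.
Proof.
apply: (@linear_differentiable R[i] (lorentz_predual w) (R[i]^o) (lp_coord j : {linear lorentz_predual w -> R[i]^o}) x).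
exact: lp_coord_continuous. Qed.

(** [lp_coord j] is the j-th coefficient functional of the canonical basis
    ([lorentz_unit_coefficients]). *)
Definition monomial_fun (alpha : multiindex) : lorentz_predual w -> R[i]^o :=
  fun x => \prod_(j <- finsupp alpha) lp_coord j x ^+ alpha j.

Lemma monomialP alpha : monomial_fun alpha \in @holomorphic_pred R _.
Proof.
apply/asboolP => x; rewrite /monomial_fun.
elim: (finsupp alpha : seq nat) => [|j s IH].
  under eq_fun do rewrite big_nil.
  exact: differentiable_cst.
under eq_fun do rewrite big_cons.
apply: (@differentiableM R[i] (lorentz_predual w) (fun y => lp_coord j y ^+ alpha j)) => //.
elim: (alpha j) => [|n IHn]; first exact: differentiable_cst.
under eq_fun do rewrite exprS.
by apply: (@differentiableM R[i] (lorentz_predual w) (lp_coord j)) => //; exact: lp_coord_differentiable.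
Qed.

Definition monomial alpha : entire (lorentz_predual w) := Entire (monomialP alpha).

Lemma lp_partial_sumE (a : nat -> R[i]) N i :
  series (fun n => a n *: lorentz_unit n) N i = if (i < N)%N then a i else 0.
Proof.
rewrite /series /=.
elim: N => [|N IH]; first by rewrite big_nil.
rewrite big_nat_recr//=.
rewrite -[LHS]/((\sum_(0 <= k < N) a k *: lorentz_unit k) i + a N * (i == N)%:R) IH.
rewrite [in RHS]ltnS [in RHS]leq_eqVlt; case: (eqVneq i N) => [->|_].
  by rewrite ltnn add0r mulr1.
by rewrite mulr0 addr0.
Qed.

Lemma lp_unit_cvg x : series (fun n => x n *: lorentz_unit n) @ \oo --> x.
Proof.
have [x0 lx] := lp_set x.
apply/cvgrPdist_lt => -[e1 e2] /= e0.
have e2E : e2 = 0 by move: e0; rewrite ltcE /= => /andP[/eqP].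
move: e0; rewrite e2E -[Complex e1 0]/(e1%:C) ltcR => {e2 e2E} e0.
have e20 : 0 < e1 / 2 by rewrite divr_gt0.
have [M _ MP] : \forall m \near \oo, lorentz_ratio w x m < e1 / 2.
  by have /cvgr0Pnorm_lt/(_ _ e20) := lx; apply: filterS => m; apply: le_lt_trans; exact: ler_norm.
have d0 : 0 < e1 / 2 / M.+1%:R by rewrite divr_gt0.
have /cvg0_normcP/(_ _ d0) [N _ NP] := x0.
exists N => // n /= Nn.
rewrite -[ltLHS]/((lorentz_norm w (x - series (fun n => x n *: lorentz_unit n) n))%:C) ltcR.
apply: (@le_lt_trans _ _ (e1 / 2)); last by rewrite ltr_pdivrMr// ltr_pMr// ltr1n.
have tE i : (x - series (fun n => x n *: lorentz_unit n) n) i = if (i < n)%N then 0 else x i.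
  rewrite -[LHS]/(x i - (series (fun n => x n *: lorentz_unit n) n) i) lp_partial_sumE.
  by case: ifP; rewrite ?subrr ?subr0.
apply: lnorm_le => m.
have [B xB] := cvg0_bounded x0.
have [Mm|mM] := leqP M m.
  apply: le_trans (ltW (MP m Mm)); rewrite ler_wpM2r ?invr_ge0 ?(ltW (lsum_gt0 _ _))//.
  apply: (rsum_mono _ xB) => i; rewrite tE normc_ge0/=.
  by case: ifP => _; rewrite ?normc0 ?normc_ge0.
rewrite ler_pdivrMr ?lsum_gt0//.
apply: (@le_trans _ _ (e1 / 2)); last first.
  by rewrite ler_peMr ?(ltW e20)// big_ord_recl lweight0 lerDl sumr_ge0// => *; exact/ltW/lweight_gt0.
apply: rsum_leW => [i|s us sm]; first exact: normc_ge0.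
apply: (@le_trans _ _ (\sum_(i <- s) (e1 / 2 / M.+1%:R))).
  apply: ler_sum => i _; rewrite tE; case: ltnP => [_|ni].
    by rewrite normc0 ltW.
  exact/ltW/NP/(leq_trans Nn).
rewrite big_const_seq iter_addr addr0 count_predT sm -[_ *+ m.+1]mulr_natr -mulrA.
by rewrite ler_piMr ?(ltW e20)// mulrC ler_pdivrMr// mul1r ler_nat ltnW.
Qed.

Lemma lorentz_unit_coefficients :
  coefficient_functionals lorentz_unit lp_coord.
Proof.
split; [exact: lp_coord_continuous|exact: lp_unit_cvg|].
move=> x a ax n.
have cn : (fun N => series (fun n => a n *: lorentz_unit n) N n) @ \oo --> (x n : R[i]^o).
  apply: (@cvg_comp _ _ _ (series (fun n => a n *: lorentz_unit n)) (lp_coord n) _ _ _ ax).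
  exact: lp_coord_continuous.
have ca : (fun N => series (fun n => a n *: lorentz_unit n) N n) @ \oo --> (a n : R[i]^o).
  apply: cvg_near_cst; exists n.+1 => // N /= nN.
  by rewrite lp_partial_sumE nN.
exact: (cvg_unique (@norm_hausdorff _ (R[i]^o)) ca cn).
Qed.

End lorentz_basis.

(* Main.v *)
Require Import Defs.
From mathcomp Require Import all_boot all_order all_algebra finmap.
From mathcomp Require Import all_classical all_reals all_analysis.
From mathcomp Require Import complex.
From mathcomp Require Import ring lra.
From mathcomp Require cyclic separable cyclotomic.
Set Implicit Arguments.
Unset Strict Implicit.
Unset Printing Implicit Defensive.
Import Order.TTheory GRing.Theory Num.Theory numFieldNormedType.Exports.
Import Normc.
Local Open Scope classical_set_scope.
Local Open Scope ring_scope.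
Local Open Scope complex_scope.

(** The space has a 1-unconditional basis, and this is what makes every compatible
    ordering work.

    An entire [f] is the sum of its homogeneous parts [hpart n f], where
    [hpart n f x] is the n-th Taylor coefficient of a |-> f (a x); by Cauchy's
    estimates these decrease geometrically, uniformly on compact sets
    ([hpart_bounds]). On the span of the first [m] basis vectors a homogeneous part
    is a finite combination of monomials ([hpart_poly]).

    Fix a degree [n]. The square order is the colexicographic order, so the
    multi-indices alpha of degree [n] which come no later than beta are those which
    agree with beta at all indices, or agree with it above some index j and satisfy
    alpha_j < beta_j. Keeping only the monomials with alpha_j = k is an average over
    rotations of the j-th coordinate by roots of unity, hence does not increase the
    supremum over a set invariant under rotations. The conditions alpha_j < beta_j
    cost beta_j such averages, and the beta_j add up to [n]: the projection on an
    initial segment multiplies suprema by at most n + 1 ([multiplier_colex],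
    [degree_psum_bound]).

    A partial sum of the whole monomial expansion consists of one initial segment
    in each degree, whatever the interleaving of the degrees. Summing the factors
    n + 1 against the geometric decay shows that the partial sums are equicontinuous
    for the compact-open topology ([psum_bound]), because every compact set lies in
    a compact set invariant under rotations and truncations, its solid hull
    ([compact_solid_hull]). They fix polynomials from some point on, and polynomials
    are dense ([polynomial_dense]), so they converge to [f] ([psum_cvg]). The
    coefficients are continuous by the same averages ([coef_continuous]), and unique
    because they are biorthogonal to the monomials ([coef_monomial]).

    The one-variable theory behind the homogeneous parts is Goursat's theorem and
    Cauchy's formula on one fixed square ([goursat], [cauchy_formula]), which give a
    Taylor expansion with a bound for the remainder ([taylor]). Several variables
    are reached without iterated integrals: along a complex line, [hpart n f]
    satisfies every linear relation satisfied by the polynomials of degree at most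
    [n] ([hpart_line_poly]), hence is such a polynomial. *)

(** * Antiderivatives of continuous functions on the line *)

Section real.
Context {R : realType}.
Implicit Types (f F : R -> R).

Lemma is_derive_eps f (x d : R) :
  (forall e, 0 < e -> exists2 del, 0 < del & forall h, `|h| < del ->
     `|f (x + h) - f x - h * d| <= e * `|h|) ->
  is_derive x 1 f d.
Proof.
move=> H.
have lim : h^-1 *: ((f \o shift x) (h *: (1:R)) - f x) @[h --> (0:R)^'] --> d.
  apply/cvgrPdist_le => e e0; have [del del0 Hd] := H e e0.
  near=> h.
  have h0 : h != 0 by near: h; exact: nbhs_dnbhs_neq.
  have hd : `|h| < del by near: h; exact: dnbhs0_lt.
  have := Hd h hd; rewrite /= [h *: (1 : R)]mulr1 [h + x]addrC.
  rewrite -ler_pdivrMr ?normr_gt0// -normrV ?unitfE// -normrM.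
  congr (_ <= _); rewrite -normrN; congr (`|_|).
  rewrite /GRing.scale /=; field => //.
by apply: DeriveDef; [apply/cvg_ex; exists d | apply: cvg_lim].
Unshelve. all: by end_near. Qed.

Lemma antiderivative_bounded f (b : R) : continuous f ->
  exists F, forall x, - b < x -> x < b -> is_derive x 1 F (f x).
Proof.
move=> cf.
have int : (@lebesgue_measure R).-integrable `[- b, b] (EFin \o f).
  apply: continuous_compact_integrable; first exact: segment_compact.
  exact: continuous_subspaceT.
exists (fun x => \int[lebesgue_measure]_(t in [set` `[- b, x]]) f t) => x bx xb.
have [dF <-] := @continuous_FTC1 R f (BLeft (- b)) x b xb int bx (cf x).
by rewrite derive1E; apply: DeriveDef.
Qed.

Lemma const_of_derive0 F (a b : R) : a <= b ->
  (forall x, a <= x <= b -> is_derive x 1 F 0) -> F b = F a.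
Proof.
move=> ab dF; apply/eqP; rewrite -subr_eq0; apply/eqP.
have [||x _ ->] := @MVT_segment R F (fun=> 0) a b ab.
- by move=> x; rewrite in_itv /= => xab; apply: dF; lra.
- apply: derivable_within_continuous => x; rewrite in_itv /= => xab.
  by apply/ex_derive/dF.
by rewrite mul0r.
Qed.

(** Lebesgue integration gives an antiderivative on each bounded interval; normalised
    to vanish at 0, two of them agree on the smaller interval. *)
Lemma antiderivative f : continuous f -> exists F, forall x : R, is_derive x 1 F (f x).
Proof.
move=> cf; have [G GP] := choice (fun b => @antiderivative_bounded f b cf).
pose F x := G (`|x| + 1) x - G (`|x| + 1) 0; exists F => x0.
have FE b x : `|x| + 1 <= b -> F x = G b x - G b 0.
  move=> xb; rewrite /F; set c := `|x| + 1.
  have c0 : 0 < c by rewrite /c ltr_wpDl.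
  have dD y : - c < y -> y < c -> is_derive y 1 (fun y => G c y - G b y) 0.
    move=> cy yc.
    have := GP c y cy yc; have : is_derive y 1 (G b) (f y).
      by apply: GP; rewrite -/c in xb; lra.
    by move=> h1 h2; have := is_deriveB h2 h1; rewrite subrr.
  have xc : `|x| < c by rewrite /c ltrDl.
  suff : G c x - G b x = G c 0 - G b 0 by lra.
  move: xc; rewrite ltr_norml => /andP[cx xc].
  have [x0'|x0'] := leP 0 x.
    apply: (@const_of_derive0 (fun y => G c y - G b y)) => // y yx.
    by apply: dD; lra.
  symmetry; apply: (@const_of_derive0 (fun y => G c y - G b y)); first lra.
  by move=> y yx; apply: dD; lra.
pose b := `|x0| + 2.
have nbhs_lt1 : \forall x \near x0, `|x - x0| < 1.
  by apply/nbhs_ballP; exists 1 => //= y; rewrite /ball /= distrC.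
have nE : {near x0, (fun x => G b x - G b 0) =1 F}.
  near=> x; apply/esym/FE; rewrite /b.
  have : `|x - x0| < 1 by near: x; apply: nbhs_lt1.
  have := ler_normD (x - x0) x0; rewrite subrK; lra.
have d : is_derive x0 1 (fun x => G b x - G b 0) (f x0).
  have xb : `|x0| < b by rewrite /b; lra.
  move: xb; rewrite ltr_norml => /andP[? ?].
  by rewrite -[f x0]subr0; apply: is_deriveB; apply: GP.
exact: (@near_eq_is_derive R R R _ F x0 1 (f x0) nE d).
Unshelve. all: by end_near. Qed.

End real.

(** * Integrals of complex functions along segments *)

Section segments.
Context {R : realType}.
Local Notation C := R[i].
Local Notation Re := (@complex.Re R).
Local Notation Im := (@complex.Im R).
Implicit Types (f g F G : R -> C) (a b c t M : R) (z : C).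

Lemma Re_le_normc z : `|Re z| <= normc z.
Proof. by case: z => x y /=; rewrite -sqrtr_sqr ler_wsqrtr// lerDl sqr_ge0. Qed.

Lemma Im_le_normc z : `|Im z| <= normc z.
Proof. by case: z => x y /=; rewrite -sqrtr_sqr ler_wsqrtr// lerDr sqr_ge0. Qed.

Lemma normc_real (x : R) : normc x%:C = `|x|.
Proof. by rewrite /= expr0n addr0 sqrtr_sqr. Qed.

Lemma normc_i : normc 'i = 1 :> R.
Proof. by rewrite /= expr0n add0r expr1n sqrtr1. Qed.

Lemma normc_gt0 z : z != 0 -> 0 < normc z.
Proof. by move=> z0; rewrite lt_def normc_ge0 andbT; apply: contra_neq z0; exact: eq0_normc. Qed.

Lemma normc_nat n : normc (n%:R : C) = n%:R.
Proof. by rewrite -[n%:R]/(1 *+ n) normcMn normc1. Qed.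

Lemma normcX z n : normc (z ^+ n) = normc z ^+ n.
Proof. by elim: n => [|n IH]; rewrite ?expr0 ?normc1// !exprS normcM IH. Qed.

Lemma normc_sum (I : Type) (s : seq I) (F : I -> C) :
  normc (\sum_(i <- s) F i) <= \sum_(i <- s) normc (F i).
Proof.
elim: s => [|i s IH]; first by rewrite !big_nil normc0.
by rewrite !big_cons; apply: le_trans (normcD _ _) _; rewrite lerD2l.
Qed.

Lemma gt0_real z : 0 < z -> exists2 r : R, 0 < r & z = r%:C.
Proof.
case: z => r s; rewrite ltcE /= => /andP[/eqP -> r0]; by exists r.
Qed.

Lemma normc_le_ReIm z : normc z <= `|Re z| + `|Im z|.
Proof.
rewrite {1}[z]complexE; apply: le_trans (normcD _ _) _.
by rewrite normcM normc_i mul1r !normc_real.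
Qed.

(** Componentwise, so that the theorems of real analysis apply. *)
Definition cder F f := forall t : R,
  is_derive t 1 (Re \o F) (Re (f t)) /\ is_derive t 1 (Im \o F) (Im (f t)).

Definition rcont f := continuous (Re \o f) /\ continuous (Im \o f).

Lemma cderD F f G g : cder F f -> cder G g -> cder (F \+ G) (f \+ g).
Proof.
move=> dF dG t; have [? ?] := dF t; have [? ?] := dG t; split.
  have -> : Re \o (F \+ G) = (Re \o F) \+ (Re \o G).
    by apply/funext => u /=; case: (F u); case: (G u).
  have -> : Re ((f \+ g) t) = Re (f t) + Re (g t) by rewrite /=; case: (f t); case: (g t).
  exact: is_deriveD.
have -> : Im \o (F \+ G) = (Im \o F) \+ (Im \o G).
  by apply/funext => u /=; case: (F u); case: (G u).
have -> : Im ((f \+ g) t) = Im (f t) + Im (g t) by rewrite /=; case: (f t); case: (g t).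
exact: is_deriveD.
Qed.

Lemma cderZ z F f : cder F f -> cder (fun t => z * F t) (fun t => z * f t).
Proof.
case: z => u v dF t; have [dR dI] := dF t; split.
  have -> : Re \o (fun t => (u +i* v) * F t) = (u \*: (Re \o F)) \- (v \*: (Im \o F)).
    by apply/funext => s /=; case: (F s).
  have -> : Re ((u +i* v) * f t) = u *: Re (f t) - v *: Im (f t) by case: (f t).
  by apply: is_deriveB; apply: is_deriveZ.
have -> : Im \o (fun t => (u +i* v) * F t) = (u \*: (Im \o F)) \+ (v \*: (Re \o F)).
  by apply/funext => s /=; case: (F s).
have -> : Im ((u +i* v) * f t) = u *: Im (f t) + v *: Re (f t) by case: (f t).
by apply: is_deriveD; apply: is_deriveZ.
Qed.

Lemma cder_exists f : rcont f -> exists F, cder F f.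
Proof.
move=> [/antiderivative [A AP] /antiderivative [B BP]].
by exists (fun t => A t +i* B t) => t; split; [exact: AP|exact: BP].
Qed.

Lemma cder_eps F f : (forall t e, 0 < e -> exists2 d, 0 < d & forall h, `|h| < d ->
    normc (F (t + h) - F t - h%:C * f t) <= e * `|h|) -> cder F f.
Proof.
move=> H t; split; apply: is_derive_eps => e e0; have [d d0 dP] := H t e e0;
  exists d => // h hd; apply: le_trans (dP h hd) => /=.
  apply: le_trans (Re_le_normc _); rewrite le_eqVlt; apply/orP; left; apply/eqP.
  by case: (F (t + h)) (F t) (f t) => ? ? [? ?] [? ?] /=; congr (`|_|); ring.
apply: le_trans (Im_le_normc _); rewrite le_eqVlt; apply/orP; left; apply/eqP.
by case: (F (t + h)) (F t) (f t) => ? ? [? ?] [? ?] /=; congr (`|_|); ring.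
Qed.

(** The mean value theorem for the real and the imaginary part, whence the factor 2.
    With [M] equal to 0 it also gives the uniqueness of antiderivatives. *)
Lemma cder_bound F f a b M : cder F f -> a <= b ->
  (forall t, a <= t <= b -> normc (f t) <= M) ->
  normc (F b - F a) <= 2 * M * (b - a).
Proof.
move=> dF ab fM.
have real_bound (u v : R -> R) : (forall t, is_derive t (1:R) u (v t)) ->
    (forall t, a <= t <= b -> `|v t| <= M) -> `|u b - u a| <= M * (b - a).
  move=> du vM; have [|t tab ->] := @MVT_segment R u v a b ab.
    apply: derivable_within_continuous => t _; exact: (@ex_derive _ _ _ _ _ _ _ (du t)).
  rewrite normrM [ `|b - a| ]ger0_norm ?subr_ge0//.
  by rewrite ler_wpM2r ?subr_ge0// vM// -in_itv.
apply: le_trans (normc_le_ReIm _) _.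
have := real_bound (Re \o F) (Re \o f) (fun t => (dF t).1) _.
have := real_bound (Im \o F) (Im \o f) (fun t => (dF t).2) _.
move=> /(_ _)/wrap[].
  by move=> t tab; apply: le_trans (Im_le_normc _) (fM t tab).
move=> hI /(_ _)/wrap[].
  by move=> t tab; apply: le_trans (Re_le_normc _) (fM t tab).
move=> hR; rewrite -mulrA mulr_natl mulr2n; apply: lerD.
  by move: hR => /=; case: (F b) (F a) => ? ? [].
by move: hI => /=; case: (F b) (F a) => ? ? [].
Qed.

(** The integral of [f] from [a] to [b], as an increment of any antiderivative: its
    additivity over intervals is then immediate. *)
Definition seg f a b : C := let F := xget (fun=> 0) [set F | cder F f] in F b - F a.

Lemma segE f F a b : cder F f -> seg f a b = F b - F a.
Proof.
move=> dF; rewrite /seg; case: xgetP => [G _ dG|]; last by move=> /(_ F).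
wlog ab : a b / a <= b.
  move=> H; have [|/ltW] := leP a b; first exact: H.
  by move=> /H h; rewrite -[LHS]opprB h opprB.
pose H t := F t + (- 1) * G t.
have dH : cder H (fun t => f t + (-1) * f t) by apply: cderD => //; exact: cderZ.
have := cder_bound dH ab (M := 0) _; rewrite mulr0 mul0r => /(_ _)/wrap[].
  by move=> t _; rewrite mulN1r subrr normc0.
move=> H0; have : H b - H a = 0.
  by apply: eq0_normc; apply/eqP; rewrite eq_le H0 normc_ge0.
by rewrite /H => h; apply/eqP; rewrite -subr_eq0 -oppr_eq0; apply/eqP; rewrite -[RHS]h; ring.
Qed.

Lemma seg_cat f a b c : seg f a b + seg f b c = seg f a c.
Proof. by rewrite /seg; ring. Qed.

Lemma segD f g a b : rcont f -> rcont g -> seg (f \+ g) a b = seg f a b + seg g a b.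
Proof.
move=> /cder_exists[F dF] /cder_exists[G dG].
by rewrite (segE _ _ (cderD dF dG)) (segE _ _ dF) (segE _ _ dG) /=; ring.
Qed.

Lemma segZ z f a b : rcont f -> seg (fun t => z * f t) a b = z * seg f a b.
Proof.
move=> /cder_exists[F dF].
by rewrite (segE _ _ (cderZ z dF)) (segE _ _ dF); ring.
Qed.

Lemma seg_bound f a b M : rcont f -> a <= b ->
  (forall t, a <= t <= b -> normc (f t) <= M) -> normc (seg f a b) <= 2 * M * (b - a).
Proof. by move=> /cder_exists[F dF]; rewrite (segE _ _ dF); exact: cder_bound. Qed.

End segments.

(** * Integrals along the boundary of a rectangle *)

Section goursat.
Context {R : realType}.
Local Notation C := R[i].
Local Notation Re := (@complex.Re R).
Local Notation Im := (@complex.Im R).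
Implicit Types (k G : C -> C) (z p : C) (x y e : R).

Definition ccont k z := forall e, 0 < e ->
  exists2 d, 0 < d & forall h, normc h < d -> normc (k (z + h) - k z) < e.

Definition cdiff G z (l : C) := forall e, 0 < e ->
  exists2 d, 0 < d & forall h, normc h < d -> normc (G (z + h) - G z - h * l) <= e * normc h.

Lemma cdiff_ccont G z l : cdiff G z l -> ccont G z.
Proof.
move=> H e e0; have [d d0 dP] := H 1 ltr01.
have l1 : 0 < 1 + normc l by rewrite ltr_wpDr ?normc_ge0.
exists (Num.min d (e / (1 + normc l))) => [|h].
  by rewrite lt_min d0 divr_gt0.
rewrite lt_min ltr_pdivlMr// => /andP[hd he].
apply: le_lt_trans he; rewrite -(subrK (h * l) (G (z + h) - G z)).
apply: le_trans (normcD _ _) _; rewrite normcM mulrDr mulr1.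
by rewrite lerD2r -[leRHS]mul1r dP.
Qed.

Lemma ccont_h k y : (forall z, Im z = y -> ccont k z) -> rcont (fun x => k (x +i* y)).
Proof.
move=> H; split=> x; apply/(@cvgrPdist_lt _ _ _ (nbhs x)) => e e0;
  have [d d0 dP] := H (x +i* y) erefl e e0; near=> t.
  have : normc (k ((x +i* y) + (t - x)%:C) - k (x +i* y)) < e.
    by apply: dP; rewrite normc_real distrC; near: t; exact: nbhsx_ballx.
  have -> : (x +i* y) + (t - x)%:C = t +i* y by apply/eqP; rewrite eq_complex /= subrKC addr0 !eqxx.
  apply: le_lt_trans; apply: le_trans (Re_le_normc _); rewrite distrC.
  by rewrite /=; case: (k _) (k _) => ? ? [].
have : normc (k ((x +i* y) + (t - x)%:C) - k (x +i* y)) < e.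
  by apply: dP; rewrite normc_real distrC; near: t; exact: nbhsx_ballx.
have -> : (x +i* y) + (t - x)%:C = t +i* y by apply/eqP; rewrite eq_complex /= subrKC addr0 !eqxx.
apply: le_lt_trans; apply: le_trans (Im_le_normc _); rewrite distrC.
by rewrite /=; case: (k _) (k _) => ? ? [].
Unshelve. all: by end_near. Qed.

Lemma ccont_v k x : (forall z, Re z = x -> ccont k z) -> rcont (fun y => k (x +i* y)).
Proof.
move=> H.
have tE t : ('i * (t +i* - x) : C) = x +i* t by simpc.
rewrite (_ : (fun y => _) = fun t => k ('i * (t +i* - x))); last first.
  by apply/funext => t; rewrite tE.
apply: (@ccont_h (fun z => k ('i * z)) (- x)) => z zx e e0.
have [|d d0 dP] := H ('i * z) _ e e0.
  by rewrite mulrC ReiNIm zx opprK.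
by exists d => // h hd; rewrite mulrDr; apply: dP; rewrite normcM normc_i mul1r.
Qed.

(** The factor 'i of the vertical sides is dz / dt. *)
Definition hseg k y x0 x1 : C := seg (fun t => k (t +i* y)) x0 x1.
Definition vseg k x y0 y1 : C := 'i * seg (fun t => k (x +i* t)) y0 y1.
Definition rect k x0 x1 y0 y1 : C :=
  hseg k y0 x0 x1 + vseg k x1 y0 y1 - hseg k y1 x0 x1 - vseg k x0 y0 y1.

(** The full lines that carry the sides: integrands are asked to be continuous there,
    so that each side is a function continuous on the whole real line. *)
Definition grid x0 x1 y0 y1 : set C :=
  [set z | Re z = x0 \/ Re z = x1 \/ Im z = y0 \/ Im z = y1].
Definition box x0 x1 y0 y1 : set C :=
  [set z | x0 <= Re z <= x1 /\ y0 <= Im z <= y1].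

Lemma rect_hcat k x0 x1 x2 y0 y1 :
  rect k x0 x1 y0 y1 + rect k x1 x2 y0 y1 = rect k x0 x2 y0 y1.
Proof. by rewrite /rect /hseg -!(seg_cat _ x0 x1 x2); ring. Qed.

Lemma rect_vcat k x0 x1 y0 y1 y2 :
  rect k x0 x1 y0 y1 + rect k x0 x1 y1 y2 = rect k x0 x1 y0 y2.
Proof. by rewrite /rect /vseg -!(seg_cat _ y0 y1 y2); ring. Qed.

Section grid_continuous.
Context (x0 x1 y0 y1 : R).
Local Notation gcont k := (forall z, grid x0 x1 y0 y1 z -> ccont k z).

Let gridh k : gcont k -> rcont (fun x => k (x +i* y0)) /\ rcont (fun x => k (x +i* y1)).
Proof. by move=> H; split; apply: ccont_h => z zy; apply: H; rewrite /grid /=; auto. Qed.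

Let gridv k : gcont k -> rcont (fun y => k (x0 +i* y)) /\ rcont (fun y => k (x1 +i* y)).
Proof. by move=> H; split; apply: ccont_v => z zy; apply: H; rewrite /grid /=; auto. Qed.

Lemma rectD k1 k2 : gcont k1 -> gcont k2 ->
  rect (k1 \+ k2) x0 x1 y0 y1 = rect k1 x0 x1 y0 y1 + rect k2 x0 x1 y0 y1.
Proof.
move=> c1 c2; have [h1 h2] := gridh c1; have [h3 h4] := gridh c2.
have [v1 v2] := gridv c1; have [v3 v4] := gridv c2.
rewrite /rect /hseg /vseg.
have := segD x0 x1 h1 h3; have := segD x0 x1 h2 h4.
have := segD y0 y1 v1 v3; have := segD y0 y1 v2 v4.
by rewrite /GRing.add_fun => -> -> -> ->; ring.
Qed.

Lemma rectZ k (c : C) : gcont k ->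
  rect (fun z => c * k z) x0 x1 y0 y1 = c * rect k x0 x1 y0 y1.
Proof.
move=> ck; have [h1 h2] := gridh ck; have [v1 v2] := gridv ck.
rewrite /rect /hseg /vseg (segZ c x0 x1 h1) (segZ c x0 x1 h2).
by rewrite (segZ c y0 y1 v1) (segZ c y0 y1 v2); ring.
Qed.

Lemma rect_bound k (M : R) : gcont k -> x0 <= x1 -> y0 <= y1 ->
  (forall z, grid x0 x1 y0 y1 z -> box x0 x1 y0 y1 z -> normc (k z) <= M) ->
  normc (rect k x0 x1 y0 y1) <= 4 * M * ((x1 - x0) + (y1 - y0)).
Proof.
move=> ck x01 y01 kM; have [h0 h1] := gridh ck; have [v0 v1] := gridv ck.
have b1 : normc (hseg k y0 x0 x1) <= 2 * M * (x1 - x0).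
  by apply: seg_bound => // t t01; apply: kM; rewrite /grid /box /=; [auto|rewrite lexx].
have b2 : normc (hseg k y1 x0 x1) <= 2 * M * (x1 - x0).
  by apply: seg_bound => // t t01; apply: kM; rewrite /grid /box /=; [auto|rewrite lexx andbT].
have b3 : normc (vseg k x0 y0 y1) <= 2 * M * (y1 - y0).
  rewrite normcM normc_i mul1r.
  by apply: seg_bound => // t t01; apply: kM; rewrite /grid /box /=; [auto|rewrite lexx].
have b4 : normc (vseg k x1 y0 y1) <= 2 * M * (y1 - y0).
  rewrite normcM normc_i mul1r.
  by apply: seg_bound => // t t01; apply: kM; rewrite /grid /box /=; [auto|rewrite lexx andbT].
rewrite /rect; apply: le_trans (normcD _ _) _; rewrite normcN.
apply: le_trans (lerD (normcD _ _) (lexx _)) _; rewrite normcN.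
apply: le_trans (lerD (lerD (normcD _ _) (lexx _)) (lexx _)) _.
lra.
Qed.

(** This is the change of variable z = x + i t in a difference quotient. *)
Lemma rotate_error (u v l : C) :
  - 'i * u - - 'i * v - l = - 'i * (u - v - 'i * l).
Proof.
move: u v l => [a b] [c d] [p q].
by apply/eqP; rewrite eq_complex /=; apply/andP; split; apply/eqP; ring.
Qed.

(** The fundamental theorem of calculus along the four sides: the increments cancel. *)
Lemma rect_primitive G k : (forall z, grid x0 x1 y0 y1 z -> cdiff G z (k z)) ->
  rect k x0 x1 y0 y1 = 0.
Proof.
move=> dG.
have dh y : (forall z, Im z = y -> grid x0 x1 y0 y1 z) ->
    cder (fun t => G (t +i* y)) (fun t => k (t +i* y)).
  move=> yg; apply: cder_eps => t e e0.
  have [d d0 dP] := dG (t +i* y) (yg (t +i* y) erefl) e e0.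
  exists d => // h hd; rewrite -[ `|h| ]normc_real.
  have -> : (t + h) +i* y = (t +i* y) + h%:C by simpc.
  by apply: dP; rewrite normc_real.
have dv x : (forall z, Re z = x -> grid x0 x1 y0 y1 z) ->
    cder (fun t => - 'i * G (x +i* t)) (fun t => k (x +i* t)).
  move=> yg; apply: cder_eps => t e e0.
  have [d d0 dP] := dG (x +i* t) (yg (x +i* t) erefl) e e0.
  exists d => // h hd; rewrite -[ `|h| ]normc_real.
  have -> : x +i* (t + h) = (x +i* t) + 'i * h%:C by simpc.
  have := dP ('i * h%:C); rewrite normcM normc_i mul1r => /(_ _)/wrap[].
    by rewrite normc_real.
  rewrite rotate_error mulrA.
  by rewrite normcM normcN normc_i mul1r.
rewrite /rect /hseg /vseg.
rewrite (segE _ _ (dh y0 _)); last by rewrite /grid /=; auto.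
rewrite (segE _ _ (dh y1 _)); last by rewrite /grid /=; auto.
rewrite (segE _ _ (dv x0 _)); last by rewrite /grid /=; auto.
rewrite (segE _ _ (dv x1 _)); last by rewrite /grid /=; auto.
have E (u v : C) : 'i * (- 'i * u - - 'i * v) = u - v.
  have := rotate_error u v 0; rewrite subr0 mulr0 subr0 => ->.
  rewrite mulNr mulrN mulrA; case: (u - v) => p q.
  by apply/eqP; rewrite eq_complex /=; apply/andP; split; apply/eqP; ring.
by rewrite !E; ring.
Qed.
End grid_continuous.
End goursat.

(** * Goursat's theorem *)

Section bisection.
Context {R : realType}.

Lemma dyadic_half (D : R) n : D / 2 ^+ n = D / 2 ^+ n.+1 + D / 2 ^+ n.+1.
Proof.
rewrite -mulrDl -[D in RHS]mul1r -mulrDl -[1 + 1]/(2%:R).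
by rewrite exprS invfM mulrA [2%:R * _]mulrC mulfK.
Qed.

Lemma dyadic_ge0 (D : R) n : 0 <= D -> 0 <= D / 2 ^+ n.
Proof. by move=> D0; rewrite divr_ge0// exprn_ge0. Qed.

(** Cousin's lemma for a rectangle. If the property fails for a rectangle, it fails for
    one of its quarters; the nested rectangles obtained in this way shrink to a point,
    near which the local hypothesis forbids the failure. *)
Lemma bisection2 (P : nat -> R -> R -> Prop) (A B x0 y0 : R) : 0 <= A -> 0 <= B ->
  (forall n x y, P n.+1 x y -> P n.+1 (x + A / 2 ^+ n.+1) y ->
     P n.+1 x (y + B / 2 ^+ n.+1) -> P n.+1 (x + A / 2 ^+ n.+1) (y + B / 2 ^+ n.+1) ->
     P n x y) ->
  (forall p q, x0 <= p <= x0 + A -> y0 <= q <= y0 + B ->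
     exists N, forall n x y, (N <= n)%N -> x <= p <= x + A / 2 ^+ n ->
       y <= q <= y + B / 2 ^+ n -> P n x y) ->
  P 0%N x0 y0.
Proof.
move=> A0 B0 Pstep Ploc; apply: contrapT => nP0.
have step (s : nat * (R * R)) : exists v : R * R, ~ P s.1 s.2.1 s.2.2 ->
    [/\ ~ P s.1.+1 v.1 v.2, s.2.1 <= v.1 <= s.2.1 + A / 2 ^+ s.1.+1 &
        s.2.2 <= v.2 <= s.2.2 + B / 2 ^+ s.1.+1].
  case: s => n [x y] /=; have [P0|nP] := pselect (P n x y); first by exists (x, y) => /(_ P0).
  apply: contrapT => /forallNP H; apply: nP.
  have hA := dyadic_ge0 n.+1 A0; have hB := dyadic_ge0 n.+1 B0.
  apply: Pstep; apply: contrapT => nP.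
  - by apply: (H (x, y)) => _ /=; rewrite !lexx !lerDl.
  - by apply: (H (x + A / 2 ^+ n.+1, y)) => _ /=; rewrite !lexx !lerDl hA hB.
  - by apply: (H (x, y + B / 2 ^+ n.+1)) => _ /=; rewrite !lexx !lerDl hA hB.
  - by apply: (H (x + A / 2 ^+ n.+1, y + B / 2 ^+ n.+1)) => _ /=; rewrite !lexx !lerDl hA hB.
have [next nextP] := choice step.
pose u := fix u n := if n is m.+1 then next (m, u m) else (x0, y0).
have uP n : ~ P n (u n).1 (u n).2.
  by elim: n => // n IH; have [] := nextP (n, u n) IH.
pose X n := (u n).1; pose Y n := (u n).2.
have Xstep n : X n <= X n.+1 <= X n + A / 2 ^+ n.+1.
  by have [] := nextP (n, u n) (uP n).
have Ystep n : Y n <= Y n.+1 <= Y n + B / 2 ^+ n.+1.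
  by have [] := nextP (n, u n) (uP n).
have nested (Z : nat -> R) (D : R) : 0 <= D ->
    (forall n, Z n <= Z n.+1 <= Z n + D / 2 ^+ n.+1) ->
    exists p, forall n, Z n <= p <= Z n + D / 2 ^+ n.
  move=> D0 Zs.
  have Zmono n m : (n <= m)%N -> Z n <= Z m.
    move=> /subnK <-; elim: (m - n)%N => [|k IH]; first by rewrite add0n.
    by rewrite addSn; apply: le_trans IH _; have /andP[] := Zs (k + n)%N.
  have Ztop n m : (n <= m)%N -> Z m + D / 2 ^+ m <= Z n + D / 2 ^+ n.
    move=> /subnK <-; elim: (m - n)%N => [|k IH]; first by rewrite add0n.
    rewrite addSn; apply: le_trans IH.
    have /andP[_ h] := Zs (k + n)%N; rewrite [leRHS](_ : _ = Z (k + n)%N + D / 2 ^+ (k + n).+1 + D / 2 ^+ (k + n).+1) ?lerD2r//.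
    by rewrite dyadic_half addrA.
  have Zub n m : Z m <= Z n + D / 2 ^+ n.
    have [nm|/ltnW mn] := leqP n m.
      by apply: le_trans (Ztop _ _ nm); rewrite lerDl dyadic_ge0.
    by apply: le_trans (Zmono _ _ mn) _; rewrite lerDl dyadic_ge0.
  exists (sup (range Z)) => n; apply/andP; split.
    by apply: ub_le_sup; [exists (Z n + D / 2 ^+ n) => _ [m _ <-]|exists n].
  by apply: sup_le_ub => [|_ [m _ <-]//]; exists (Z n), n.
have [p pP] := nested X A A0 Xstep; have [q qP] := nested Y B B0 Ystep.
have := pP 0%N; have := qP 0%N; rewrite expr0 !divr1 => q0 p0.
have [N NP] := Ploc p q p0 q0.
exact: (uP N (NP N (X N) (Y N) (leqnn N) (pP N) (qP N))).
Qed.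

End bisection.

Section goursat.
Context {R : realType}.
Local Notation C := R[i].
Local Notation Re := (@complex.Re R).
Local Notation Im := (@complex.Im R).
Implicit Types (k G : C -> C) (z p : C) (x y e : R).

Lemma cdiff_quadratic (c l p z : C) :
  cdiff (fun z => c * z + l * (z - p) ^+ 2 / 2) z (c + l * (z - p)).
Proof.
move=> e e0; have l1 : 0 < normc (l / 2) + 1 by rewrite ltr_wpDl ?normc_ge0.
exists (e / (normc (l / 2) + 1)) => [|h]; first by rewrite divr_gt0.
rewrite ltr_pdivlMr// => hd.
have -> : c * (z + h) + l * (z + h - p) ^+ 2 / 2 - (c * z + l * (z - p) ^+ 2 / 2)
   - h * (c + l * (z - p)) = l / 2 * h * h by field.
rewrite !normcM ler_wpM2r ?normc_ge0// mulrC.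
rewrite -normcM; apply: ltW; apply: le_lt_trans hd.
by rewrite normcM ler_wpM2l ?normc_ge0// lerDl.
Qed.

Lemma rect_affine (c l p : C) x0 x1 y0 y1 : rect (fun z => c + l * (z - p)) x0 x1 y0 y1 = 0.
Proof. exact: rect_primitive (fun z _ => cdiff_quadratic c l p z). Qed.

Lemma ccontD k1 k2 z : ccont k1 z -> ccont k2 z -> ccont (k1 \+ k2) z.
Proof.
move=> c1 c2 e e0; have e20 : 0 < e / 2 by rewrite divr_gt0.
have [d1 d10 P1] := c1 _ e20; have [d2 d20 P2] := c2 _ e20.
exists (Num.min d1 d2) => [|h]; first by rewrite lt_min d10.
rewrite lt_min => /andP[h1 h2]; rewrite /= opprD addrACA (splitr e).
by apply: le_lt_trans (normcD _ _) _; rewrite ltrD ?P1 ?P2.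
Qed.

Lemma cdiff_affine (c l p z : C) : cdiff (fun z => c + l * (z - p)) z l.
Proof.
move=> e e0; exists 1 => // h _.
rewrite (_ : _ - _ - _ = 0); last by ring.
by rewrite normc0 mulr_ge0 ?normc_ge0 ?(ltW e0).
Qed.

(** Subdivide the rectangle and bound each dyadic piece by its share of [e]. Near a
    point of differentiability [k] is affine up to an error small compared with the
    diameter, the affine part integrates to 0, and the integral of the error is small
    compared with the square of the diameter, that is with the area. *)
Lemma goursat k x0 y0 (A B : R) : 0 <= A -> 0 <= B ->
  (forall z, ccont k z) ->
  (forall z, box x0 (x0 + A) y0 (y0 + B) z -> exists l, cdiff k z l) ->
  rect k x0 (x0 + A) y0 (y0 + B) = 0.
Proof.
move=> A0 B0 ck dk; apply: eq0_normc; apply/eqP.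
rewrite eq_le normc_ge0 andbT; apply/ler_addgt0Pl => e e0; rewrite addr0.
pose P n x y := normc (rect k x (x + A / 2 ^+ n) y (y + B / 2 ^+ n)) <= e / 4 ^+ n.
suff : P 0%N x0 y0 by rewrite /P expr0 !divr1.
apply: (@bisection2 _ P A B) => //.
  move=> n x y; rewrite /P (dyadic_half A n) (dyadic_half B n) !addrA.
  set a := A / 2 ^+ n.+1; set b := B / 2 ^+ n.+1 => h1 h2 h3 h4.
  rewrite -(rect_vcat _ _ _ _ (y + b)) -(rect_hcat _ _ (x + a)).
  rewrite -(rect_hcat _ _ (x + a) _ (y + b)).
  have -> : e / 4 ^+ n = (e / 4 ^+ n.+1 + e / 4 ^+ n.+1) + (e / 4 ^+ n.+1 + e / 4 ^+ n.+1).
    rewrite exprS invfM; set t := 4 ^- n; lra.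
  apply: le_trans (normcD _ _) _.
  apply: le_trans (lerD (normcD _ _) (normcD _ _)) _.
  by rewrite !lerD.
move=> p q pA qB; have [l lP] := dk (p +i* q) (conj pA qB).
(* The slope error for which the final bound 4 e' (A + B)^2 / 4^n is at most e / 4^n. *)
pose e' := e / (4 * (A + B) ^+ 2 + 1).
have den0 : 0 < 4 * (A + B) ^+ 2 + 1 by rewrite ltr_wpDl// mulr_ge0// sqr_ge0.
have e'0 : 0 < e' by rewrite divr_gt0.
have [d d0 dP] := lP e' e'0.
have [N NP] : exists N, forall n, (N <= n)%N -> (A + B) / 2 ^+ n < d.
  have [-> | AB0] := eqVneq (A + B) 0; first by exists 0%N => n _; rewrite mul0r.
  have ABp : 0 < A + B by rewrite lt_def AB0 addr_ge0.
  exists (Num.bound ((A + B) / d)) => n Nn.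
  rewrite ltr_pdivrMr ?exprn_gt0// -ltr_pdivrMl// mulrC.
  apply: lt_trans (archi_boundP (divr_ge0 (ltW ABp) (ltW d0))) _.
  apply: (@le_lt_trans _ _ n%:R); first by rewrite ler_nat.
  by rewrite -natrX ltr_nat ltn_expl.
exists N => n x y Nn px qy; rewrite /P.
set a := A / 2 ^+ n; set b := B / 2 ^+ n.
have a0 : 0 <= a by exact: dyadic_ge0.
have b0 : 0 <= b by exact: dyadic_ge0.
pose aff (z : C) := k (p +i* q) + l * (z - (p +i* q)).
pose r z := k z + (- 1) * aff z.
have cN : forall z, ccont (fun z => -1 * aff z) z.
  move=> z; apply: (@cdiff_ccont _ _ _ (- l)).
  have := @cdiff_affine (- k (p +i* q)) (- l) (p +i* q) z.
  rewrite /aff (_ : (fun _ => _) = (fun z => -1 * (k (p +i* q) + l * (z - (p +i* q)))))//.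
  by apply/funext => v; ring.
have -> : rect k x (x + a) y (y + b) = rect r x (x + a) y (y + b).
  rewrite (rectD (fun z _ => ck z) (fun z _ => cN z)).
  rewrite rectZ ?rect_affine ?mulr0 ?addr0// => z _.
  exact: cdiff_ccont (cdiff_affine _ _ _ _).
have bound : normc (rect r x (x + a) y (y + b)) <=
    4 * (e' * (a + b)) * ((x + a - x) + (y + b - y)).
  apply: rect_bound; rewrite ?lerDl//.
    by move=> z _; apply: (ccontD (ck z) (cN z)).
  move=> z _ [zx zy].
  have zab : normc (z - (p +i* q)) <= a + b.
    apply: le_trans (normc_le_ReIm _) _; move: zx zy px qy; rewrite -/a -/b.
    by case: z => u v /= *; apply: lerD; rewrite ler_norml; lra.
  have zd : normc (z - (p +i* q)) < d.
    by apply: le_lt_trans zab _; rewrite /a /b -mulrDl NP.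
  have := dP _ zd; rewrite subrKC => /le_trans h.
  apply: le_trans (h _ (ler_wpM2l (ltW e'0) zab)).
  by rewrite /r /aff le_eqVlt; apply/orP; left; apply/eqP; congr normc; ring.
apply: le_trans bound _.
rewrite (_ : _ + _ = a + b); last by ring.
rewrite /a /b -mulrDl; set S := A + B.
have -> : 4 * (e' * (S / 2 ^+ n)) * (S / 2 ^+ n) = e' * (4 * S ^+ 2) / 4 ^+ n.
  have -> : (4 : R) ^+ n = 2 ^+ n * 2 ^+ n by rewrite -exprMn; congr (_ ^+ _); ring.
  by field; rewrite expf_neq0.
rewrite ler_pM2r ?invr_gt0 ?exprn_gt0// /e' mulrAC ler_pdivrMr//.
by rewrite ler_pM2l// lerDl.
Qed.

End goursat.

(** * Cauchy's formula on a square *)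

Section cauchy.
Context {R : realType}.
Local Notation C := R[i].
Local Notation Re := (@complex.Re R).
Local Notation Im := (@complex.Im R).
Implicit Types (k G : C -> C) (f g : R[i]^o -> R[i]^o) (z p a : C) (x y e : R).

Lemma ccontZ k (c : C) z : ccont k z -> ccont (fun z => c * k z) z.
Proof.
move=> ck e e0; have n1 : 0 < normc c + 1 by rewrite ltr_wpDl ?normc_ge0.
have [d d0 dP] := ck (e / (normc c + 1)) (divr_gt0 e0 n1).
exists d => // h /dP; rewrite ltr_pdivlMr// -mulrBr normcM mulrC => h1.
by apply: le_lt_trans h1; rewrite ler_wpM2r ?normc_ge0 ?lerDl.
Qed.

(** Continuity suffices at one point: cut out a square of side 2 r around it; the
    integral over its boundary is of the order of [r]. *)
Lemma goursat_punctured k p x0 x1 y0 y1 : x0 < Re p < x1 -> y0 < Im p < y1 ->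
  (forall z, ccont k z) -> (forall z, z != p -> exists l, cdiff k z l) ->
  rect k x0 x1 y0 y1 = 0.
Proof.
move=> px py ck dk.
have G u0 u1 v0 v1 : u0 <= u1 -> v0 <= v1 -> ~ box u0 u1 v0 v1 p -> rect k u0 u1 v0 v1 = 0.
  move=> u01 v01 np.
  have := @goursat R k u0 v0 (u1 - u0) (v1 - v0); rewrite !subrKC !subr_ge0; apply=> //.
  by move=> z zb; apply: dk; apply: contra_notN np => /eqP <-.
apply: eq0_normc; apply/eqP; rewrite eq_le normc_ge0 andbT.
apply/ler_addgt0Pl => e e0; rewrite addr0.
have [d d0 dP] := ck p 1 ltr01.
pose M := normc (k p) + 1; have M0 : 0 < M by rewrite ltr_wpDl ?normc_ge0.
pose r := Num.min (Num.min (d / 4) (e / (16 * M)))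
  (Num.min (Num.min (Re p - x0) (x1 - Re p)) (Num.min (Im p - y0) (y1 - Im p))).
have r0 : 0 < r.
  rewrite !lt_min !divr_gt0 ?mulr_gt0//=; move: px py => /andP[? ?] /andP[? ?].
  by rewrite !subr_gt0; do ?[apply/andP; split].
have : r <= r by [].
rewrite {2}/r !le_min => /andP[/andP[rd re] /andP[/andP[rx0 rx1] /andP[ry0 ry1]]].
have split3 u0 u1 u2 u3 : rect k u0 u3 y0 y1 = rect k u0 u1 y0 y1 + rect k u1 u2 y0 y1 + rect k u2 u3 y0 y1.
  by rewrite !rect_hcat.
have split3v u0 u1 v0 v1 v2 v3 : rect k u0 u1 v0 v3 = rect k u0 u1 v0 v1 + rect k u0 u1 v1 v2 + rect k u0 u1 v2 v3.
  by rewrite !rect_vcat.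
move: px py => /andP[px0 px1] /andP[py0 py1].
rewrite (split3 x0 (Re p - r) (Re p + r) x1) (G x0 (Re p - r)) ?(G (Re p + r) x1); last 6 first.
- by clear -rx1; clearbody r; lra.
- by clear -py0 py1; lra.
- by rewrite /box /= => -[b1 _]; clear -r0 b1; clearbody r; lra.
- by clear -rx0; clearbody r; lra.
- by clear -py0 py1; lra.
- by rewrite /box /= => -[b1 _]; clear -r0 b1; clearbody r; lra.
rewrite (split3v _ _ y0 (Im p - r) (Im p + r) y1) (G _ _ y0) ?(G _ _ (Im p + r)); last 6 first.
- by clear -r0; clearbody r; lra.
- by clear -ry1; clearbody r; lra.
- by rewrite /box /= => -[_ b1]; clear -r0 b1; clearbody r; lra.
- by clear -r0; clearbody r; lra.
- by clear -ry0; clearbody r; lra.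
- by rewrite /box /= => -[_ b1]; clear -r0 b1; clearbody r; lra.
rewrite !add0r !addr0.
apply: le_trans (@rect_bound _ _ _ _ _ k M _ _ _ _) _ => //; try lra.
  move=> z _ [zx zy].
  have : normc (z - p) < d.
    apply: le_lt_trans (normc_le_ReIm _) _; move: zx zy; case: z (p) => u v [s t] /= *.
    apply: (@le_lt_trans _ _ (r + r)); last lra.
    by apply: lerD; rewrite ler_norml; lra.
  move=> /dP; rewrite subrKC => h; rewrite /M -[k z](subrK (k p)) addrC.
  by apply: le_trans (normcD _ _) _; rewrite lerD2l ltW.
move: re; rewrite ler_pdivlMr ?mulr_gt0//; set S := r * _ => re.
by apply: le_trans re; rewrite /S; lra.
Qed.

Lemma rect_ext k1 k2 x0 x1 y0 y1 :
  (forall z, grid x0 x1 y0 y1 z -> k1 z = k2 z) -> rect k1 x0 x1 y0 y1 = rect k2 x0 x1 y0 y1.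
Proof.
move=> E; rewrite /rect /hseg /vseg.
by congr (seg _ _ _ + 'i * seg _ _ _ - seg _ _ _ - 'i * seg _ _ _);
  apply/funext => t; apply: E; rewrite /grid /=; auto.
Qed.

Lemma derivable_cdiff g z : derivable g z (1 : R[i]^o) -> cdiff g z ('D_(1 : R[i]^o) g z).
Proof.
move=> dg e e0.
have ec0 : (0 : C) < e%:C by rewrite ltcR.
have /cvgrPdist_le/(_ _ ec0) := dg.
rewrite -/(derive g z (1 : R[i]^o)) => /nbhs_ballP[r /= /gt0_real[d1 d0 ->] dP].
exists d1 => // h hd.
have [->|h0] := eqVneq h 0.
  by rewrite addr0 subrr mul0r subr0 normc0 mulr0.
have := dP h; rewrite /ball /= sub0r normrN normc_lt => /(_ hd h0).
rewrite [leLHS]normcEn lecR => h1.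
rewrite -ler_pdivrMr; last first.
  exact: normc_gt0.
apply: le_trans h1; rewrite -normcV -normcM -normcN.
rewrite le_eqVlt; apply/orP; left; apply/eqP; congr normc.
rewrite /GRing.scale /= mulr1 [h + z]addrC; set D := derive _ _ _; set u := g (z + h); set v := g z.
by field.
Qed.

Lemma inv_derivable z a : z - a != 0 ->
  derivable (fun z : R[i]^o => (z - a)^-1 : R[i]^o) z (1 : R[i]^o).
Proof.
move=> za; apply: (@derivableV R[i] (R[i]^o) (fun z : R[i]^o => z - a)) => //.
Qed.

Lemma mul_derivable f g z : derivable f z (1 : R[i]^o) -> derivable g z (1 : R[i]^o) ->
  derivable (fun z : R[i]^o => (f z * g z : R[i]^o)) z (1 : R[i]^o).
Proof.
move=> df dg; have h := @derivableM R[i] (R[i]^o) f g z (1 : R[i]^o).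
have {}h := h df dg; exact h.
Qed.

Lemma exp_derivable n f z : derivable f z (1 : R[i]^o) ->
  derivable (fun z : R[i]^o => (f z ^+ n : R[i]^o)) z (1 : R[i]^o).
Proof.
move=> df; elim: n => [|n IH].
  rewrite (_ : (fun _ => _) = cst 1); first exact: derivable_cst.
  by apply/funext => t; rewrite expr0.
rewrite (_ : (fun _ => _) = (fun z => f z * f z ^+ n)); first exact: mul_derivable.
by apply/funext => t; rewrite exprS.
Qed.

Lemma cdiff_quotient g z a : z - a != 0 -> derivable g z (1 : R[i]^o) ->
  exists l, cdiff (fun z => g z / (z - a)) z l.
Proof.
move=> za dg; have h := mul_derivable dg (inv_derivable za).
by have h' := derivable_cdiff h; eexists; exact h'.
Qed.

(** The factor z^-n appears when the kernel 1 / (z - a) of Cauchy's formula is expanded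
    in powers of a / z. *)
Definition cauchy_kernel n a z : C := (z^-1 ^+ n) * (z - a)^-1.

Lemma kernel_derivable n a z : z != 0 -> z - a != 0 ->
  derivable (cauchy_kernel n a : R[i]^o -> R[i]^o) z (1 : R[i]^o).
Proof.
move=> z0 za.
have /inv_derivable h : z - 0 != 0 by rewrite subr0.
have E : (fun z : R[i]^o => (z - 0)^-1 : R[i]^o) = (fun z => z^-1).
  by apply/funext => t; rewrite subr0.
rewrite E in h; have h1 := mul_derivable (@exp_derivable n _ _ h) (inv_derivable za).
exact h1.
Qed.

(** The contour is the boundary of the square of half-side 2: on it |z| lies between 2
    and 4, and z is at distance at least 1 from the unit disc. *)
Definition oint k : C := rect k (- 2) 2 (- 2) 2.
Local Notation gridS := (grid (- 2) 2 (- 2) 2 : set C).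
Local Notation inside a := (-2 < Re a < 2 /\ -2 < Im a < 2).

Lemma grid_outside a z : inside a -> gridS z -> z - a != 0.
Proof.
move=> [a1 a2] zS; rewrite subr_eq0; apply/eqP => E; move: a1 a2; rewrite -E.
by case: zS => [->|[->|[->|->]]]; lra.
Qed.

Lemma inside0 : inside (0 : C).
Proof. by split => /=; lra. Qed.

Lemma inside1 a : normc a <= 1 -> inside a.
Proof.
move=> a1; have := le_trans (Re_le_normc a) a1; have := le_trans (Im_le_normc a) a1.
by rewrite !ler_norml; lra.
Qed.

Lemma kernel_grid_ccont g n a z : (forall z, derivable g z (1 : R[i]^o)) -> inside a ->
  gridS z -> ccont (fun z => g z * cauchy_kernel n a z) z.
Proof.
move=> dg ia zS; have kd : derivable (cauchy_kernel n a : R[i]^o -> R[i]^o) z (1 : R[i]^o).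
  apply: kernel_derivable; last exact: grid_outside zS.
  by rewrite -[z]subr0; apply: grid_outside zS; exact: inside0.
have h := derivable_cdiff (mul_derivable (dg z) kd); exact: cdiff_ccont h.
Qed.

Lemma derivable_cst1 z : derivable (fun _ : R[i]^o => 1 : R[i]^o) z (1 : R[i]^o).
Proof. exact: derivable_cst. Qed.

(** The difference quotient of [g] at [a] is continuous everywhere and differentiable
    away from [a], so its integral vanishes. The winding number of the contour is left
    as an integral. *)
Lemma cauchy_formula g a : (forall z, derivable g z (1 : R[i]^o)) -> inside a ->
  oint (fun z => g z * cauchy_kernel 0 a z) = g a * oint (fun z => 1 * cauchy_kernel 0 a z).
Proof.
move=> dg ia; pose l := derive g a (1 : R[i]^o).
pose k z := if z == a then l else (g z - g a) / (z - a).
have dB (z : R[i]^o) : derivable (fun z : R[i]^o => g z - g a : R[i]^o) z (1 : R[i]^o).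
  have h := derivableB (dg z) (derivable_cst (g a : R[i]^o) z (1 : R[i]^o)); exact h.
have kE z : z != a -> k z = (g z - g a) / (z - a) by move=> za; rewrite /k (negbTE za).
have dk z : z != a -> exists m, cdiff k z m.
  rewrite -subr_eq0 => za.
  have [m mP] := @cdiff_quotient (fun z => g z - g a) z a za (dB z).
  exists m => e e0; have [d d0 dP] := mP e e0.
  have za0 := normc_gt0 za.
  exists (Num.min d (normc (z - a))) => [|h]; first by rewrite lt_min d0.
  rewrite lt_min => /andP[/dP h1 h2].
  have zha : z + h != a.
    apply/eqP => E; move: h2; have -> : z - a = - h by apply/eqP; rewrite -subr_eq0 -E; apply/eqP; ring.
    by rewrite normcN ltxx.
  rewrite subr_eq0 in za; rewrite (kE _ za) (kE _ zha); exact: h1.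
have ck z : ccont k z.
  have [->|/dk[m]] := eqVneq z a; last exact: cdiff_ccont.
  move=> e e0; have e20 : 0 < e / 2 by rewrite divr_gt0.
  have [d d0 dP] := derivable_cdiff (dg a) e20; exists d => // h /dP.
  rewrite /k eqxx -subr_eq0 [a + h]addrC addrK.
  case: eqVneq => [-> _|h0]; first by rewrite subrr normc0.
  rewrite -ler_pdivrMr ?normc_gt0// -normcV -normcM => h1.
  apply: (@le_lt_trans _ _ (e / 2)); last by rewrite ltr_pdivrMr// ltr_pMr// ltr1n.
  apply: le_trans h1; rewrite le_eqVlt; apply/orP; left; apply/eqP; congr normc.
  by rewrite -/l; field.
have := goursat_punctured ia.1 ia.2 ck dk.
have c1 := @kernel_grid_ccont g 0 a _ dg ia.
have c2 := @kernel_grid_ccont (fun=> 1) 0 a _ derivable_cst1 ia.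
pose b : C := - g a; pose f2 z := b * (1 * cauchy_kernel 0 a z).
have E := @rectZ R (-2) 2 (-2) 2 _ b c2.
have cf2 z : gridS z -> ccont f2 z.
  by move=> zS; apply: ccontZ; exact: c2.
have E2 := @rectD R (-2) 2 (-2) 2 _ _ c1 cf2.
have -> : rect k (-2) 2 (-2) 2 = rect ((fun z => g z * cauchy_kernel 0 a z) \+ f2) (-2) 2 (-2) 2.
  have kgrid z : gridS z -> k z = ((fun z => g z * cauchy_kernel 0 a z) \+ f2) z.
    move=> /(grid_outside ia); rewrite subr_eq0 => /kE ->.
    by rewrite /= /f2 /b /cauchy_kernel !expr0; ring.
  exact: rect_ext.
rewrite E2 {}E /b => /eqP; rewrite mulNr subr_eq0 => /eqP h; exact: h.
Qed.

End cauchy.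

(** * Taylor expansion *)

Section taylor.
Context {R : realType}.
Local Notation C := R[i].
Local Notation Re := (@complex.Re R).
Local Notation Im := (@complex.Im R).
Implicit Types (k G : C -> C) (f g : R[i]^o -> R[i]^o) (z p a : C) (x y e : R).
Local Notation gridS := (grid (- 2) 2 (- 2) 2 : set C).
Local Notation boxS := (box (- 2) 2 (- 2) 2 : set C).
Local Notation inside a := (-2 < Re a < 2 /\ -2 < Im a < 2).

Lemma pow_primitive n z : z != 0 ->
  cdiff (fun z => - n.+1%:R^-1 * z^-1 ^+ n.+1) z (1 * cauchy_kernel n.+1 0 z).
Proof.
move=> z0.
have dV : derivable (fun z : R[i]^o => z^-1 : R[i]^o) z (1 : R[i]^o).
  have /inv_derivable h : z - 0 != 0 by rewrite subr0.
  have E : (fun z : R[i]^o => (z - 0)^-1 : R[i]^o) = (fun z => z^-1).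
    by apply/funext => t; rewrite subr0.
  by rewrite E in h.
have eV : 'D_(1 : R[i]^o) (fun z : R[i]^o => z^-1 : R[i]^o) z = - z ^- 2.
  have := @deriveV R[i] (R[i]^o) id z 1 z0 (@derivable_id R[i] (R[i]^o) z 1).
  by rewrite derive_id => ->; rewrite /GRing.scale /= mulr1.
have dX := @exp_derivable R n.+1 _ _ dV.
have eX : 'D_(1 : R[i]^o) (fun z : R[i]^o => z^-1 ^+ n.+1 : R[i]^o) z
    = n.+1%:R * z^-1 ^+ n * (- z ^- 2).
  have := @deriveX R[i] (R[i]^o) (fun z => z^-1) n.+1 z 1 dV.
  rewrite eV => h.
  have E : (fun z : R[i]^o => z^-1 ^+ n.+1 : R[i]^o) = (fun z : R[i]^o => z^-1 : R[i]^o) ^+ n.+1.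
    by apply/funext => t; rewrite exprfctE.
  by rewrite E h.
have h := derivable_cdiff dX; rewrite eX in h.
move=> e e0; have n0 : (0 : R) < n.+1%:R by rewrite ltr0n.
have [d d0 dP] := h (e * n.+1%:R) (mulr_gt0 e0 n0).
have n0' : (n.+1%:R : C) != 0 by rewrite pnatr_eq0.
have nn := @normc_nat R n.+1.
exists d => // t /dP; rewrite [e * _ * _]mulrAC -(ler_pdivrMr _ _ n0) => h1.
apply: le_trans h1; rewrite mulrC -nn -normcV -normcM -normcN.
rewrite le_eqVlt; apply/orP; left; apply/eqP; congr normc.
rewrite /cauchy_kernel subr0; set v := (z + t)^-1 ^+ n.+1; rewrite [z^-1 ^+ n.+1]exprS.
move: n0'; set N := n.+1%:R; move: N v (z^-1 ^+ n) => N v u N0.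
by field; rewrite N0.
Qed.

Lemma oint_pow n : oint (fun z : C => 1 * cauchy_kernel n.+1 0 z) = 0.
Proof.
apply: (@rect_primitive R _ _ _ _ (fun z => - n.+1%:R^-1 * z^-1 ^+ n.+1)) => z zS.
by apply: pow_primitive; rewrite -[z]subr0; exact: grid_outside (@inside0 R) zS.
Qed.

(** Adding the contributions of opposite sides, the integral of 1 / z is that of
    8 i / (4 + t^2) over [-2, 2], whose imaginary part is positive. *)
Lemma oint_inv_neq0 : oint (fun z : C => 1 * cauchy_kernel 0 0 z) != 0.
Proof.
pose k z : C := 1 * cauchy_kernel 0 0 z.
have ck z : gridS z -> ccont k z.
  exact: kernel_grid_ccont derivable_cst1 (@inside0 R).
have [h1 h2 v1 v2] : [/\ rcont (fun t => k (t +i* -2)), rcont (fun t => k (t +i* 2)),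
   rcont (fun t => k (-2 +i* t)) & rcont (fun t => k (2 +i* t))].
  by split; [apply: ccont_h|apply: ccont_h|apply: ccont_v|apply: ccont_v] => z zE;
    apply: ck; rewrite /grid /=; auto.
have [H1 P1] := cder_exists h1; have [H2 P2] := cder_exists h2.
have [V1 Q1] := cder_exists v1; have [V2 Q2] := cder_exists v2.
rewrite /oint /rect /hseg /vseg (segE _ _ P1) (segE _ _ P2) (segE _ _ Q1) (segE _ _ Q2).
pose F := ((H1 \+ (fun t => (-1) * H2 t)) \+ (fun t => 'i * V2 t)) \+ (fun t => - 'i * V1 t).
have dF := cderD (cderD (cderD P1 (cderZ (-1) P2)) (cderZ 'i Q2)) (cderZ (- 'i) Q1).
have [||t _] := @MVT_segment R (Im \o F) _ (-2) 2 _ (fun t _ => (dF t).2).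
- lra.
- apply: derivable_within_continuous => t _; exact: (@ex_derive _ _ _ _ _ _ _ (dF t).2).
move=> E; apply/eqP => E0.
have E1 : F 2 - F (-2) = 0 by rewrite -[RHS]E0 /F /=; ring.
have E2 : (Im \o F) 2 - (Im \o F) (-2) = 0.
  by rewrite -[RHS]/(Im (0 : C)) -E1 /=; case: (F 2) (F (-2)) => ? ? [].
move: E; rewrite {}E2 => /esym/eqP; rewrite mulf_eq0 => /orP[|]; last by move=> /eqP; lra.
set v := Im _; suff -> : v = 8 / (4 + t ^+ 2).
  have t4 : 0 < 4 + t ^+ 2 by rewrite ltr_wpDr// sqr_ge0.
  by rewrite gt_eqF// divr_gt0.
have t4 : 4 + t ^+ 2 != 0 by rewrite gt_eqF// ltr_wpDr// sqr_ge0.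
have inv (x y : R) : x ^+ 2 + y ^+ 2 = 4 + t ^+ 2 ->
    k (x +i* y) = (x / (4 + t ^+ 2)) +i* (- y / (4 + t ^+ 2)).
  move=> xy; rewrite /k /cauchy_kernel expr0 subr0 !mul1r -xy.
  by apply/eqP; rewrite eq_complex /= mulNr !eqxx.
rewrite -[v]/(Im (k (t +i* -2) + (-1) * k (t +i* 2) + 'i * k (2 +i* t) + - 'i * k (-2 +i* t))).
rewrite !inv; try ring.
by rewrite /=; field.
Qed.

Lemma cauchy_kernelS n a z : z != 0 -> z - a != 0 ->
  cauchy_kernel n a z = cauchy_kernel n 0 z + a * cauchy_kernel n.+1 a z.
Proof.
move=> z0 za; rewrite /cauchy_kernel subr0 exprS.
by move: (z^-1 ^+ n) => u; field; rewrite za.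
Qed.

Lemma oint_kernelS g n a : (forall z, derivable g z (1 : R[i]^o)) -> inside a ->
  oint (fun z => g z * cauchy_kernel n a z) =
  oint (fun z => g z * cauchy_kernel n 0 z) + a * oint (fun z => g z * cauchy_kernel n.+1 a z).
Proof.
move=> dg ia.
have c0 := @kernel_grid_ccont R g n 0 _ dg (@inside0 R).
have c1 := @kernel_grid_ccont R g n.+1 a _ dg ia.
rewrite /oint -rectZ// -rectD//; last by move=> z zS; apply: ccontZ; exact: c1.
apply: rect_ext => z zS /=; rewrite cauchy_kernelS.
- by ring.
- by rewrite -[z]subr0; exact: grid_outside (@inside0 R) zS.
- exact: grid_outside zS.
Qed.

Lemma oint_kernel_sum g N a : (forall z, derivable g z (1 : R[i]^o)) -> inside a ->
  oint (fun z => g z * cauchy_kernel 0 a z) =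
  \sum_(n < N) oint (fun z => g z * cauchy_kernel n 0 z) * a ^+ n +
    a ^+ N * oint (fun z => g z * cauchy_kernel N a z).
Proof.
move=> dg ia; elim: N => [|N ->]; first by rewrite big_ord0 add0r expr0 mul1r.
rewrite big_ord_recr /= (oint_kernelS N dg ia) exprSr; ring.
Qed.

Lemma oint_kernel_bound g N a (B : R) : (forall z, derivable g z (1 : R[i]^o)) ->
  normc a <= 1 -> (forall z, normc z <= 4 -> normc (g z) <= B) ->
  normc (oint (fun z => g z * cauchy_kernel N a z)) <= 32 * B * 2^-1 ^+ N.
Proof.
move=> dg a1 gB; have ia := inside1 a1.
have c1 := @kernel_grid_ccont R g N a _ dg ia.
have B0 : 0 <= B by apply: le_trans (normc_ge0 _) (gB 0 _); rewrite normc0.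
have H : normc (oint (fun z => g z * cauchy_kernel N a z)) <=
    4 * (B * 2^-1 ^+ N) * ((2 - -2) + (2 - -2)).
  apply: rect_bound => //; try lra.
  move=> z zS [zx zy].
  have z2 : 2 <= normc z.
    have := Re_le_normc z; have := Im_le_normc z; rewrite !ler_norml.
    by case: zS => [->|[->|[->|->]]]; lra.
  have z4 : normc z <= 4.
    apply: le_trans (normc_le_ReIm z) _.
    have h1 : `|Re z| <= 2 by rewrite ler_norml.
    have h2 : `|Im z| <= 2 by rewrite ler_norml.
    lra.
  have za1 : 1 <= normc (z - a).
    have := normcD (z - a) a; rewrite subrK; lra.
  rewrite /cauchy_kernel !normcM; apply: ler_pM; rewrite ?mulr_ge0 ?normc_ge0//.
    exact: gB.
  rewrite -[leRHS]mulr1; apply: ler_pM; rewrite ?normc_ge0//; last first.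
    by rewrite normcV invf_le1// (lt_le_trans _ za1).
  rewrite normcX normcV lerXn2r ?nnegrE ?invr_ge0 ?normc_ge0//.
  by rewrite lef_pV2// posrE; lra.
apply: le_trans H _; set u := _ ^+ N; lra.
Qed.

(** Expand 1 / (z - a) in powers of a / z: all terms but the first have an
    antiderivative, and the remainder tends to 0. *)
Lemma oint_winding a : normc a <= 1 ->
  oint (fun z => 1 * cauchy_kernel 0 a z) = oint (fun z => 1 * cauchy_kernel 0 0 z).
Proof.
move=> a1; apply/eqP; rewrite -subr_eq0; apply/eqP; apply: eq0_normc; apply/eqP.
rewrite eq_le normc_ge0 andbT; apply/ler_addgt0Pl => e e0; rewrite addr0.
pose N := (Num.bound (32 / e)).+1.
have -> : oint (fun z => 1 * cauchy_kernel 0 a z) - oint (fun z => 1 * cauchy_kernel 0 0 z)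
   = a ^+ N * oint (fun z => 1 * cauchy_kernel N a z).
  have E := @oint_kernel_sum (fun=> 1) N a (@derivable_cst1 R) (inside1 a1).
  rewrite {}E big_ord_recl big1 => [|i _].
    by rewrite expr0 mulr1 addr0 addrAC subrr add0r.
  by rewrite (oint_pow i) mul0r.
have := @oint_kernel_bound (fun=> 1) N a 1 (@derivable_cst1 R) a1.
move=> /(_ _)/wrap[]; first by move=> z _; rewrite normc1.
rewrite mulr1 => h; rewrite normcM.
have aN : normc (a ^+ N) <= 1.
  elim: (N) => [|m IH]; first by rewrite expr0 normc1.
  by rewrite exprS normcM mulr_ile1 ?normc_ge0.
apply: le_trans (_ : 32 * 2^-1 ^+ N <= e).
  apply: le_trans h; rewrite -[leRHS]mul1r; apply: ler_wpM2r => //; exact: normc_ge0.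
rewrite exprVn ler_pdivrMr ?exprn_gt0// -ler_pdivrMl// mulrC.
apply: le_trans (ltW (archi_boundP _)) _; first by rewrite divr_ge0// ltW.
by rewrite -natrX ler_nat; apply: ltnW; apply: ltn_trans (ltnSn _) _; rewrite -/N; exact: ltn_expl.
Qed.

(** Integrate the geometric expansion of 1 / (z - a) against [g] in Cauchy's formula.
    The bound for the remainder contains Cauchy's estimates for the coefficients. *)
Lemma taylor : exists2 K : R, 0 < K & forall g, (forall z, derivable g z (1 : R[i]^o)) ->
  exists c : nat -> C, forall N a (B : R), normc a <= 1 ->
    (forall z, normc z <= 4 -> normc (g z) <= B) ->
    normc (g a - \sum_(n < N) c n * a ^+ n) <= K * B * (normc a / 2) ^+ N.
Proof.
pose w := oint (fun z : C => 1 * cauchy_kernel 0 0 z).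
have w0 : w != 0 by exact: oint_inv_neq0.
have nw0 := normc_gt0 w0.
exists (32 / normc w) => [|g dg]; first by rewrite divr_gt0.
exists (fun n => oint (fun z => g z * cauchy_kernel n 0 z) / w) => N a B a1 gB.
have ia := inside1 a1.
have := cauchy_formula dg ia; rewrite oint_winding// -/w => E.
have -> : g a - \sum_(n < N) oint (fun z => g z * cauchy_kernel n 0 z) / w * a ^+ n =
    w^-1 * (a ^+ N * oint (fun z => g z * cauchy_kernel N a z)).
  have -> : (g a : C) = oint (fun z => g z * cauchy_kernel 0 a z) / w by rewrite E mulfK.
  rewrite (oint_kernel_sum N dg ia) mulrDl mulr_suml.
  rewrite (_ : \sum_(i < N) _ = \sum_(n < N) oint (fun z => g z * cauchy_kernel n 0 z) / w * a ^+ n).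
    by rewrite [X in X - _]addrC addrK mulrC.
  by apply: eq_bigr => i _; rewrite mulrAC.
rewrite !normcM normcV.
rewrite normcX exprMn.
have h := oint_kernel_bound N dg a1 gB.
have -> : 32 / normc w * B * (normc a ^+ N * 2^-1 ^+ N) =
  (normc w)^-1 * (normc a ^+ N * (32 * B * 2^-1 ^+ N)) by ring.
by rewrite ler_wpM2l ?invr_ge0 ?normc_ge0// ler_wpM2l ?exprn_ge0 ?normc_ge0.
Qed.
End taylor.

(** * Solid hulls of compact sets *)

Section solid.
Context {R : realType} (w : lorentz_weight R).
Local Notation C := R[i].
Local Notation X := (lorentz_predual w).
Local Notation N := (@lorentz_norm R w).
Implicit Types (x y : X) (t : nat -> C).

Lemma nbhs_lpP x (A : set X) :
  nbhs x A <-> exists2 e : R, 0 < e & forall y, N (x - y) < e -> A y.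
Proof.
split=> [/nbhs_ballP[r /= /gt0_real[e1 e0 ->] H]|[e e0 H]].
  by exists e1 => // y xy; apply: H; rewrite -ball_normE /ball_ /= -[ltLHS]/((N (x - y))%:C) ltcR.
apply/nbhs_ballP; exists e%:C => /=; first by rewrite ltcR.
by move=> y; rewrite -ball_normE /ball_ /= -[ltLHS]/((N (x - y))%:C) ltcR; exact: H.
Qed.

Lemma lpD x y i : (x + y) i = x i + y i. Proof. by []. Qed.
Lemma lpN x i : (- x) i = - x i. Proof. by []. Qed.
Lemma lpB x y i : (x - y) i = x i - y i. Proof. by []. Qed.
Lemma lpZ (c : C) x i : (c *: x) i = c * x i. Proof. by []. Qed.

Lemma lp_eqP x y : (forall i, x i = y i) -> x = y.
Proof. by move=> xy; apply/val_inj/funext. Qed.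

Lemma NB x y : N (x - y) <= N x + N y.
Proof.
rewrite -scaleN1r; apply: le_trans (lnormD (lp_set x) (lp_set (-1 *: y))) _.
by rewrite (lnormZ _ (lp_set y)) normcN normc1 mul1r.
Qed.

Lemma ND x y : N (x + y) <= N x + N y.
Proof. exact: lnormD (lp_set x) (lp_set y). Qed.

Lemma NZ (c : C) x : N (c *: x) = normc c * N x.
Proof. exact: lnormZ (lp_set x). Qed.

Lemma N_sum (I : Type) (s : seq I) (F : I -> X) : N (\sum_(i <- s) F i) <= \sum_(i <- s) N (F i).
Proof.
elim: s => [|i s IH]; last by rewrite !big_cons; apply: le_trans (ND _ _) _; rewrite lerD2l.
by rewrite !big_nil -(scale0r (0 : X)) NZ normc0 mul0r.
Qed.

(** Coordinates outside the closed unit disc are replaced by 0, so that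
    multiplication by any sequence is a total operation on the space. *)
Definition clip (c : C) : C := if normc c <= 1 then c else 0.

Lemma clip_le1 c : normc (clip c) <= 1.
Proof. by rewrite /clip; case: ifP => //; rewrite normc0. Qed.

Lemma clipE c : normc c <= 1 -> clip c = c.
Proof. by rewrite /clip => ->. Qed.

Lemma damp_subproof t x : (fun i => clip (t i) * x i : R[i]^o) \in lorentz_pred w.
Proof.
have [x0 lx] := lp_set x.
have le i : normc (clip (t i) * x i) <= normc (x i).
  by rewrite normcM ler_piMl ?normc_ge0// clip_le1.
rewrite inE; split.
  apply/cvg0_normcP => e e0; move/cvg0_normcP : x0 => /(_ e e0).
  by apply: filterS => i; apply: le_lt_trans.
apply: cvgr0_le lx => m; rewrite lratio_ge0 /= ler_wpM2r ?invr_ge0 ?(ltW (lsum_gt0 _ _))//.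
have [M xM] := cvg0_bounded x0.
by apply: (rsum_mono _ xM) => i; rewrite normc_ge0/=.
Qed.

Definition damp t x : X := LorentzPredual (damp_subproof t x).

Arguments damp : simpl never.

Lemma dampE t x i : damp t x i = clip (t i) * x i. Proof. by []. Qed.

(** The basis is 1-unconditional. *)
Lemma N_mono x y : (forall i, normc (x i) <= normc (y i)) -> N x <= N y.
Proof.
move=> xy; apply: lnorm_le => m; apply: le_trans (lratio_le m (lp_set y)).
rewrite ler_wpM2r ?invr_ge0 ?(ltW (lsum_gt0 _ _))//.
have [M yM] := cvg0_bounded (lp_set y).1.
by apply: (rsum_mono _ yM) => i; rewrite normc_ge0/=.
Qed.

Lemma N_damp t x : N (damp t x) <= N x.
Proof.
by apply: N_mono => i; rewrite dampE normcM ler_piMl ?normc_ge0// clip_le1.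
Qed.

Lemma dampB t x y : damp t (x - y) = damp t x - damp t y.
Proof. by apply: lp_eqP => i; rewrite lpB !dampE lpB mulrBr. Qed.

Lemma dampZ t (c : C) x : damp t (c *: x) = c *: damp t x.
Proof. by apply: lp_eqP => i; rewrite lpZ !dampE lpZ mulrCA. Qed.

Definition trunc m x : X := damp (fun i => (i < m)%:R) x.

Arguments trunc : simpl never.

Lemma truncE m x i : trunc m x i = if (i < m)%N then x i else 0.
Proof.
rewrite dampE clipE ?normc_bool; first by case: ifP; rewrite ?mul1r ?mul0r.
by case: (i < m)%N.
Qed.

Lemma trunc_sum m x : trunc m x = \sum_(0 <= n < m) x n *: lorentz_unit w n.
Proof.
apply: lp_eqP => i; rewrite truncE; symmetry.
exact: (lp_partial_sumE w x m i).
Qed.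

Lemma trunc_cvg x (e : R) : 0 < e -> \forall m \near \oo, N (x - trunc m x) < e.
Proof.
move=> e0; have /cvgrPdist_lt := @lp_unit_cvg R w x.
have ec0 : (0 : C) < e%:C by rewrite ltcR.
move=> /(_ _ ec0); apply: filterS => m; rewrite trunc_sum.
by rewrite -[ltLHS]/((N (x - \sum_(0 <= n < m) x n *: lorentz_unit w n))%:C) ltcR.
Qed.

Lemma compact_disc (r : R) : compact [set z : R[i]^o | normc z <= r].
Proof.
pose q (uv : R * R) : R[i]^o := Complex uv.1 uv.2.
have cq : continuous q.
  move=> [u v]; apply/cvgrPdist_lt => _ /gt0_real[e1 e0 ->].
  have e20 : 0 < e1 / 2 by rewrite divr_gt0.
  exists (ball u (e1 / 2), ball v (e1 / 2)); first by split; exact: nbhsx_ballx.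
  move=> p [] /=; rewrite /ball /= => h1 h2.
  rewrite [X in X < _](_ : _ = (normc (Complex (u - p.1) (v - p.2)))%:C) // ltcR.
  have -> : Complex (u - p.1) (v - p.2) = (u - p.1)%:C + (v - p.2) *i.
    by apply/eqP; rewrite eq_complex /= addr0 add0r !eqxx.
  apply: le_lt_trans (normcD _ _) _.
  by rewrite /= expr0n /= addr0 add0r !sqrtr_sqr (splitr e1) ltrD.
have cK := continuous_compact (continuous_subspaceT cq)
  (compact_setX (@segment_compact R (- r) r) (@segment_compact R (- r) r)).
apply: subclosed_compact cK _; last first.
  move=> [u v] /= zr.
  exists (u, v) => //=; split => /=; rewrite in_itv /= -ler_norml.
    by apply: le_trans zr; rewrite -sqrtr_sqr ler_wsqrtr// lerDl sqr_ge0.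
  by apply: le_trans zr; rewrite -sqrtr_sqr ler_wsqrtr// lerDr sqr_ge0.
rewrite (_ : [set z : R[i]^o | _] = (@normc R : R[i]^o -> R) @^-1` [set s : R | s <= r])//.
apply: closed_comp; last exact: closed_le.
by move=> z _; exact: normc_continuous.
Qed.

Definition solid_hull (K : set X) : set X :=
  [set y | exists t x, [/\ K x, forall i, normc (t i) <= 1 & y = damp t x]].

(** Multiplication by a bounded sequence depends continuously on it for the topology
    of pointwise convergence: finitely many coordinates carry all of [x] but a small
    tail. *)
Lemma damp_dist t t' x m : (forall i, normc (t i) <= 1) -> (forall i, normc (t' i) <= 1) ->
  N (damp t x - damp t' x) <=
  \sum_(0 <= i < m) normc (t i - t' i) * (normc (x i) * N (lorentz_unit w i)) + 2 * N (x - trunc m x).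
Proof.
move=> t1 t'1.
have -> : damp t x - damp t' x = (damp t (trunc m x) - damp t' (trunc m x)) +
    (damp t (x - trunc m x) - damp t' (x - trunc m x)).
  apply: lp_eqP => i; rewrite !dampB !(lpD, lpN); ring.
apply: le_trans (ND _ _) _; apply: lerD; last first.
  apply: le_trans (NB _ _) _; rewrite mulr_natl mulr2n.
  by apply: lerD; [exact: (N_damp t)|exact: (N_damp t')].
have -> : damp t (trunc m x) - damp t' (trunc m x) =
    \sum_(0 <= i < m) (t i - t' i) * x i *: lorentz_unit w i.
  apply: lp_eqP => i.
  have := lp_partial_sumE w (fun i => (t i - t' i) * x i) m i.
  rewrite lpB (dampE t) (dampE t') !truncE !clipE// /series /= => ->.
  by case: ifP => _; rewrite ?mulr0 ?subr0// mulrBl.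
apply: le_trans (N_sum _ _) _; apply: ler_sum => i _.
by rewrite NZ normcM mulrA.
Qed.

(** The hull is the image of the product of [K] with a countable power of the closed
    unit disc, compact by Tychonoff's theorem, under the multiplication. *)
Lemma compact_solid_hull K : compact K -> compact (solid_hull K).
Proof.
move=> cK.
pose T := prod_topology (fun _ : nat => R[i]^o).
pose D : set T := [set t | forall i, normc (t i) <= 1].
have cD : compact D.
  have h := @tychonoff nat (fun _ => R[i]^o) (fun _ => [set z : R[i]^o | normc z <= 1])
    (fun _ => @compact_disc 1).
  exact h.
have -> : solid_hull K = (fun p : T * X => damp p.1 p.2) @` (D `*` K).
  apply/seteqP; split=> [y [t [x [Kx t1 ->]]]|_ [[t x] [/= t1 Kx] <-]].
    by exists (t, x).
  by exists t, x.
apply: continuous_compact; last exact: compact_setX.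
apply/subspace_continuousP => -[t0 x0] [/= Dt0 Kx0] A /nbhs_lpP[e e0 eA].
have e40 : 0 < e / 4 by rewrite divr_gt0.
have [m mP] : exists m, N (x0 - trunc m x0) < e / 4.
  by have [m _ mP] := trunc_cvg x0 e40; exists m; exact: mP (leqnn m).
pose S := \sum_(0 <= i < m) normc (x0 i) * N (lorentz_unit w i).
have S0 : 0 <= S.
  by apply: sumr_ge0 => i _; rewrite mulr_ge0 ?normc_ge0// lnorm_ge0//; exact: lp_set.
pose d := e / 4 / (S + 1).
have d0 : 0 < d by rewrite divr_gt0// ltr_wpDl.
have near_t : \forall t \near t0, forall i : 'I_m, normc ((t0 : T) i - (t : T) i) < d.
  have FF : Filter (nbhs (t0 : T)) := @nbhs_filter T t0.
  apply: (@filter_forall T 'I_m _ (nbhs (t0 : T)) FF) => i.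
  have cp := @proj_continuous nat (fun _ => R[i]^o) i t0.
  have dc0 : (0 : C) < d%:C by rewrite ltcR.
  have /cvgrPdist_lt/(_ _ dc0) cpB := cp.
  apply: (@filterS T (nbhs (t0 : T)) FF _ _ _ cpB) => t.
  by rewrite /= normc_lt.
have near_x : \forall x \near x0, N (x0 - x) < e / 4.
  by apply/nbhs_lpP; exists (e / 4).
rewrite /fmap /= /within /=.
exists ([set t | forall i : 'I_m, normc ((t0 : T) i - (t : T) i) < d], [set x | N (x0 - x) < e / 4]) => //=.
move=> [t x] [/= ht hx] [/= Dt Kx]; apply: eA.
have -> : damp t0 x0 - damp t x = (damp t0 x0 - damp t x0) + damp t (x0 - x).
  by rewrite dampB addrA subrK.
apply: le_lt_trans (ND _ _) _.
have h1 := damp_dist x0 m Dt0 Dt.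
have h2 : \sum_(0 <= i < m) normc (t0 i - t i) * (normc (x0 i) * N (lorentz_unit w i)) <= d * S.
  rewrite mulr_sumr [leLHS]big_mkord [leRHS]big_mkord; apply: ler_sum => i _.
  by apply: ler_wpM2r; [rewrite mulr_ge0 ?normc_ge0// lnorm_ge0//; exact: lp_set|exact/ltW/ht].
have h3 : d * S <= e / 4.
  by rewrite /d mulrAC ler_pdivrMr ?ltr_wpDl// ler_pM2l// lerDl.
have h4 := N_damp t (x0 - x).
by clear -h1 h2 h3 h4 hx mP; lra.
Qed.

End solid.

(** * Homogeneous parts of entire functions *)

Section is_taylor.
Context {R : realType}.
Local Notation C := R[i].
Implicit Types (g : C -> C) (c : nat -> C) (a : C).

(** The coefficients are pinned down by the behaviour at 0 alone, so that existence,
    uniqueness and algebraic operations do not involve the size of a disc. *)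
Definition is_taylor g c := forall N : nat, exists2 p : R * R, 0 < p.2 &
  forall a, normc a <= p.2 -> normc (g a - \sum_(n < N) c n * a ^+ n) <= p.1 * normc a ^+ N.

Lemma is_taylorD g1 c1 g2 c2 k : is_taylor g1 c1 -> is_taylor g2 c2 ->
  is_taylor (fun a => g1 a + k * g2 a) (fun n => c1 n + k * c2 n).
Proof.
move=> H1 H2 N; have [[M1 d1] /= d10 P1] := H1 N; have [[M2 d2] /= d20 P2] := H2 N.
exists (M1 + normc k * M2, Num.min d1 d2); first by rewrite lt_min d10.
move=> a /=; rewrite le_min => /andP[a1 a2].
have -> : g1 a + k * g2 a - \sum_(n < N) (c1 n + k * c2 n) * a ^+ n =
  (g1 a - \sum_(n < N) c1 n * a ^+ n) + k * (g2 a - \sum_(n < N) c2 n * a ^+ n).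
  rewrite mulrBr mulr_sumr addrACA -opprD; congr (_ - _).
  by rewrite -big_split; apply: eq_bigr => n _ /=; rewrite mulrDl mulrA.
apply: le_trans (normcD _ _) _; rewrite mulrDl normcM -mulrA.
by apply: lerD; [exact: P1|apply: ler_wpM2l; [exact: normc_ge0|exact: P2]].
Qed.

Lemma is_taylor0 : is_taylor (fun=> 0) (fun=> 0).
Proof.
move=> N; exists (0, 1) => //= a _; rewrite big1 ?subrr ?normc0 ?mul0r// => n _.
by rewrite mul0r.
Qed.

Lemma is_taylor_scale g c k : is_taylor g c ->
  is_taylor (fun a => g (a * k)) (fun n => c n * k ^+ n).
Proof.
move=> H N; have [[M d] /= d0 P] := H N.
have k1 : 0 < normc k + 1 by rewrite ltr_wpDl ?normc_ge0.
exists (M * normc k ^+ N, d / (normc k + 1)); first by rewrite divr_gt0.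
move=> a /=; rewrite ler_pdivlMr// => ad.
have /P : normc (a * k) <= d.
  by rewrite normcM; apply: le_trans ad; rewrite ler_wpM2l ?normc_ge0// lerDl.
rewrite normcM exprMn mulrAC mulrA; apply: le_trans; rewrite le_eqVlt; apply/orP; left; apply/eqP.
congr (normc (_ - _)); apply: eq_bigr => n _; rewrite exprMn; ring.
Qed.

Lemma is_taylor_monomial (v : C) d : is_taylor (fun a => v * a ^+ d) (fun n => v *+ (n == d)).
Proof.
move=> N; exists (normc v, 1) => //= a a1.
have [dN|Nd] := ltnP d N.
  rewrite (bigD1 (Ordinal dN))//= eqxx mulr1n big1 ?addr0 ?subrr ?normc0 ?mulr_ge0 ?exprn_ge0 ?normc_ge0//.
  move=> i id; rewrite (_ : (i == d :> nat) = false) ?mulr0n ?mul0r//.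
  by apply: contraNF id => /eqP id; apply/eqP/val_inj.
rewrite big1 ?subr0 => [|i _]; last first.
  by rewrite ltn_eqF ?mulr0n ?mul0r// (leq_trans _ Nd).
rewrite normcM normcX ler_wpM2l ?normc_ge0// -(subnK Nd) exprD.
by rewrite ler_piMl ?exprn_ge0 ?normc_ge0// exprn_ile1 ?normc_ge0.
Qed.

Lemma is_taylor_small g c n (M d : R) : is_taylor g c -> 0 < d ->
  (forall a, normc a <= d -> normc (g a) <= M * normc a ^+ n.+1) ->
  forall k, (k <= n)%N -> c k = 0.
Proof.
move=> H d0 gM; elim/ltn_ind => k IH kn.
have [[M' d'] /= d'0 P] := H k.+1.
apply: eq0_normc; apply/eqP; rewrite eq_le normc_ge0 andbT.
apply/ler_addgt0Pl => e e0; rewrite addr0.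
pose B := `|M| + `|M'| + 1; have B0 : 0 < B by rewrite ltr_wpDl// addr_ge0.
pose r := Num.min (Num.min d d') (Num.min 1 (e / B)).
have r0 : 0 < r by rewrite !lt_min d0 d'0 ltr01 divr_gt0.
have : r <= r by []; rewrite {2}/r !le_min => /andP[/andP[rd rd'] /andP[r1 re]].
have nr : normc (r%:C) = r by rewrite /= expr0n addr0 sqrtr_sqr gtr0_norm.
have h1 := gM r%:C; have h2 := P r%:C; rewrite nr in h1 h2.
have {}h1 := h1 rd; have {}h2 := h2 rd'.
have S : \sum_(n0 < k.+1) c n0 * r%:C ^+ n0 = c k * r%:C ^+ k.
  rewrite big_ord_recr /= big1 ?add0r// => i _.
  by rewrite IH ?mul0r// (leq_trans _ kn)// ltnW.
rewrite S in h2.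
have h3 : normc (c k * r%:C ^+ k) <= (M * r ^+ n.+1) + M' * r ^+ k.+1.
  have -> : c k * r%:C ^+ k = g r%:C - (g r%:C - c k * r%:C ^+ k) by ring.
  apply: le_trans (normcD _ _) _; rewrite normcN; exact: lerD.
rewrite normcM normcX nr in h3.
have rk0 : 0 < r ^+ k by rewrite exprn_gt0.
rewrite -(ler_pM2r rk0); apply: le_trans h3 _.
have h4 : M * r ^+ n.+1 <= `|M| * r * r ^+ k.
  apply: (@le_trans _ _ (`|M| * r ^+ n.+1)); first by rewrite ler_wpM2r ?exprn_ge0 ?(ltW r0)// ler_norm.
  rewrite -mulrA ler_wpM2l// -exprS -(subnK kn) -addnS exprD.
  by rewrite ler_piMl ?exprn_ge0 ?(ltW r0)// exprn_ile1 ?(ltW r0).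
have h5 : M' * r ^+ k.+1 <= `|M'| * r * r ^+ k.
  by rewrite exprS mulrA ler_wpM2r ?(ltW rk0)// ler_wpM2r ?(ltW r0)// ler_norm.
apply: le_trans (lerD h4 h5) _; rewrite -mulrDl ler_wpM2r ?(ltW rk0)// -mulrDl.
apply: (@le_trans _ _ (B * r)); first by rewrite ler_wpM2r ?(ltW r0)// lerDl.
by rewrite mulrC -ler_pdivlMr.
Qed.

Lemma is_taylor_unique g c c' : is_taylor g c -> is_taylor g c' -> c = c'.
Proof.
move=> H H'; apply/funext => n.
have D := is_taylorD (-1) H H'.
have := @is_taylor_small _ _ n 0 1 D ltr01 _ n (leqnn n).
move=> /(_ _)/wrap[].
  by move=> a _; rewrite mulN1r subrr normc0 mul0r.
by rewrite mulN1r => /eqP; rewrite subr_eq0 => /eqP.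
Qed.

(** 0 is a default value for functions without a Taylor expansion. *)
Definition taylor_coef g : nat -> C := xget (fun=> 0) [set c | is_taylor g c].

Lemma taylor_coefE g c : is_taylor g c -> taylor_coef g = c.
Proof.
move=> H; rewrite /taylor_coef; case: xgetP => [c' _ H'|]; last by move=> /(_ c).
exact: is_taylor_unique H' H.
Qed.

Lemma taylor_coefP : exists2 K : R, 0 < K &
  forall g : R[i]^o -> R[i]^o, (forall z, derivable g z (1 : R[i]^o)) ->
  is_taylor g (taylor_coef g) /\
  forall N a (B : R), normc a <= 1 -> (forall z, normc z <= 4 -> normc (g z) <= B) ->
    normc (g a - \sum_(n < N) taylor_coef g n * a ^+ n) <= K * B * (normc a / 2) ^+ N.
Proof.
have [K K0 HK] := @taylor R; exists K => // g dg; have [c cP] := HK g dg.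
suff tc : is_taylor g c by rewrite (taylor_coefE tc).
have cg : continuous g.
  by move=> z; apply: differentiable_continuous; apply/derivable1_diffP; exact: dg.
have [B B0 BP] : exists2 B, 0 <= B & forall z, normc z <= 4 -> normc (g z) <= B.
  have cn : continuous (fun z : R[i]^o => normc (g z)).
    by move=> z; apply: (@continuous_comp (R[i]^o) (R[i]^o) R g (@normc R)); [exact: cg|exact: normc_continuous].
  have d0 : [set z : R[i]^o | normc z <= 4] !=set0 by exists 0; rewrite /= expr0n /= addr0 sqrtr0.
  have [p p4 pP] := compact_EVT_max d0 (@compact_disc R 4) (continuous_subspaceT cn).
  by exists (normc (g p)) => [|z z4]; [exact: normc_ge0|apply: pP; rewrite inE].
move=> N; exists (K * B * 2^-1 ^+ N, 1) => //= a a1.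
by apply: le_trans (cP N a B a1 BP) _; rewrite exprMn [normc a ^+ N * _]mulrC mulrA.
Qed.

End is_taylor.

Section homogeneous_part.
Context {R : realType} (X : normedModType R[i]).
Local Notation C := R[i].
Implicit Types (f g : entire X) (x y : X) (n : nat).

Lemma line_derivable f x y (z : R[i]^o) :
  derivable (fun a : R[i]^o => f (x + a *: y) : R[i]^o) z (1 : R[i]^o).
Proof.
apply: diff_derivable.
have df : differentiable f (x + z *: y) by exact: (asboolP _ (entireP f)).
apply: (@differentiable_comp R[i] (R[i]^o) X (R[i]^o) (fun a : R[i]^o => x + a *: y) f) => //.
Qed.

Lemma ray_derivable f x (z : R[i]^o) :
  derivable (fun a : R[i]^o => f (a *: x) : R[i]^o) z (1 : R[i]^o).
Proof.
have := @line_derivable f 0 x z.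
rewrite (_ : (fun a : R[i]^o => f (0 + a *: x) : R[i]^o) = (fun a => f (a *: x)))//.
by apply/funext => a; rewrite add0r.
Qed.

Definition hpart n f x : C := taylor_coef (fun a => f (a *: x)) n.

Lemma hpart_taylor f x : is_taylor (fun a => f (a *: x)) (fun n => hpart n f x).
Proof. by have [K _ /(_ _ (@ray_derivable f x))[]] := @taylor_coefP R. Qed.

Lemma hpartE f x c : is_taylor (fun a => f (a *: x)) c -> forall n, hpart n f x = c n.
Proof. by move=> H n; rewrite /hpart (taylor_coefE H). Qed.

Lemma hpart_add k f g x n : hpart n (f + k *: g) x = hpart n f x + k * hpart n g x.
Proof.
exact: (@hpartE (f + k *: g) x _ (is_taylorD k (hpart_taylor f x) (hpart_taylor g x))).
Qed.

Lemma hpart_homog (l : C) f x n : hpart n f (l *: x) = hpart n f x * l ^+ n.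
Proof.
rewrite (@hpartE f (l *: x) (fun n => hpart n f x * l ^+ n))//.
have := is_taylor_scale l (hpart_taylor f x).
rewrite (_ : (fun a => f ((a * l) *: x)) = (fun a => f (a *: (l *: x))))//.
by apply/funext => a; rewrite scalerA.
Qed.

Lemma hpart_bounds : exists2 K : R, 0 < K & forall f x (B : R),
  (forall z : C, normc z <= 4 -> normc (f (z *: x)) <= B) ->
  (forall N, normc (f x - \sum_(n < N) hpart n f x) <= K * B * 2^-1 ^+ N) /\
  (forall n, normc (hpart n f x) <= K * B * 2^-1 ^+ n).
Proof.
have [K K0 HK] := @taylor_coefP R; exists (2 * K) => [|f x B fB]; first by rewrite mulr_gt0.
have B0 : 0 <= B by apply: le_trans (normc_ge0 _) (fB 0 _); rewrite normc0.
have [_ h] := HK _ (@ray_derivable f x).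
have H N : normc (f x - \sum_(n < N) hpart n f x) <= K * B * 2^-1 ^+ N.
  have n1 : normc (1 : C) <= 1 by rewrite normc1.
  have := h N 1 B n1 fB; rewrite normc1 mul1r scale1r.
  rewrite (_ : \sum_(n < N) _ = \sum_(n < N) hpart n f x)//.
  by apply: eq_bigr => n _; rewrite expr1n mulr1.
have p0 N : 0 <= K * B * 2^-1 ^+ N by rewrite !mulr_ge0 ?(ltW K0)// exprn_ge0.
split=> n.
  by apply: le_trans (H n) _; have := p0 n; lra.
have -> : hpart n f x = (f x - \sum_(i < n) hpart i f x) - (f x - \sum_(i < n.+1) hpart i f x).
  by rewrite big_ord_recr /=; ring.
apply: le_trans (normcD _ _) _; rewrite normcN.
apply: le_trans (lerD (H n) (H n.+1)) _.
rewrite exprS; have := p0 n; set u := 2^-1 ^+ n => hu; lra.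
Qed.

(** By interpolation, [p] is a polynomial of degree at most [n] along every complex line
    if and only if its values there satisfy the linear relations between values of
    such polynomials. This form is preserved by translations and averages, and allows
    extraction of coefficients at roots of unity. *)
Definition line_poly n (p : X -> C) := forall x y m (l u : 'I_m -> C),
  (forall k, (k <= n)%N -> \sum_i u i * l i ^+ k = 0) ->
  \sum_i u i * p (x + l i *: y) = 0.

Lemma is_taylor_sum m (u : 'I_m -> C) (g : 'I_m -> C -> C) (c : 'I_m -> nat -> C) :
  (forall i, is_taylor (g i) (c i)) ->
  is_taylor (fun a => \sum_i u i * g i a) (fun n => \sum_i u i * c i n).
Proof.
move=> H.
have E (s : seq 'I_m) : is_taylor (fun a => \sum_(i <- s) u i * g i a) (fun n => \sum_(i <- s) u i * c i n).
  elim: s => [|i s IH].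
    have := @is_taylor0 R.
    by congr is_taylor; apply/funext => a; rewrite big_nil.
  have := is_taylorD (u i) IH (H i).
  by congr is_taylor; apply/funext => a; rewrite big_cons addrC.
exact: E.
Qed.

(** Expand f (a x + t y) in powers of t and put t = a l_i. Terms of degree at most [n] in
    t disappear from the combination with weights u_i, so the combination of the
    f (a (x + l_i y)) is of order a^(n+1), and its n-th coefficient is 0. *)
Lemma hpart_line_poly n f : line_poly n (hpart n f).
Proof.
move=> x y m l u Hu.
(* For |a| <= 1 / L all the parameters a l_i stay in the unit disc. *)
pose L := 1 + \sum_i normc (l i).
have L1 : 1 <= L by rewrite lerDl sumr_ge0// => i _; exact: normc_ge0.
have L0 : 0 < L by apply: lt_le_trans L1.
have lL i : normc (l i) <= L.
  rewrite /L (bigD1 i)//= addrCA lerDl addr_ge0// sumr_ge0// => j _; exact: normc_ge0.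
have [K K0 HK] := @taylor_coefP R.
have [B [B0 BP]] : exists B, 0 <= B /\ forall a z : C, normc a <= 1 -> normc z <= 4 ->
    normc (f (a *: x + z *: y)) <= B.
  pose q (p : R[i]^o * R[i]^o) : X := p.1 *: x + p.2 *: y.
  have cq : continuous q.
    move=> p; apply: cvgD; apply: cvgZl; [exact: cvg_fst|exact: cvg_snd].
  have cK := continuous_compact (continuous_subspaceT cq)
    (compact_setX (@compact_disc R 1) (@compact_disc R 4)).
  have [B [B0 BP]] := entire_bounded f cK.
  by exists B; split=> // a z a1 z4; apply: BP; exists (a, z).
have T := is_taylor_sum u (fun i => hpart_taylor f (x + l i *: y)).
apply: (is_taylor_small T (d := L^-1) (n := n)
  (M := \sum_i normc (u i) * (K * B * L ^+ n.+1))); rewrite ?invr_gt0//.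
move=> a aL.
have La : normc a * L <= 1 by rewrite -ler_pdivlMr// div1r.
have a1 : normc a <= 1.
  by apply: le_trans La; rewrite ler_peMr ?normc_ge0.
pose h := taylor_coef (fun t => f (a *: x + t *: y)).
have [_ hP] := HK _ (@line_derivable f (a *: x) y).
have -> : \sum_i u i * f (a *: (x + l i *: y)) =
   \sum_i u i * (f (a *: x + (a * l i) *: y) - \sum_(k < n.+1) h k * (a * l i) ^+ k).
  have E0 : \sum_i u i * (\sum_(k < n.+1) h k * (a * l i) ^+ k) = 0.
    under eq_bigr do rewrite mulr_sumr.
    rewrite exchange_big big1 // => k _.
    transitivity (h k * a ^+ k * \sum_i u i * l i ^+ k).
      by rewrite mulr_sumr; apply: eq_bigr => i _; rewrite exprMn; ring.
    by rewrite Hu ?mulr0// -ltnS.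
  under [RHS]eq_bigr do rewrite mulrBr.
  rewrite sumrB E0 subr0; apply: eq_bigr => i _.
  by rewrite scalerDr scalerA.
rewrite mulr_suml.
apply: le_trans (normc_sum _ _) _; apply: ler_sum => i _; rewrite normcM -[leRHS]mulrA.
apply: ler_wpM2l; first exact: normc_ge0.
have al1 : normc (a * l i) <= 1.
  rewrite normcM; apply: le_trans La; apply: ler_wpM2l; [exact: normc_ge0|exact: lL].
have := hP n.+1 (a * l i) B al1 (fun z => BP a z a1).
move=> /le_trans; apply; rewrite -[leRHS]mulrA ler_wpM2l ?mulr_ge0 ?(ltW K0)//.
rewrite -exprMn; apply: lerXn2r; rewrite ?nnegrE ?mulr_ge0 ?normc_ge0 ?(ltW L0)//.
rewrite normcM mulrC [L * _]mulrC.
apply: (@le_trans _ _ (normc a * normc (l i))).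
  rewrite mulrC ler_piMr ?mulr_ge0 ?normc_ge0//; lra.
by rewrite ler_wpM2l ?normc_ge0.
Qed.

End homogeneous_part.

(** * Multi-indices and the square order *)

Section multiindices.
Implicit Types (alpha beta : multiindex) (i j k m n : nat).

Definition below m alpha := forall i, (m <= i)%N -> alpha i = 0%N.

Lemma mlen_below alpha : below (mlen alpha) alpha.
Proof.
move=> i; apply: contraTeq => ai; rewrite -ltnNge.
have : i \in finsupp alpha by rewrite mem_finsupp.
by move=> /(@leq_bigmax_seq _ _ xpredT (fun j => j.+1)) /(_ isT).
Qed.

Lemma below_le m m' alpha : (m <= m')%N -> below m alpha -> below m' alpha.
Proof. by move=> mm ba i /(leq_trans mm); exact: ba. Qed.

Lemma mlen_le m alpha : below m alpha -> (mlen alpha <= m)%N.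
Proof.
move=> ba; rewrite /mlen; apply/bigmax_leqP_seq => i ia _.
by rewrite ltnNge; apply/negP => /ba a0; move: ia; rewrite mem_finsupp a0.
Qed.

Lemma mlen_top alpha m : mlen alpha = m.+1 -> alpha m != 0%N.
Proof.
move=> am; apply/negP => /eqP a0.
suff : (mlen alpha <= m)%N by rewrite am ltnn.
apply: mlen_le => i; rewrite leq_eqVlt => /orP[/eqP <- //|].
by rewrite -am; exact: mlen_below.
Qed.

Lemma big_finsupp (T : Type) (idx : T) (op : Monoid.com_law idx) (F : nat -> nat -> T) m alpha :
  (forall i, F i 0%N = idx) -> below m alpha ->
  \big[op/idx]_(j <- finsupp alpha) F j (alpha j) = \big[op/idx]_(j < m) F j (alpha j).
Proof.
move=> F0 ba; rewrite -(big_mkord xpredT (fun j => F j (alpha j))).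
rewrite [RHS](bigID (mem (finsupp alpha))) /= [X in op _ X]big1 ?Monoid.mulm1; last first.
  by move=> i; rewrite mem_finsupp negbK => /eqP ->.
rewrite -[RHS]big_filter; apply: perm_big; apply: uniq_perm.
- exact: fset_uniq.
- by rewrite filter_uniq// iota_uniq.
- move=> i; rewrite mem_filter mem_index_iota /=; apply/idP/andP => [ia|[]//].
  split=> //; rewrite ltnNge; apply/negP => /ba a0.
  by move: ia; rewrite mem_finsupp a0.
Qed.

Lemma mdegree_below m alpha : below m alpha -> mdegree alpha = (\sum_(j < m) alpha j)%N.
Proof. exact: (@big_finsupp nat 0%N addn (fun i k => k) m alpha (fun=> erefl)). Qed.

Lemma multiindex_eq m alpha beta : below m alpha -> below m beta ->
  (forall i, (i < m)%N -> alpha i = beta i) -> alpha = beta.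
Proof.
move=> ba bb ab; apply/fsfunP => i.
by have [/ab //|mi] := ltnP i m; rewrite ba ?bb.
Qed.

Fixpoint cube n m : seq multiindex :=
  if m is m'.+1 then [seq [fsfun alpha with m' |-> k] | k <- iota 0 n.+1, alpha <- cube n m']
  else [:: [fsfun]].

Lemma cubeP n m alpha :
  reflect (below m alpha /\ forall i, (alpha i <= n)%N) (alpha \in cube n m).
Proof.
apply: (iffP idP); elim: m alpha => [|m IH] alpha.
- by rewrite inE => /eqP ->; split=> [i _|i]; rewrite fsfunE.
- move=> /allpairsP[[k b] /= [kn /IH[bb bn] ->]]; split=> i.
    move=> mi; rewrite fsfun_withE gtn_eqF//; apply: bb; exact: ltnW.
  rewrite fsfun_withE; by case: eqP => // _; move: kn; rewrite -[0%N :: _]/(iota 0 n.+1) mem_iota.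
- move=> [ba _]; rewrite inE; apply/eqP/fsfunP => i; rewrite fsfunE; exact: ba.
- move=> [ba an]; apply/allpairsP; exists (alpha m, [fsfun alpha with m |-> 0%N]); split.
  + by rewrite mem_iota /= add0n ltnS an.
  + apply: IH; split=> i; rewrite fsfun_withE; last by case: eqP.
    by move=> mi; case: eqVneq => // im; apply: ba; rewrite ltn_neqAle eq_sym im.
  + by apply/fsfunP => i; rewrite !fsfun_withE; case: eqP => // ->.
Qed.

Lemma cube_uniq n m : uniq (cube n m).
Proof.
elim: m => // m IH; apply: allpairs_uniq => //; first exact: iota_uniq.
move=> [k a] [k' a'] /allpairsP[[k1 a1] [_ /cubeP[b1 _] [-> ->]]].
move=> /allpairsP[[k2 a2] [_ /cubeP[b2 _] [-> ->]]] /= E.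
have Ei i := congr1 (fun f : multiindex => f i) E.
congr (_, _); first by have := Ei m; rewrite /= !fsfun_withE eqxx.
apply: (multiindex_eq b1 b2) => i im.
by have := Ei i; rewrite /= !fsfun_withE ltn_eqF.
Qed.

(** The square order in recursive form. It compares entries at the largest index where
    two multi-indices differ: the comparison of lengths is a special case. *)
Fixpoint colex_le m alpha beta : bool :=
  if m is j.+1 then (alpha j < beta j)%N || (alpha j == beta j) && colex_le j alpha beta
  else true.

(** If alpha were longer than beta, its last nonzero entry would be at an index m where
    beta vanishes. The two agree beyond j, so m is at most j, and beta vanishes at j
    too, although its entry there is larger than that of alpha. *)
Lemma square_lt_of_top alpha beta j : (alpha j < beta j)%N ->
  (forall i, (j < i)%N -> alpha i = beta i) -> square_lt alpha beta.
Proof.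
move=> ab eqab.
have : (mlen alpha <= mlen beta)%N.
  rewrite leqNgt; apply/negP => lt.
  case E : (mlen alpha) lt => [//|m]; rewrite ltnS => bm.
  have am := mlen_top E; have b0 := mlen_below bm.
  have [jm|mj] := ltnP j m; first by rewrite (eqab _ jm) b0 in am.
  have bj : beta j = 0%N by apply: mlen_below; exact: leq_trans mj.
  by rewrite bj in ab.
rewrite leq_eqVlt => /orP[/eqP E|]; last by left.
by right; split=> //; exists j.
Qed.

Lemma colex_leP m alpha beta : colex_le m alpha beta ->
  (forall i, (i < m)%N -> alpha i = beta i) \/
  exists2 j, (j < m)%N & (alpha j < beta j)%N /\ forall i, (j < i < m)%N -> alpha i = beta i.
Proof.
elim: m => [_|m IH] /=; first by left.
move=> /orP[ab|/andP[/eqP abm /IH[E|[j jm [ab E]]]]].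
- right; exists m => //; split=> // i /andP[mi]; rewrite ltnS => im.
  by move: (leq_trans mi im); rewrite ltnn.
- by left=> i; rewrite ltnS leq_eqVlt => /orP[/eqP ->//|]; exact: E.
- right; exists j; first exact: ltnW.
  split=> // i /andP[ji]; rewrite ltnS leq_eqVlt => /orP[/eqP ->//|im].
  by apply: E; rewrite ji.
Qed.

Lemma colex_leN m alpha beta : ~~ colex_le m alpha beta ->
  exists2 j, (j < m)%N & (beta j < alpha j)%N /\ forall i, (j < i < m)%N -> beta i = alpha i.
Proof.
elim: m => [//|m IH] /=; rewrite negb_or -leqNgt leq_eqVlt => /andP[/orP[/eqP ab|ba] H].
  rewrite ab eqxx /= in H; have [j jm [ba E]] := IH H.
  exists j; first exact: ltnW.
  split=> // i /andP[ji]; rewrite ltnS leq_eqVlt => /orP[/eqP ->//|im].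
  by apply: E; rewrite ji.
exists m => //; split=> // i /andP[mi]; rewrite ltnS => im.
by move: (leq_trans mi im); rewrite ltnn.
Qed.

Lemma colex_square m alpha beta : below m alpha -> below m beta ->
  if colex_le m alpha beta then alpha = beta \/ square_lt alpha beta
  else square_lt beta alpha.
Proof.
move=> ba bb; have ext (a b : multiindex) j : below m a -> below m b ->
    (forall i, (j < i < m)%N -> a i = b i) -> forall i, (j < i)%N -> a i = b i.
  move=> Ba Bb H i ji; have [im|mi] := ltnP i m; first by apply: H; rewrite ji.
  by rewrite Ba ?Bb.
case: ifPn => [/colex_leP[E|[j jm [ab E]]]|/colex_leN[j jm [ab E]]].
- by left; exact: multiindex_eq E.
- by right; apply: square_lt_of_top ab _; exact: ext E.
- by apply: square_lt_of_top ab _; exact: ext E.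
Qed.

End multiindices.

(** The recursive comparison decides on which side of [e j] a multi-index of the same
    degree is enumerated, because the order is total. *)
Lemma compatible_segment (e : nat -> multiindex) m i j : injective e -> compatible e ->
  mdegree (e i) = mdegree (e j) -> below m (e i) -> below m (e j) ->
  colex_le m (e i) (e j) = (i <= j)%N.
Proof.
move=> einj ecomp dij bi bj; have := colex_square bi bj; case: ifP => _.
  move=> [/einj -> |]; first by rewrite leqnn.
  by move=> /(ecomp _ _ dij)/ltnW ->.
by move=> /(ecomp _ _ (esym dij)) ji; rewrite leqNgt ji.
Qed.

(** This makes an initial segment visible after truncation to finitely many
    coordinates. *)
Lemma compatible_below (e : nat -> multiindex) i j : injective e -> compatible e ->
  mdegree (e i) = mdegree (e j) -> (i <= j)%N -> below (mlen (e j)) (e i).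
Proof.
move=> einj ecomp dij; rewrite leq_eqVlt => /orP[/eqP ->|ij]; first exact: mlen_below.
apply: below_le (@mlen_below (e i)).
by have [/ltnW//|[->]] := (ecomp _ _ dij).1 ij.
Qed.

(** * Extraction of monomials by roots of unity *)

Section roots_of_unity.
Context {R : realType}.
Local Notation C := R[i].

Lemma prim_root_exists n : exists z : C, n.+1.-primitive_root z.
Proof.
pose p : {poly C} := 'X^(n.+1) - 1; have [r Dp] := closed_field_poly_normal p.
rewrite (monicP _) ?monicXnsubC // scale1r in Dp.
have rn1: all n.+1.-unity_root r by apply/allP=> z; rewrite -root_prod_XsubC -Dp.
have sz_r: (n.+1 < (size r).+1)%N.
  by rewrite -(size_prod_XsubC r id) -Dp size_XnsubC.
have [|z] := hasP (cyclic.has_prim_root (ltn0Sn n) rn1 _ sz_r); last by exists z.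
by rewrite -separable.separable_prod_XsubC -Dp cyclotomic.separable_Xn_sub_1 // pnatr_eq0.
Qed.

Definition zeta n : C := xchoose (prim_root_exists n).

Lemma zetaP n : n.+1.-primitive_root (zeta n).
Proof. exact: xchooseP. Qed.

Lemma zeta_norm n k : normc (zeta n ^+ k) = 1.
Proof.
have z1 : normc (zeta n) = 1.
  apply/eqP; rewrite -(@pexpr_eq1 _ _ n.+1) ?normc_ge0// -normcX.
  by rewrite (prim_expr_order (zetaP n)) normc1.
by rewrite normcX z1 expr1n.
Qed.

Lemma zeta_neq0 n : zeta n != 0.
Proof.
by apply/eqP => z0; have := zeta_norm n 1; rewrite expr1 z0 normc0 => /eqP; rewrite eq_sym oner_eq0.
Qed.

(** A geometric sum of roots of unity: this is where n + 1 points are enough to separate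
    degrees up to [n]. *)
Lemma zeta_orthogonal n a k : (a <= n)%N -> (k <= n)%N ->
  n.+1%:R^-1 * \sum_(t < n.+1) (zeta n)^-1 ^+ (t * k) * (zeta n ^+ t) ^+ a = (a == k)%:R.
Proof.
move=> an kn; set z := zeta n; have z0 : z != 0 := zeta_neq0 n.
have n0 : (n.+1%:R : C) != 0 by rewrite pnatr_eq0.
pose q := z ^+ a / z ^+ k.
have -> : \sum_(t < n.+1) z^-1 ^+ (t * k) * (z ^+ t) ^+ a = \sum_(t < n.+1) q ^+ t.
  apply: eq_bigr => t _; rewrite /q expr_div_n -!exprM exprVn mulrC; congr (_ / _).
    by rewrite mulnC.
  by rewrite mulnC.
have [E|ak] := eqVneq a k.
  have -> : q = 1 by rewrite /q E divff// expf_neq0.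
  under eq_bigr do rewrite expr1n.
  by rewrite sumr_const card_ord mulVf.
have q1 : q != 1.
  rewrite /q; apply: contraNneq ak => /(canRL (divfK (expf_neq0 k z0))).
  rewrite mul1r => /eqP; rewrite (eq_prim_root_expr (zetaP n)).
  by rewrite !modn_small ?ltnS// => /eqP ->.
have := subrX1 q n.+1.
have -> : q ^+ n.+1 = 1.
  rewrite /q expr_div_n -!exprM [(a * _)%N]mulnC [(k * _)%N]mulnC !exprM.
  by rewrite (prim_expr_order (zetaP n)) !expr1n divr1.
rewrite subrr => /esym/eqP; rewrite mulf_eq0 subr_eq0 (negbTE q1) /= => /eqP ->.
by rewrite mulr0.
Qed.

Lemma zeta_average n (g : nat -> C) (B : R) k : (forall t, normc (g t) <= B) ->
  normc (n.+1%:R^-1 * \sum_(t < n.+1) (zeta n)^-1 ^+ (t * k) * g t) <= B.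
Proof.
move=> gB; have n0 : (0 : R) < n.+1%:R by rewrite ltr0n.
rewrite normcM normcV normc_nat mulrC ler_pdivrMr// mulr_natr.
apply: le_trans (normc_sum _ _) _.
apply: (@le_trans _ _ (\sum_(t < n.+1) B)); last by rewrite sumr_const card_ord.
apply: ler_sum => t _; rewrite normcM exprVn normcV zeta_norm invr1 mul1r.
exact: gB.
Qed.

End roots_of_unity.

Section monomials.
Context {R : realType} (w : lorentz_weight R).
Local Notation C := R[i].
Local Notation X := (lorentz_predual w).
Implicit Types (x y : X) (alpha beta : multiindex) (i j k m n : nat) (p q : X -> C).

Lemma monomialE m alpha x : below m alpha -> monomial w alpha x = \prod_(j < m) x j ^+ alpha j.
Proof.
exact: (@big_finsupp C 1 *%R (fun j k => x j ^+ k) m alpha (fun=> erefl)).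
Qed.

Lemma monomialZ alpha (c : C) x : monomial w alpha (c *: x) = monomial w alpha x * c ^+ mdegree alpha.
Proof.
have ba := @mlen_below alpha; rewrite !(monomialE _ ba) (mdegree_below ba).
rewrite -prodrXr -big_split; apply: eq_bigr => j _ /=.
by transitivity ((c * x j) ^+ alpha j) => //; rewrite exprMn mulrC.
Qed.

Definition rot j (c : C) x : X := damp (fun i => if i == j then c else 1) x.

Arguments rot : simpl never.

Lemma rotE j c x i : normc c = 1 -> rot j c x i = (if i == j then c else 1) * x i.
Proof. by move=> c1; rewrite dampE clipE//; case: eqP; rewrite ?c1 ?normc1. Qed.

Lemma monomial_rot j c alpha x : normc c = 1 ->
  monomial w alpha (rot j c x) = c ^+ alpha j * monomial w alpha x.
Proof.
move=> c1; have ba : below (maxn (mlen alpha) j.+1) alpha.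
  by apply: below_le (@mlen_below alpha); exact: leq_maxl.
rewrite !(monomialE _ ba).
have jm : (j < maxn (mlen alpha) j.+1)%N by exact: leq_maxr.
under eq_bigr do rewrite rotE//.
rewrite (bigD1 (Ordinal jm))// [in RHS](bigD1 (Ordinal jm))//= eqxx exprMn mulrA.
congr (_ * _); apply: eq_bigr => i ij.
by rewrite ifN ?mul1r//; apply: contraNneq ij => ij; apply/eqP/val_inj.
Qed.

(** The part of [p] which is of degree [k] in the variable [j], for [p] of degree
    at most [n]: a discrete Cauchy integral. *)
Definition extract n j k p x : C :=
  n.+1%:R^-1 * \sum_(t < n.+1) (zeta n)^-1 ^+ (t * k) * p (rot j (zeta n ^+ t) x).

Definition poly_fun (s : seq multiindex) (c : multiindex -> C) x : C :=
  \sum_(alpha <- s) c alpha * monomial w alpha x.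

Lemma extract_poly n j k s c : (k <= n)%N -> (forall alpha, alpha \in s -> (alpha j <= n)%N) ->
  extract n j k (poly_fun s c) = poly_fun s (fun alpha => (alpha j == k)%:R * c alpha).
Proof.
move=> kn sn; apply/funext => x; rewrite /extract /poly_fun.
under eq_bigr do rewrite mulr_sumr.
rewrite exchange_big mulr_sumr big_seq [RHS]big_seq; apply: eq_bigr => alpha /sn an.
rewrite -(zeta_orthogonal an kn) -!mulrA; congr (_ * _).
rewrite mulr_suml; apply: eq_bigr => t _.
rewrite monomial_rot ?zeta_norm//. by rewrite -!mulrA; congr (_ * _); exact: mulrCA.
Qed.

Definition rot_invariant (S : set X) := forall j c x, normc c = 1 -> S x -> S (rot j c x).

Lemma extract_bound n j k p (S : set X) (B : R) : rot_invariant S ->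
  (forall x, S x -> normc (p x) <= B) -> forall x, S x -> normc (extract n j k p x) <= B.
Proof.
move=> rS pB x Sx; apply: (@zeta_average R n (fun t => p (rot j (zeta n ^+ t) x)) B k) => t.
by apply: pB; apply: rS => //; exact: zeta_norm.
Qed.

Lemma extract_trunc n j k p m x :
  extract n j k (p \o trunc m) x = extract n j k p (trunc m x).
Proof.
rewrite /extract; congr (_ * _); apply: eq_bigr => t _; congr (_ * p _).
apply: lp_eqP => i; rewrite truncE !rotE ?zeta_norm// truncE.
by case: ifP => _; rewrite ?mulr0.
Qed.

Lemma extract_homog n j k p d : (forall (l : C) x, p (l *: x) = p x * l ^+ d) ->
  forall (l : C) x, extract n j k p (l *: x) = extract n j k p x * l ^+ d.
Proof.
move=> ph l x; rewrite /extract -mulrA mulr_suml; congr (_ * _); apply: eq_bigr => t _.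
by rewrite /rot dampZ ph mulrA.
Qed.

Lemma extract_add n j k p q (c : C) x :
  extract n j k (fun x => p x + c * q x) x = extract n j k p x + c * extract n j k q x.
Proof.
rewrite /extract mulrCA -mulrDr; congr (_ * _).
by rewrite mulr_sumr -big_split; apply: eq_bigr => t _ /=; ring.
Qed.

Fixpoint extracts n beta m p : X -> C :=
  if m is m'.+1 then extract n m' (beta m') (extracts n beta m' p) else p.

Lemma extracts_poly n beta m s c : (forall i, beta i <= n)%N ->
  (forall alpha i, alpha \in s -> (alpha i <= n)%N) ->
  extracts n beta m (poly_fun s c) =
  poly_fun s (fun alpha => [forall i : 'I_m, alpha i == beta i]%:R * c alpha).
Proof.
move=> bn sn; elim: m => [|m IH] /=.
  congr poly_fun; apply/funext => alpha.
  by rewrite (_ : [forall i : 'I_0, _] = true) ?mul1r//; apply/forallP => -[].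
rewrite IH extract_poly//; last by move=> alpha; exact: sn.
congr poly_fun; apply/funext => alpha; rewrite mulrA -natrM mulnb; congr (_%:R * _).
congr nat_of_bool; apply/andP/forallP => [[am /forallP H] i|H].
  have := ltn_ord i; rewrite ltnS leq_eqVlt => /orP[/eqP ->//|im].
  exact: (H (Ordinal im)).
split; first exact: (H ord_max).
by apply/forallP => i; exact: (H (widen_ord (leqnSn m) i)).
Qed.

Lemma extracts_bound n beta m p (S : set X) (B : R) : rot_invariant S ->
  (forall x, S x -> normc (p x) <= B) -> forall x, S x -> normc (extracts n beta m p x) <= B.
Proof. by move=> rS pB; elim: m => //= m IH; exact: extract_bound. Qed.

Lemma extracts_trunc n beta m p m' x :
  extracts n beta m (p \o trunc m') x = extracts n beta m p (trunc m' x).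
Proof.
elim: m x => //= m IH x; rewrite -extract_trunc; congr extract.
exact/funext.
Qed.

Lemma extracts_homog n beta m p d : (forall (l : C) x, p (l *: x) = p x * l ^+ d) ->
  forall (l : C) x, extracts n beta m p (l *: x) = extracts n beta m p x * l ^+ d.
Proof. by move=> ph; elim: m => //= m IH; exact: extract_homog. Qed.

Lemma extracts_add n beta m p q (c : C) x :
  extracts n beta m (fun x => p x + c * q x) x = extracts n beta m p x + c * extracts n beta m q x.
Proof.
elim: m x => //= m IH x; rewrite -extract_add; congr extract; exact/funext.
Qed.

(** The relation between the point [l] and the roots of unity, with the weights of
    Lagrange interpolation. *)
Lemma line_poly_expand n p x y (l : C) : line_poly n p ->
  p (x + l *: y) = \sum_(k < n.+1) l ^+ k *
    (n.+1%:R^-1 * \sum_(t < n.+1) (zeta n)^-1 ^+ (t * k) * p (x + (zeta n ^+ t) *: y)).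
Proof.
move=> lp; set z := zeta n.
pose ll (i : 'I_n.+2) : C := if unlift ord0 i is Some t then z ^+ (t : 'I_n.+1) else l.
pose u (i : 'I_n.+2) : C := if unlift ord0 i is Some t then
  - (\sum_(k < n.+1) l ^+ k * (n.+1%:R^-1 * z^-1 ^+ ((t : 'I_n.+1) * k))) else 1.
have := lp x y _ ll u; rewrite big_ord_recl /u /ll unlift_none mul1r => H.
have {H} : p (x + l *: y) +
  \sum_(t < n.+1) (- (\sum_(k < n.+1) l ^+ k * (n.+1%:R^-1 * z^-1 ^+ (t * k)))) * p (x + (z ^+ t) *: y) = 0.
  rewrite -[RHS]H => [|k kn].
    by congr (_ + _); apply: eq_bigr => t _; rewrite liftK.
  rewrite big_ord_recl unlift_none mul1r.
  under eq_bigr do rewrite liftK mulNr.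
  rewrite sumrN; apply/eqP; rewrite subr_eq0; apply/eqP.
  under eq_bigr do rewrite mulr_suml.
  rewrite exchange_big /= (bigD1 (Ordinal (kn : (k < n.+1)%N)))//= [X in _ + X]big1 ?addr0 => [|k' k'k].
    have := @zeta_orthogonal R n k k kn kn; rewrite eqxx => E.
    rewrite -[LHS]mulr1 -[X in _ * X = _]/(true%:R) -E mulr_sumr mulr_sumr; apply: eq_bigr => t _; rewrite /z; ring.
  have k'n : (k' <= n)%N by rewrite -ltnS.
  have := @zeta_orthogonal R n k k' kn k'n.
  rewrite (_ : (k == k') = false); last first.
    by apply/negbTE; apply: contraNneq k'k => kk; apply/eqP/val_inj.
  move=> E; rewrite -[RHS](mulr0 (l ^+ k')) -[X in l ^+ k' * X]E mulr_sumr mulr_sumr.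
  by apply: eq_bigr => t _; rewrite /z; ring.
under eq_bigr do rewrite mulNr.
rewrite sumrN => /eqP; rewrite subr_eq0 => /eqP ->.
under eq_bigr do rewrite mulr_suml.
rewrite exchange_big; apply: eq_bigr => k _ /=.
by rewrite !mulr_sumr; apply: eq_bigr => t _; ring.
Qed.

(** One coordinate at a time: the coefficients of [p] along the direction of the last
    one are averages of translates of [p], hence again polynomial along lines. *)
Lemma poly_fun_trunc n m p : line_poly n p ->
  exists c, p \o trunc m = poly_fun (cube n m) c.
Proof.
elim: m p => [|m IH] p lp.
  exists (fun=> p 0); apply/funext => x.
  rewrite /poly_fun /cube big_seq1 (@monomialE 0); last by move=> i _; rewrite fsfunE.
  rewrite big_ord0 mulr1 /=; congr p.
  by apply: lp_eqP => i; rewrite truncE ltn0.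
pose q k x : C := n.+1%:R^-1 *
  \sum_(t < n.+1) (zeta n)^-1 ^+ (t * k) * p (x + (zeta n ^+ t) *: lorentz_unit w m).
have lq k : line_poly n (q k).
  move=> x y M l u H.
  have -> : \sum_(i < M) u i * q k (x + l i *: y) = n.+1%:R^-1 *
      \sum_(t < n.+1) (zeta n)^-1 ^+ (t * k) *
        \sum_(i < M) u i * p ((x + (zeta n ^+ t) *: lorentz_unit w m) + l i *: y).
    rewrite /q; under eq_bigr do rewrite mulrCA mulr_sumr.
    rewrite -mulr_sumr exchange_big; congr (_ * _); apply: eq_bigr => t _ /=.
    rewrite mulr_sumr; apply: eq_bigr => i _; rewrite mulrCA; congr (_ * (_ * p _)).
    by rewrite addrAC.
  by rewrite big1 ?mulr0// => t _; rewrite lp// mulr0.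
have [c cP] := choice (fun k => IH (q k) (lq k)).
exists (fun alpha => c (alpha m) [fsfun alpha with m |-> 0%N]).
apply/funext => x; rewrite -[LHS]/(p (trunc m.+1 x)).
have -> : trunc m.+1 x = trunc m x + x m *: lorentz_unit w m.
  apply: lp_eqP => i; rewrite lpD lpZ !truncE ltnS leq_eqVlt.
  rewrite -[lorentz_unit w m i]/((i == m)%:R : C).
  by case: eqVneq => [->|_]; rewrite ?ltnn ?add0r ?mulr1//= mulr0 addr0.
rewrite (line_poly_expand _ _ _ lp) /poly_fun.
rewrite -[cube n m.+1]/[seq [fsfun alpha with m |-> k] | k <- iota 0 n.+1, alpha <- cube n m].
rewrite big_allpairs_dep.
rewrite -[iota 0 n.+1]/(index_iota 0 n.+1) big_mkord; apply: eq_bigr => k _.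
have := congr1 (fun g : X -> C => g x) (cP k) => /= E.
rewrite -/(q k (trunc m x)) [LHS]mulrC E /poly_fun mulr_suml big_seq [RHS]big_seq.
apply: eq_bigr => alpha /cubeP[ba _].
have -> : [fsfun [fsfun alpha with m |-> (k : nat)] with m |-> 0%N] = alpha.
  by apply/fsfunP => i; rewrite !fsfun_withE; case: eqVneq => // ->; rewrite ba.
rewrite fsfun_withE eqxx -mulrA; congr (_ * _).
rewrite -[RHS]/(monomial w [fsfun alpha with m |-> (k : nat)] x).
rewrite (monomialE _ ba) (@monomialE m.+1) => [|i mi]; last first.
  by rewrite fsfun_withE gtn_eqF// ba// ltnW.
rewrite big_ord_recr /= fsfun_withE eqxx; congr (_ * _).
by apply: eq_bigr => i _; rewrite fsfun_withE ltn_eqF.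
Qed.

End monomials.

(** * Taylor coefficients and multipliers *)

Section coefficients.
Context {R : realType} (w : lorentz_weight R).
Local Notation C := R[i].
Local Notation X := (lorentz_predual w).
Implicit Types (x y : X) (alpha beta : multiindex) (i j k m n : nat) (p q : X -> C) (f g : entire X).

Definition ones m : X := \sum_(0 <= j < m) (1 : C) *: lorentz_unit w j.

Lemma onesE m i : ones m i = (i < m)%:R.
Proof.
have := lp_partial_sumE w (fun=> 1) m i; rewrite /series /= => E.
by rewrite [LHS]E; case: ifP.
Qed.

Lemma monomial_ones alpha m : below m alpha -> monomial w alpha (ones m) = 1.
Proof.
by move=> ba; rewrite (monomialE _ ba) big1// => j _; rewrite onesE ltn_ord expr1n.
Qed.

Lemma monomial_ones0 alpha m i : (m <= i)%N -> alpha i != 0%N -> monomial w alpha (ones m) = 0.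
Proof.
move=> mi ai; have iM : (i < mlen alpha)%N.
  by rewrite ltnNge; apply/negP => /mlen_below E; rewrite E in ai.
rewrite (monomialE _ (@mlen_below alpha)) (bigD1 (Ordinal iM))//=.
by rewrite onesE ltnNge mi expr0n (negbTE ai) mul0r.
Qed.

Lemma mdegree_ge alpha i : (alpha i <= mdegree alpha)%N.
Proof.
have [iM|Mi] := ltnP i (mlen alpha); last by rewrite mlen_below.
rewrite (mdegree_below (@mlen_below alpha)) (bigD1 (Ordinal iM))//=; exact: leq_addr.
Qed.

Lemma poly_fun_ext s (c c' : multiindex -> C) : (forall alpha, alpha \in s -> c alpha = c' alpha) ->
  poly_fun (w := w) s c = poly_fun s c'.
Proof. by move=> cc; apply/funext => x; apply: eq_big_seq => alpha /cc ->. Qed.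

(** Fixing the first entries of alpha leaves the multi-indices extending beta; at
    [ones (mlen beta)] only the monomial of beta itself survives. *)
Lemma extracts_cube n m beta (c : multiindex -> C) : beta \in cube n m ->
  extracts n beta (mlen beta) (poly_fun (cube n m) c) (ones (mlen beta)) = c beta.
Proof.
move=> bc; have /cubeP[bb bn] := bc.
rewrite extracts_poly//; last by move=> alpha i /cubeP[_ ->].
rewrite /poly_fun (bigD1_seq beta bc (cube_uniq n m))/= big_seq_cond big1 => [|alpha].
  rewrite addr0 -[monomial_fun beta _]/(monomial w beta (ones (mlen beta))).
  rewrite (monomial_ones (@mlen_below beta)) mulr1.
  by rewrite (_ : [forall _, _] = true) ?mul1r//; apply/forallP.
move=> /andP[/cubeP[ba _] ab].
case: forallP => [H|_]; last by rewrite !mul0r.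
rewrite mul1r -[monomial_fun alpha _]/(monomial w alpha (ones (mlen beta))).
have [/forallP E|] := boolP [forall i : 'I_m, (mlen beta <= i)%N ==> (alpha i == 0%N)].
  case/eqP : ab; apply: (multiindex_eq ba bb) => i im.
  have [ib|bi] := ltnP i (mlen beta); first exact/eqP/(H (Ordinal ib)).
  by have := E (Ordinal im); rewrite /= bi /= => /eqP ->; rewrite mlen_below.
by case/forallPn => i; rewrite negb_imply => /andP[bi ai]; rewrite (monomial_ones0 bi ai) mulr0.
Qed.

(** The Taylor coefficient of index [alpha]: the part of the right multidegree is
    evaluated where the monomial is 1. *)
Definition coef alpha f : C :=
  extracts (mdegree alpha) alpha (mlen alpha) (hpart (mdegree alpha) f) (ones (mlen alpha)).

Definition hcoef n f alpha : C := if mdegree alpha == n then coef alpha f else 0.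

(** The coefficients produced by the expansion for [m] coordinates do not depend on
    [m], as [coef] recovers them; those of another degree vanish by homogeneity. *)
Lemma hpart_poly n m f : hpart n f \o trunc m = poly_fun (cube n m) (hcoef n f).
Proof.
have [c cP] := poly_fun_trunc m (@hpart_line_poly R X n f).
rewrite cP; apply: poly_fun_ext => alpha ac; have /cubeP[ba an] := ac.
rewrite /hcoef; case: eqP => [dn|/eqP dn].
  rewrite /coef dn.
  have -> : ones (mlen alpha) = trunc m (ones (mlen alpha)).
    apply: lp_eqP => i; rewrite truncE; case: ltnP => // mi.
    by rewrite onesE ltnNge (leq_trans (mlen_le ba) mi).
  by rewrite -extracts_trunc cP extracts_cube.
pose q := extracts n alpha m (hpart n f \o trunc m).
have qh (l : C) x : q (l *: x) = q x * l ^+ n.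
  by apply: extracts_homog => {l x} l x; rewrite /= /trunc dampZ hpart_homog.
have qE x : q x = c alpha * monomial w alpha x.
  rewrite /q cP extracts_poly//; last by move=> beta i /cubeP[_ ->].
  rewrite /poly_fun (bigD1_seq alpha ac (cube_uniq n m))/= big_seq_cond big1 ?addr0.
    by rewrite (_ : [forall _, _] = true) ?mul1r//; apply/forallP.
  move=> beta /andP[/cubeP[bb _] ab]; case: forallP => [H|_]; last by rewrite !mul0r.
  by case/eqP: ab; apply: (multiindex_eq bb ba) => i im; exact/eqP/(H (Ordinal im)).
(* Doubling the argument multiplies one monomial by 2^|alpha| and by 2^n at once. *)
have := qh 2 (ones m); rewrite !qE monomialZ (monomial_ones ba) mul1r mulr1 => /eqP.
rewrite -subr_eq0 -mulrBr mulf_eq0 => /orP[/eqP //|].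
rewrite subr_eq0 -!natrX eqr_nat eqn_exp2l// => /eqP E.
by rewrite E eqxx in dn.
Qed.

Lemma coef_add alpha f g (k : C) : coef alpha (f + k *: g) = coef alpha f + k * coef alpha g.
Proof.
rewrite /coef -extracts_add; congr extracts; apply/funext => x; exact: hpart_add.
Qed.

Lemma hpart_monomial n alpha x : hpart n (monomial w alpha) x = monomial w alpha x *+ (n == mdegree alpha).
Proof.
apply: (@hpartE R X (monomial w alpha) x (fun n => monomial w alpha x *+ (n == mdegree alpha))).
have := is_taylor_monomial (monomial w alpha x) (mdegree alpha).
by congr is_taylor; apply/funext => a; rewrite monomialZ.
Qed.

Lemma coef_monomial alpha beta : coef beta (monomial w alpha) = (alpha == beta)%:R.
Proof.
have -> : coef beta (monomial w alpha) = extracts (mdegree beta) beta (mlen beta)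
    (poly_fun (if mdegree beta == mdegree alpha then [:: alpha] else [::]) (fun=> 1)) (ones (mlen beta)).
  rewrite /coef; congr extracts; apply/funext => x; rewrite hpart_monomial /poly_fun.
  by case: eqP; rewrite ?big_seq1 ?mul1r// big_nil.
rewrite extracts_poly => [|i|a i]; first last.
- by case: eqP => // ->; rewrite inE => /eqP ->; exact: mdegree_ge.
- exact: mdegree_ge.
case: eqP => [dE|nd]; rewrite /poly_fun; last first.
  by rewrite big_nil; case: eqP => // ab; case: nd; rewrite ab.
rewrite big_seq1 mulr1; case: eqP => [->|ab].
  rewrite (monomial_ones (@mlen_below beta)) mulr1.
  by rewrite (_ : [forall _, _] = true)//; apply/forallP.
case: forallP => [H|_]; last by rewrite mul0r.
rewrite mul1r.
have [E|] := boolP [forall i : 'I_(mlen alpha), (mlen beta <= i)%N ==> (alpha i == 0%N)].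
  case: ab; apply/fsfunP => i; have [ib|bi] := ltnP i (mlen beta); first exact/eqP/(H (Ordinal ib)).
  rewrite [RHS]mlen_below//; have [ia|ai] := ltnP i (mlen alpha); last by rewrite mlen_below.
  by move/forallP: E => /(_ (Ordinal ia)); rewrite /= bi /= => /eqP.
by case/forallPn => i; rewrite negb_imply => /andP[bi ai]; rewrite (monomial_ones0 bi ai).
Qed.

Lemma coef_bound : exists2 K : R, 0 < K & forall alpha f (S : set X) (B : R),
  rot_invariant S -> S (ones (mlen alpha)) ->
  (forall (z : C) x, normc z <= 4 -> S x -> normc (f (z *: x)) <= B) ->
  normc (coef alpha f) <= K * B.
Proof.
have [K K0 KP] := @hpart_bounds R X; exists K => // alpha f S B rS S1 fB.
have B0 : 0 <= B.
  by apply: le_trans (normc_ge0 _) (fB 0 _ _ S1); rewrite normc0.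
apply: (@extracts_bound R w _ _ _ _ S (K * B) rS) => // x Sx.
have [_ h] := KP f x B (fun z z4 => fB z x z4 Sx).
apply: le_trans (h (mdegree alpha)) _; rewrite ler_piMr ?mulr_ge0 ?(ltW K0)//.
by rewrite exprn_ile1// invf_le1// ler1n.
Qed.

End coefficients.

Section multipliers.
Context {R : realType} (w : lorentz_weight R).
Local Notation C := R[i].
Local Notation X := (lorentz_predual w).
Context (n : nat) (s : seq multiindex) (S : set X).
Context (sn : forall alpha i, alpha \in s -> (alpha i <= n)%N).
Context (rS : rot_invariant S).
Implicit Types (chi : multiindex -> C) (A B : R) (beta : multiindex).

Definition multiplier chi A := forall c B,
  (forall x, S x -> normc (poly_fun s c x) <= B) ->
  forall x, S x -> normc (poly_fun s (fun alpha => chi alpha * c alpha) x) <= A * B.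

Lemma multiplier_eq j k : (k <= n)%N -> multiplier (fun alpha => (alpha j == k)%:R) 1.
Proof.
move=> kn c B cB x Sx; rewrite mul1r.
rewrite -(@extract_poly _ _ n)//; last by move=> alpha; exact: sn.
exact: extract_bound cB x Sx.
Qed.

Lemma multiplierM chi1 A1 chi2 A2 : multiplier chi1 A1 -> multiplier chi2 A2 ->
  multiplier (fun alpha => chi1 alpha * chi2 alpha) (A1 * A2).
Proof.
move=> M1 M2 c B cB x Sx; have := M1 _ _ (M2 c B cB) x Sx; rewrite mulrA.
by congr (normc _ <= _); apply: eq_bigr => alpha _; rewrite mulrA.
Qed.

Lemma multiplierD chi1 A1 chi2 A2 : multiplier chi1 A1 -> multiplier chi2 A2 ->
  multiplier (fun alpha => chi1 alpha + chi2 alpha) (A1 + A2).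
Proof.
move=> M1 M2 c B cB x Sx; rewrite mulrDl.
apply: le_trans (lerD (M1 c B cB x Sx) (M2 c B cB x Sx)).
apply: le_trans (normcD _ _); rewrite le_eqVlt; apply/orP; left; apply/eqP; congr normc.
by rewrite -big_split; apply: eq_bigr => alpha _ /=; rewrite mulrDl mulrDl.
Qed.

Lemma multiplier_lt j k : (k <= n.+1)%N -> multiplier (fun alpha => (alpha j < k)%:R) k%:R.
Proof.
elim: k => [_|k IH kn] c B cB x Sx.
  rewrite mul0r /poly_fun big1 ?normc0// => alpha _; by rewrite ltn0 !mul0r.
have := multiplierD (IH (ltnW kn)) (multiplier_eq j (kn : (k <= n)%N)) cB Sx.
rewrite -natr1; congr (normc _ <= _); apply: eq_bigr => alpha _; congr (_ * _ * _).
by rewrite [(alpha j < k.+1)%N]ltnS; case: (ltngtP (alpha j) k) => _ /=; rewrite ?mulr0n ?addr0 ?add0r.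
Qed.

(** The recursion for the order adds the cost beta_j of the condition alpha_j < beta_j at
    each index, while the conditions alpha_i = beta_i are free. *)
Lemma multiplier_colex m beta : (forall i, beta i <= n)%N ->
  multiplier (fun alpha => (colex_le m alpha beta)%:R) (1 + \sum_(j < m) beta j)%:R.
Proof.
move=> bn; elim: m => [|m IH] c B cB x Sx.
  rewrite big_ord0 addn0 mul1r; have := cB x Sx; congr (normc _ <= _).
  by apply: eq_bigr => alpha _; rewrite mul1r.
have := multiplierD (multiplier_lt m (leqW (bn m))) (multiplierM (multiplier_eq m (bn m)) IH) cB Sx.
rewrite mul1r -natrD big_ord_recr /= [(beta m + _)%N]addnC addnA.
congr (normc _ <= _); apply: eq_bigr => alpha _; congr (_ * _ * _) => /=.
by case: (ltngtP (alpha m) (beta m)) => _ /=; rewrite ?mulr0n ?mul0r ?mul1r ?addr0 ?add0r.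
Qed.

End multipliers.

(** * Partial sums of the monomial expansion *)

Section partial_sums.
Context {R : realType} (w : lorentz_weight R).
Local Notation C := R[i].
Local Notation X := (lorentz_predual w).
Context (e : nat -> multiindex) (e_enum : bijective e) (e_compat : compatible e).
Implicit Types (x y : X) (alpha beta : multiindex) (i j k m n N : nat) (f g : entire X) (S : set X) (B : R).

Definition psum N f x : C := \sum_(i < N) coef (e i) f * monomial w (e i) x.

Definition trunc_invariant S := forall m x, S x -> S (trunc m x).

(** In each degree the partial sum is the image of the homogeneous part under the
    multiplier of an initial segment. *)
Lemma degree_psum_bound n N f S B : rot_invariant S -> trunc_invariant S ->
  (forall x, S x -> normc (hpart n f x) <= B) ->
  forall x, S x ->
  normc (\sum_(i < N | mdegree (e i) == n) coef (e i) f * monomial w (e i) x) <= n.+1%:R * B.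
Proof.
move=> rS tS fB x Sx.
have B0 : 0 <= B by exact: le_trans (normc_ge0 _) (fB x Sx).
have [/existsP[i0 i0n]|] := boolP [exists i : 'I_N, mdegree (e i) == n]; last first.
  rewrite negb_exists => /forallP H; rewrite big_pred0 ?normc0 ?mulr_ge0//.
  by move=> i; apply/negbTE/H.
case: (@arg_maxnP _ i0 (fun i : 'I_N => mdegree (e i) == n) (fun i : 'I_N => (i : nat)) i0n) => j jn jmax.
(* [e j] is the last multi-index of degree [n] before [N]: it determines the segment. *)
set m := mlen (e j); have bj : below m (e j) by exact: mlen_below.
have ebn i : (e j i <= n)%N by rewrite -(eqP jn); exact: mdegree_ge.
have einj : injective e by exact: bij_inj.
have M := @multiplier_colex R w n (cube n m) S (fun alpha i H => (elimT (cubeP n m alpha) H).2 i) rS m (e j) ebn.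
have pB y : S y -> normc (poly_fun (cube n m) (hcoef n f) y) <= B.
  move=> Sy; have := congr1 (fun g : X -> C => g y) (hpart_poly n m f).
  by rewrite [LHS]/= => <-; apply: fB; exact: tS.
have := M _ _ pB x Sx.
rewrite -(mdegree_below bj) (eqP jn) add1n; congr (normc _ <= _).
rewrite /poly_fun.
transitivity (\sum_(alpha <- cube n m | (mdegree alpha == n) && colex_le m alpha (e j))
    coef alpha f * monomial w alpha x).
  rewrite [RHS]big_mkcond; apply: eq_bigr => alpha _; rewrite /hcoef.
  by case: eqP => _ /=; case: colex_le; rewrite ?mul1r ?mul0r ?mulr0 ?mul0r.
rewrite -big_filter -(big_mkord (fun i => mdegree (e i) == n) (fun i => coef (e i) f * monomial w (e i) x)).
rewrite -[RHS]big_filter -(big_map e xpredT (fun alpha => coef alpha f * monomial w alpha x)).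
apply: perm_big; apply: uniq_perm.
- by rewrite filter_uniq// cube_uniq.
- by rewrite map_inj_uniq// filter_uniq// iota_uniq.
have [e' eK e'K] := e_enum.
move=> alpha; apply/idP/mapP.
  rewrite mem_filter => /andP[/andP[an ac] /cubeP[ba _]].
  exists (e' alpha) => //; rewrite mem_filter e'K an mem_index_iota /=.
  have := @compatible_segment e m (e' alpha) j einj e_compat.
  rewrite e'K (eqP an) (eqP jn) ac => /(_ erefl ba bj)/esym h.
  exact: leq_ltn_trans h (ltn_ord j).
case=> i; rewrite mem_filter mem_index_iota /= => /andP[ein iN] ->.
have ij : (i <= j)%N by exact: (jmax (Ordinal iN) ein).
have dij : mdegree (e i) = mdegree (e j) by rewrite (eqP ein) (eqP jn).
have bi : below m (e i) by exact: compatible_below einj e_compat dij ij.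
rewrite mem_filter ein (compatible_segment einj e_compat dij bi bj) ij /=.
by apply/cubeP; split=> // k; rewrite -(eqP ein); exact: mdegree_ge.
Qed.

Lemma sum_geometric_bound D : \sum_(n < D) n.+1%:R * 2^-1 ^+ n <= 4 :> R.
Proof.
have -> : \sum_(n < D) n.+1%:R * 2^-1 ^+ n = 4 - (D%:R + 2) * 2 * 2^-1 ^+ D :> R.
  elim: D => [|D IH]; first by rewrite big_ord0 expr0; ring.
  by rewrite big_ord_recr /= IH exprS -[in RHS]natr1 -natr1; field.
by rewrite lerBlDr lerDl !mulr_ge0 ?exprn_ge0// addr_ge0.
Qed.

(** Equicontinuity of the partial sums: the factors n + 1 of the degrees are absorbed
    by the decay 2^-n of the homogeneous parts. *)
Lemma psum_bound : exists2 K : R, 0 < K & forall N f S B,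
  rot_invariant S -> trunc_invariant S ->
  (forall (z : C) x, normc z <= 4 -> S x -> normc (f (z *: x)) <= B) ->
  forall x, S x -> normc (psum N f x) <= K * B.
Proof.
have [K K0 KP] := @hpart_bounds R X; exists (4 * K) => [|N f S B rS tS fB x Sx].
  by rewrite mulr_gt0.
have B0 : 0 <= B by apply: le_trans (normc_ge0 _) (fB 0 _ _ Sx); rewrite normc0.
pose D := (\max_(i < N) mdegree (e i)).+1.
have -> : psum N f x = \sum_(n < D) \sum_(i < N | mdegree (e i) == n) coef (e i) f * monomial w (e i) x.
  rewrite /psum; under [RHS]eq_bigr do rewrite big_mkcond.
  rewrite exchange_big; apply: eq_bigr => i _ /=.
  have iD : (mdegree (e i) < D)%N by rewrite ltnS; exact: (leq_bigmax i).
  rewrite (bigD1 (Ordinal iD))//= eqxx big1 ?addr0// => n nd.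
  by rewrite ifN//; apply: contraNneq nd => E; apply/eqP/val_inj.
apply: le_trans (normc_sum _ _) _.
apply: (@le_trans _ _ (\sum_(n < D) K * B * (n.+1%:R * 2^-1 ^+ n))).
  apply: ler_sum => n _; rewrite mulrCA.
  apply: degree_psum_bound Sx => // y Sy.
  by have [_] := KP f y B (fun z z4 => fB z y z4 Sy).
rewrite -mulr_sumr -[leRHS]mulrA mulrC ler_wpM2r ?mulr_ge0 ?(ltW K0)//.
exact: sum_geometric_bound.
Qed.

Lemma psum_add N f g (k : C) x : psum N (f + k *: g) x = psum N f x + k * psum N g x.
Proof.
rewrite /psum mulr_sumr -big_split; apply: eq_bigr => i _ /=.
by rewrite coef_add mulrDl mulrA.
Qed.

Definition finite_expansion f := exists N0, forall N x, (N0 <= N)%N -> psum N f x = f x.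

Lemma finite_expansion_monomial alpha : finite_expansion (monomial w alpha).
Proof.
have [e' eK e'K] := e_enum; exists (e' alpha).+1 => N x aN.
rewrite /psum (bigD1 (Ordinal aN))//= e'K coef_monomial eqxx mul1r big1 ?addr0// => i ia.
rewrite coef_monomial; case: eqP => [E|]; last by rewrite mul0r.
by case/eqP : ia; apply: val_inj => /=; rewrite E eK.
Qed.

Lemma finite_expansion_add f g (k : C) : finite_expansion f -> finite_expansion g ->
  finite_expansion (f + k *: g).
Proof.
move=> [N1 H1] [N2 H2]; exists (maxn N1 N2) => N x; rewrite geq_max => /andP[n1 n2].
by rewrite psum_add H1// H2.
Qed.

Lemma finite_expansion0 : finite_expansion 0.
Proof.
have [N0 H] := finite_expansion_add (-1) (@finite_expansion_monomial [fsfun]) (@finite_expansion_monomial [fsfun]).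
by exists N0 => N x /H; rewrite scaleN1r subrr; apply.
Qed.

Lemma finite_expansion_sum (T : Type) (s : seq T) (F : T -> entire X) (c : T -> C) :
  (forall t, finite_expansion (F t)) -> finite_expansion (\sum_(t <- s) c t *: F t).
Proof.
move=> HF; elim: s => [|t s IH]; first by rewrite big_nil; exact: finite_expansion0.
by rewrite big_cons addrC; exact: finite_expansion_add.
Qed.

Lemma entire_sumE (T : Type) (s : seq T) (F : T -> entire X) x :
  (\sum_(t <- s) F t) x = \sum_(t <- s) F t x.
Proof.
elim: s => [|t s IH]; first by rewrite !big_nil.
by rewrite !big_cons -IH.
Qed.

End partial_sums.

(** * Convergence *)

Section convergence.
Context {R : realType} (w : lorentz_weight R).
Local Notation C := R[i].
Local Notation X := (lorentz_predual w).
Local Notation N := (@lorentz_norm R w).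
Implicit Types (x y : X) (f g : entire X) (K S : set X).

Lemma damp_damp t t' x : damp t (damp t' x) = damp (fun i => clip (t i) * clip (t' i)) x :> X.
Proof.
apply: lp_eqP => i; rewrite !dampE mulrA (clipE (c := clip _ * clip _))//.
by rewrite normcM mulr_ile1 ?normc_ge0 ?clip_le1.
Qed.

Lemma damp_hull t K x : solid_hull K x -> solid_hull K (damp t x).
Proof.
move=> [t' [y [Ky t'1 ->]]]; exists (fun i => clip (t i) * clip (t' i)), y; split=> //.
  by move=> i; rewrite normcM mulr_ile1 ?normc_ge0 ?clip_le1.
exact: damp_damp.
Qed.

Lemma hull_rot K : rot_invariant (solid_hull K).
Proof. by move=> j c x _; exact: damp_hull. Qed.

Lemma hull_trunc K : trunc_invariant (solid_hull K).
Proof. by move=> m x; exact: damp_hull. Qed.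

(** The dilations used in Cauchy's estimates keep solid hulls inside one larger solid
    hull, by writing z t = (z / 4) (4 t). *)
Lemma scale_hull K x (z : C) : normc z <= 4 -> solid_hull K x ->
  solid_hull ((fun y : X => (4 : C) *: y) @` K) (z *: x).
Proof.
move=> z4 [t [y [Ky t1 ->]]].
exists (fun i => z / 4 * t i), ((4 : C) *: y); split; first by exists y.
  move=> i; rewrite normcM mulr_ile1 ?normc_ge0//.
  by rewrite normcM normcV normc_nat ler_pdivrMr// mul1r.
apply: lp_eqP => i; rewrite -[LHS]/(z * damp t y i) !dampE -[(_ *: y) i]/(4 * y i).
rewrite [in RHS]clipE; last first.
  rewrite normcM mulr_ile1 ?normc_ge0//.
  by rewrite normcM normcV normc_nat ler_pdivrMr// mul1r.
by rewrite clipE//; field.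
Qed.

Lemma sub_hull K x : K x -> solid_hull K x.
Proof.
move=> Kx; exists (fun=> 1), x; split=> // [i|]; first by rewrite normc1.
by apply: lp_eqP => i; rewrite dampE clipE ?normc1// mul1r.
Qed.

Lemma compact_scale (c : C) K : compact K -> compact ((fun y : X => c *: y) @` K).
Proof.
move=> cK; apply: continuous_compact cK; apply: continuous_subspaceT.
exact: scaler_continuous.
Qed.

(** Truncations converge to the identity pointwise and are contractions; compactness
    makes the convergence of [f] along them uniform. *)
Lemma trunc_unif f K (d : R) : compact K -> 0 < d ->
  exists m, forall x, K x -> normc (f x - f (trunc m x)) < d.
Proof.
move=> /compact_near_coveringP cK d0; have d20 : 0 < d / 2 by rewrite divr_gt0.
have : \forall m \near \oo, K `<=` (fun x => normc (f x - f (trunc m x)) < d).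
  apply: cK => x Kx.
  have /nbhs_lpP[r r0 rP] : nbhs x [set y | normc (f x - f y) < d / 2].
    have /cvgrPdist_lt := @entire_continuous R X f x.
    have dc0 : (0 : C) < (d / 2)%:C by rewrite ltcR.
    by move=> /(_ _ dc0); apply: filterS => y; rewrite normc_lt.
  have r20 : 0 < r / 2 by rewrite divr_gt0.
  exists ([set y | N (x - y) < r / 2], [set m | N (x - trunc m x) < r / 2]).
    by split; [apply/nbhs_lpP; exists (r / 2)|exact: trunc_cvg].
  move=> [y m] [/= xy xm].
  have h1 : normc (f x - f y) < d / 2 by apply: rP; apply: lt_le_trans xy _; lra.
  have h2 : normc (f x - f (trunc m y)) < d / 2.
    apply: rP; have -> : x - trunc m y = (x - trunc m x) + trunc m (x - y).
      by rewrite /trunc dampB addrA subrK.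
    apply: le_lt_trans (ND _ _) _; have := N_damp (fun i => (i < m)%:R) (x - y).
    rewrite -/(trunc m (x - y)); lra.
  have -> : f y - f (trunc m y) = (f x - f (trunc m y)) - (f x - f y) by ring.
  by apply: le_lt_trans (normcD _ _) _; rewrite normcN (splitr d) ltrD.
by move=> [m _ mP]; exists m; exact: mP (leqnn m).
Qed.

(** Truncate the argument to finitely many coordinates, then the Taylor series. *)
Lemma polynomial_dense f K (d : R) : compact K -> 0 < d ->
  exists s (c : nat * multiindex -> C),
    forall x, K x -> normc (f x - \sum_(t <- s) c t * monomial w t.2 x) < d.
Proof.
move=> cK d0; have d20 : 0 < d / 2 by rewrite divr_gt0.
have [m mP] := trunc_unif f cK d20.
have [B [B0 BP]] := entire_bounded f (compact_solid_hull (@compact_scale 4 _ cK)).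
have [A A0 AP] := @hpart_bounds R X.
pose n0 := Num.bound (A * B / (d / 2)).
exists [seq (n, alpha) | n <- iota 0 n0, alpha <- cube n m], (fun t => hcoef t.1 f t.2).
move=> x Kx.
rewrite big_allpairs_dep (_ : iota 0 n0 = index_iota 0 n0); last by rewrite /index_iota subn0.
rewrite big_mkord.
have E n : \sum_(alpha <- cube n m) hcoef n f alpha * monomial w alpha x = hpart n f (trunc m x).
  by rewrite -[RHS]/((hpart n f \o trunc m) x) hpart_poly.
under eq_bigr do rewrite E.
have h1 := mP x Kx.
have [h2 _] := AP f (trunc m x) B (fun z z4 => BP _ (scale_hull z4 (hull_trunc m (sub_hull Kx)))).
have -> : f x - \sum_(i < n0) hpart i f (trunc m x) =
  (f x - f (trunc m x)) + (f (trunc m x) - \sum_(i < n0) hpart i f (trunc m x)) by ring.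
apply: le_lt_trans (normcD _ _) _; rewrite (splitr d); apply: ltr_leD => //.
apply: le_trans (h2 n0) _.
rewrite exprVn ler_pdivrMr ?exprn_gt0// -ler_pdivrMl// mulrC.
apply: le_trans (ltW (archi_boundP _)) _; first by apply: divr_ge0; [apply: mulr_ge0 => //; exact: ltW|exact: ltW].
by rewrite -natrX ler_nat; apply: ltnW; exact: ltn_expl.
Qed.

Lemma psum_cvg (e : nat -> multiindex) f K (d : R) :
  bijective e -> compatible e -> compact K -> 0 < d ->
  exists N0, forall n x, (N0 <= n)%N -> K x -> normc (f x - psum e n f x) < d.
Proof.
move=> be ce cK d0; have [A A0 AP] := @psum_bound R w e be ce.
pose L := solid_hull ((fun y : X => (4 : C) *: y) @` K).
have cL : compact L by exact: compact_solid_hull (@compact_scale 4 _ cK).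
(* Replacing [f] by a polynomial costs this once for [f] and [A] times for the sum. *)
have dA : 0 < d / (1 + A) by rewrite divr_gt0// addr_gt0.
have [s [c H]] := polynomial_dense f cL dA.
pose P : entire X := \sum_(t <- s) c t *: monomial w t.2.
have PE x : P x = \sum_(t <- s) c t * monomial w t.2 x by rewrite /P entire_sumE.
have [N0 N0P] : finite_expansion e P.
  by apply: finite_expansion_sum => // t; exact: finite_expansion_monomial.
exists N0 => n x nN Kx; have Sx := sub_hull Kx.
have fP (z : C) y : normc z <= 4 -> solid_hull K y -> normc ((f + (-1) *: P) (z *: y)) <= d / (1 + A).
  move=> z4 Sy; rewrite -[_ (z *: y)]/(f (z *: y) + (-1) * P (z *: y)) mulN1r PE.
  exact/ltW/H/scale_hull.
have h1 := AP n _ _ _ (hull_rot (K := K)) (hull_trunc (K := K)) fP x Sx.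
rewrite psum_add N0P// mulN1r in h1.
have h2 : normc (f x - P x) < d / (1 + A).
  have n1 : normc (1 : C) <= 4 by rewrite normc1; lra.
  by rewrite PE; apply: H; rewrite -[x]scale1r; exact: scale_hull.
have -> : f x - psum e n f x = (f x - P x) - (psum e n f x - P x) by ring.
apply: le_lt_trans (normcD _ _) _; rewrite normcN.
have -> : d = d / (1 + A) + A * (d / (1 + A)).
  by field; rewrite gt_eqF// addr_gt0.
exact: ltr_leD.
Qed.

Lemma coef_continuous alpha : continuous (fun f : entire X => coef alpha f : R[i]^o).
Proof.
move=> f; have [A A0 AP] := @coef_bound R w.
pose L : set X := solid_hull [set ones w (mlen alpha)].
pose L4 := solid_hull ((fun y : X => (4 : C) *: y) @` [set ones w (mlen alpha)]).
have cL4 : compact L4 by apply: compact_solid_hull; apply: compact_scale; exact: compact_set1.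
apply/(@cvgrPdist_lt _ _ _ (nbhs f) (nbhs_filter f)) => _ /gt0_real[e1 e0 ->].
apply/nbhs_tau0P; exists L4, (e1 / (2 * A)); split=> //.
  by rewrite divr_gt0// mulr_gt0.
move=> g gf; rewrite /= normc_lt.
have -> : coef alpha f - coef alpha g = coef alpha (f + (-1) *: g).
  by rewrite coef_add mulN1r.
apply: (@le_lt_trans _ _ (A * (e1 / (2 * A)))).
  apply: (AP alpha _ L) => [||z y z4 Ly]; first exact: hull_rot.
    exact: sub_hull.
  rewrite -[_ (z *: y)]/(f (z *: y) + (-1) * g (z *: y)) mulN1r.
  exact/ltW/gf/scale_hull.
have -> : A * (e1 / (2 * A)) = e1 / 2 by field; rewrite gt_eqF.
by rewrite ltr_pdivrMr// ltr_pMr// ltr1n.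
Qed.

End convergence.

Theorem corollary6p8 (R : realType) (w : lorentz_weight R)
    (e : nat -> multiindex) (e_enum : bijective e) (e_compat : compatible e) :
  schauder_basis (fun n => monomial w (e n)).
Proof.
exists (fun n f => coef (e n) f); split.
- by move=> n; exact: coef_continuous.
- move=> f A /nbhs_tau0P[K [d [cK d0 KA]]].
  have [N0 NP] := psum_cvg f e_enum e_compat cK d0.
  exists N0 => // n /= nN; apply: KA => x Kx.
  rewrite /series /= big_mkord entire_sumE.
  exact: NP.
- move=> f a fa n.
  have cn : (fun N => coef (e n) (series (fun n => a n *: monomial w (e n)) N) : R[i]^o) @ \oo
      --> (coef (e n) f : R[i]^o).
    apply: (@cvg_comp _ _ _ (series (fun n => a n *: monomial w (e n)))
      (fun f => coef (e n) f : R[i]^o) _ _ _ fa).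
    exact: coef_continuous.
  have coefS (s : seq nat) : coef (e n) (\sum_(k <- s) a k *: monomial w (e k)) =
      \sum_(k <- s) a k * (k == n)%:R.
    elim: s => [|k s IH].
      have c0 := coef_add (e n) (0 : entire (lorentz_predual w)) 0 (-1).
      by rewrite !big_nil; move: c0; rewrite scaler0 addr0 mulN1r subrr.
    rewrite !big_cons addrC coef_add IH coef_monomial addrC; congr (_ * _ + _).
    by rewrite (inj_eq (bij_inj e_enum)).
  have ca : (fun N => coef (e n) (series (fun n => a n *: monomial w (e n)) N) : R[i]^o) @ \oo
      --> (a n : R[i]^o).
    apply: cvg_near_cst; exists n.+1 => // N /= nN.
    rewrite /series /= big_mkord -(big_mkord xpredT (fun k => a k *: monomial w (e k))) coefS.
    rewrite big_mkord (bigD1 (Ordinal nN))//= eqxx mulr1 big1 ?addr0// => k kn.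
    rewrite (_ : (k == n :> nat) = false) ?mulr0//.
    by apply/negbTE; apply: contraNneq kn => kn; apply/eqP/val_inj.
  exact: (cvg_unique (@norm_hausdorff _ (R[i]^o)) ca cn).
Qed.
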